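(* In the steady two-dimensional Couette setting described in the context, there exists a family $\{\boldsymbol U_\nu\}_{0<\nu<1/8}$ of divergence-free velocity fields on $\Omega$, satisfying the Couette boundary conditions, with $$\nu\langle|\nabla\boldsymbol U_\nu|^2\rangle\sim\nu^{1/3},$$ such that, for some constant $c>0$ independent of $\nu$, the corresponding passive vector fields $\boldsymbol u_\nu$ satisfy $$\nu\langle|\nabla\boldsymbol u_\nu|^2\rangle\ge c\,\nu^{1/3}\qquad\text{for all }0<\nu<1/8.$$
   Context: Fix $L_1>0$, let $\mathbb T_{L_1}$ be the circle of length $L_1$, and let $\Omega=\mathbb T_{L_1}\times[-1/2,1/2]$ with coordinates $\boldsymbol x=(x_1,x_2)$; $\boldsymbol e_1$ is the unit vector in the $x_1$ direction. The Couette boundary conditions for a vector field $\boldsymbol w:\Omega\to\mathbb R^2$ are $\boldsymbol w(x_1,-1/2)=-\boldsymbol e_1/2$ and $\boldsymbol w(x_1,1/2)=\boldsymbol e_1/2$ for all $x_1\in\mathbb T_{L_1}$. The fields $\boldsymbol U_\nu$ are time-independent and belong to $L^\infty(\Omega)\cap H^1(\Omega)$. Given $\nu>0$ and $\boldsymbol U=\boldsymbol U_\nu$, the corresponding passive vector field $\boldsymbol u=\boldsymbol u_\nu\in H^1(\Omega)$ is the unique weak solution of $$\nabla\cdot\boldsymbol u=0,\qquad \boldsymbol U\cdot\nabla\boldsymbol u=-\nabla p+\nu\Delta\boldsymbol u$$ (with $p$ a scalar pressure on $\Omega$, hence periodic in $x_1$) satisfying the Couette boundary conditions. The angle brackets denote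 the volume average $\langle g\rangle=\frac1{|\Omega|}\int_\Omega g\,d\boldsymbol x$. $A_\nu\sim B_\nu$ means that there are constants $C_1,C_2>0$ independent of $\nu$ with $C_1B_\nu\le A_\nu\le C_2B_\nu$ for all $0<\nu<1/8$. *)

(* Defs.v *)
From mathcomp Require Import all_boot all_order all_algebra.
From mathcomp Require Import all_classical all_reals all_analysis.
Import Order.TTheory GRing.Theory Num.Theory.
Import numFieldNormedType.Exports.

Set Implicit Arguments.
Unset Strict Implicit.
Unset Printing Implicit Defensive.

Local Open Scope classical_set_scope.
Local Open Scope ring_scope.

(* A function on Omega = T_{L1} x [-1/2, 1/2] is represented by a function    *)
(* on R * R of which only the values on the fundamental cell [cell L1]        *)
(* matter. The circle T_{L1} enters through the test functions, which are     *)
(* L1-periodic in x1: a jump between x1 = 0 and x1 = L1 is incompatible with  *)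
(* having a weak gradient in L^2. The coordinates x1, x2 and the components   *)
(* of vectors are indexed by ord0, ord_max : 'I_2.                            *)

Definition cell (R : realType) (L1 : R) : set (R * R) :=
  `[0, L1]%classic `*` `[- 2^-1, 2^-1]%classic.

Notation leb2 R := (@lebesgue_measure R \x @lebesgue_measure R)%E.

(* < f > *)
Definition average (R : realType) (L1 : R) (f : R * R -> R) : R :=
  (fine ((leb2 R) (cell L1)))^-1 * \int[leb2 R]_(x in cell L1) f x.

Definition square_integrable (R : realType) (L1 : R) (f : R * R -> R) : Prop :=
  measurable_fun (cell L1) f /\
  (leb2 R).-integrable (cell L1) (fun x => (f x ^+ 2)%:E).

Definition basis_vector (R : realType) (j : 'I_2) : R * R :=
  if j == ord0 then (1, 0) else (0, 1).

Definition partial (R : realType) (j : 'I_2) (f : R * R -> R) : R * R -> R :=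
  fun x => 'D_(basis_vector R j) f x.

(* The space C^1_c of the open cylinder T_{L1} x (-1/2, 1/2); periodicity and *)
(* vanishing near |x2| = 1/2 make the support compact in the open cylinder.   *)
(* As in Gilbarg-Trudinger, C^1 test functions are used for first-order weak  *)
(* derivatives and for H^1_0.                                                 *)
Record test_function (R : realType) (L1 : R) (phi : R * R -> R) : Prop := {
  test_continuous : continuous phi ;
  test_derivable : forall j x, derivable phi x (basis_vector R j) ;
  test_C1 : forall j, continuous (partial j phi) ;
  test_periodic : forall x1 x2, phi (x1 + L1, x2) = phi (x1, x2) ;
  test_compact : exists2 d : R, 0 < d &
    forall x1 x2, 2^-1 - d <= `|x2| -> phi (x1, x2) = 0 }.

(* An element of H^1(Omega), packed with its (a.e. unique) weak gradient.     *)
Record H1 (R : realType) (L1 : R) := {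
  H1_fun :> R * R -> R ;
  grad : 'I_2 -> R * R -> R ;
  H1_L2 : square_integrable L1 H1_fun ;
  grad_L2 : forall j, square_integrable L1 (grad j) ;
  grad_weak : forall j phi, test_function L1 phi ->
    \int[leb2 R]_(x in cell L1) (H1_fun x * partial j phi x) =
    - \int[leb2 R]_(x in cell L1) (grad j x * phi x) }.

Definition vector_field (R : realType) (L1 : R) := 'I_2 -> H1 L1.

(* The function f, with weak gradient g, belongs to H^1_0(Omega), the H^1     *)
(* closure of the test functions. The integrals are extended-real valued, so  *)
(* that f - phi and g - grad phi are forced to have finite L^2 norms.         *)
Definition in_H10 (R : realType) (L1 : R)
    (f : R * R -> R) (g : 'I_2 -> R * R -> R) : Prop :=
  forall eps : R, 0 < eps -> exists2 phi, test_function L1 phi &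
    (\int[leb2 R]_(x in cell L1)
       ((f x - phi x) ^+ 2 + \sum_(j < 2) (g j x - partial j phi x) ^+ 2)%:E
     < eps%:E)%E.

(* The laminar profile x2 e1 and its gradient: boundary values in the sense   *)
(* of traces are prescribed by u - x2 e1 \in H^1_0.                           *)
Definition laminar (R : realType) (i : 'I_2) (x : R * R) : R :=
  if i == ord0 then x.2 else 0.

Definition laminar_grad (R : realType) (i j : 'I_2) (x : R * R) : R :=
  if (i == ord0) && (j == ord_max) then 1 else 0.

Definition couette_bc (R : realType) (L1 : R) (u : vector_field L1) : Prop :=
  forall i, in_H10 L1 (fun x => u i x - laminar i x)
                      (fun j x => grad (u i) j x - laminar_grad i j x).

Definition no_slip (R : realType) (L1 : R) (v : vector_field L1) : Prop :=
  forall i, in_H10 L1 (v i) (grad (v i)).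

Definition divergence_free (R : realType) (L1 : R) (u : vector_field L1) :
    Prop :=
  {ae leb2 R, forall x, cell L1 x -> \sum_(i < 2) grad (u i) i x = 0}.

Definition essentially_bounded (R : realType) (L1 : R) (u : vector_field L1) :
    Prop :=
  exists M : R, forall i, {ae leb2 R, forall x, cell L1 x -> `|u i x| <= M}.

(* grad u : grad v *)
Definition grad_dot (R : realType) (L1 : R) (u v : vector_field L1)
    (x : R * R) : R :=
  \sum_(i < 2) \sum_(j < 2) grad (u i) j x * grad (v i) j x.

(* nu < |grad u|^2 > *)
Definition dissipation (R : realType) (L1 nu : R) (u : vector_field L1) : R :=
  nu * average L1 (grad_dot u u).

(* (U . grad u) . v *)
Definition advection (R : realType) (L1 : R) (U u v : vector_field L1)
    (x : R * R) : R :=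
  \sum_(i < 2) (\sum_(j < 2) U j x * grad (u i) j x) * v i x.

(* Weak solutions of div u = 0, U . grad u = - grad p + nu Delta u with the   *)
(* Couette boundary conditions. The pressure is eliminated, as usual, by      *)
(* testing with the divergence-free fields of H^1_0. Since p is a function on *)
(* Omega, i.e. periodic in x1, fields v with a nonzero flux through the       *)
(* sections x1 = const are admissible too (no mean pressure gradient).        *)
Definition passive_field (R : realType) (L1 nu : R) (U u : vector_field L1) :
    Prop :=
  [/\ divergence_free u, couette_bc u &
      forall v : vector_field L1, divergence_free v -> no_slip v ->
        nu * (\int[leb2 R]_(x in cell L1) grad_dot u v x) +
        \int[leb2 R]_(x in cell L1) advection U u v x = 0].

(* Main.v *)
Require Import Defs.
From HB Require Import structures.
From mathcomp Require Import all_boot all_order all_algebra.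
From mathcomp Require Import all_classical all_reals all_analysis.
From mathcomp Require Import measurable_realfun ring lra.
Import Order.TTheory GRing.Theory Num.Theory.
Import numFieldNormedType.Exports.

(* Let m ~ nu^(1/6) be the inverse of an integer. The flow U is a mean shear  *)
(* carrying the wall values in layers of width m^4, plus a no-slip "pump" v   *)
(* of amplitude m: two waves m a(x2) sin(k0 (x1 - x2)), m b(x2) sin(k1 (x1 -  *)
(* x2)), k0 ~ m^-3, k1 ~ m^-4, corrected to be divergence-free, where a turns *)
(* on at distance m^2 from the walls, b at distance m^4, and a^2 + b^2 = 1    *)
(* beyond. The layers have just the right widths for all gradients to be      *)
(* O(m^-2) in L^2, whence nu |grad U|^2 = O(nu m^-4) = O(nu^(1/3)).           *)
(*                                                                            *)
(* Since the shear vanishes where v does not, U_j v_i = v_j v_i is, for all   *)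
(* i, j, equal to m^2 / 2 up to an oscillation O and an error O(m^4) in L^2.  *)
(* The wave vectors being multiples of (1, -1), (d1 + d2) O = d1 S with S of  *)
(* size m^4 in L^2. Testing the equation of u with v, and using that d2 u1 is *)
(* the only entry of grad u with a nonzero mean, bounds m^2 L1 / 2 by         *)
(* |grad u| (nu |grad v| + O(m^4)) = |grad u| O(m^4); hence |grad u| >= c /   *)
(* m^2. The same bound for U holds because d2 U1 is orthogonal to a^2 + b^2   *)
(* and 1 - a^2 - b^2 is O(m^2) in L^2. Weak solutions exist by Lax-Milgram.   *)

(** The dissipation of [u] is bounded below by duality, with one divergence-free no-slip test field
    [v] for which every product [U j * v i] is the constant m^2 / 2 up to negligible terms. In the
    weak equation this constant meets the mean of grad u, which the boundary values fix
    ([couette_mean_gradient]), and everything else is |grad u| times O(m^4). Hence m^2 <= C |grad u|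
    m^4, so that |grad u| >= c / m^2 and, since nu ~ m^6, nu |grad u|^2 >= c m^2 ~ nu^(1/3). The
    abstract estimate is [passive_lower_bound]; [oscillating_flux] disposes of the oscillating part
    of the products; [flux_pot_nrm], [flux_rem_nrm] and [flow_grad_le] supply the sizes m^4, m^4 and
    m^-2.

    A single wave of amplitude m would not serve this estimate. If its profile a turns on at
    distance w from the walls, the defect 1 - a^2 has L^2 norm of order sqrt w, which must be
    O(m^2), so w ~ m^4. The potential S then has norm of order m^2 / (k sqrt w) = 1 / k, which asks
    for k ~ m^-4, whereas a gradient of size m k in the bulk allows only k ~ m^-3. So the fast wave
    is confined to a layer of width m^2, where its gradient m^-3 costs only m^-2 in L^2, and the
    slow wave, which turns on over that layer, fills the rest.

    The upper bound for [U] is again [flow_grad_le], the lower one [flow_grad_lower]. Passive fields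
    exist ([passive_field_exists]) by [lax_milgram] applied to u - x2 e1: advection by a bounded
    divergence-free field is skew ([advection_skew]), so the viscous term alone gives coercivity.
    [flow_exists] collects these facts for m = 1 / n, and [scale_exists] chooses the integer n from
    nu. *)

Set Implicit Arguments.
Unset Strict Implicit.
Unset Printing Implicit Defensive.

Local Open Scope classical_set_scope.
Local Open Scope ring_scope.

(** * Square integrable functions *)

(* Locked: unifying the unfolded integrals of different functions is prohibitively slow. *)
HB.lock Definition ip d (T : measurableType d) (R : realType)
    (mu : {measure set T -> \bar R}) (D : set T) (f g : T -> R) : R :=
  \int[mu]_(x in D) (f x * g x).

Section square_integrable_functions.
Context d (T : measurableType d) (R : realType).
Variables (mu : {measure set T -> \bar R}) (D : set T).
Hypothesis mD : measurable D.
Implicit Types f g h : T -> R.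

(** For [leb2 R] and [cell L1] this is [square_integrable] up to unfolding, so the fields of [H1]
    records can be used directly. *)
Definition L2 f :=
  measurable_fun D f /\ mu.-integrable D (fun x => (f x ^+ 2)%:E).

Local Notation itg f := (mu.-integrable D (EFin \o f)).

Lemma L2_mul_integrable f g : L2 f -> L2 g -> itg (fun x => f x * g x).
Proof.
move=> [mf f2] [mg g2].
apply: (le_integrable mD _ _ (integrableD mD f2 g2)).
  by apply/measurable_EFinP; apply: measurable_funM.
move=> x Dx /=; rewrite lee_fin.
rewrite (ger0_norm (addr_ge0 (sqr_ge0 _) (sqr_ge0 _))) normrM.
rewrite -(real_normK (num_real (f x))) -(real_normK (num_real (g x))).
have := sqr_ge0 (`|f x| - `|g x|); have := sqr_ge0 (`|f x| + `|g x|); nra.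
Qed.

Lemma L2Z a f : L2 f -> L2 (fun x => a * f x).
Proof.
move=> [mf f2]; split; first exact: measurable_funM.
have := integrableZl mD (a ^+ 2) f2; apply: eq_integrable => // x _ /=.
by rewrite exprMn EFinM.
Qed.

Lemma L2D f g : L2 f -> L2 g -> L2 (fun x => f x + g x).
Proof.
move=> Lf Lg; split; first exact: measurable_funD (proj1 Lf) (proj1 Lg).
have := integrableD mD (integrableD mD (proj2 Lf) (proj2 Lg))
  (integrableZl mD 2 (L2_mul_integrable Lf Lg)).
apply: eq_integrable => // x _ /=; rewrite -!EFinM -!EFinD; congr _%:E; ring.
Qed.

Lemma L2N f : L2 f -> L2 (fun x => - f x).
Proof.
by move=> /(L2Z (-1)); congr L2; apply/funext => x; rewrite mulN1r.
Qed.

Lemma L2B f g : L2 f -> L2 g -> L2 (fun x => f x - g x).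
Proof. by move=> Lf /L2N; exact: L2D. Qed.

Lemma L2_le f g : measurable_fun D f -> L2 g ->
  (forall x, D x -> `|f x| <= `|g x|) -> L2 f.
Proof.
move=> mf [mg g2] fg; split=> //; apply: (le_integrable mD _ _ g2).
  by apply/measurable_EFinP; apply: measurable_funX.
move=> x Dx /=; rewrite lee_fin !normrX lerXn2r ?nnegrE //; exact: fg.
Qed.

Lemma bounded_integrable f (C : R) : (mu D < +oo)%E -> measurable_fun D f ->
  (forall x, D x -> `|f x| <= C) -> itg f.
Proof.
move=> fin mf fC; apply: measurable_bounded_integrable => //.
exists C; split; first exact: num_real.
by move=> M CM x /fC fxC; apply: le_trans fxC (ltW CM).
Qed.

Lemma L2_bounded f (C : R) : (mu D < +oo)%E -> measurable_fun D f ->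
  (forall x, D x -> `|f x| <= C) -> L2 f.
Proof.
move=> fin mf fC; apply: (@L2_le _ (fun=> C)) => //.
  split; first exact: measurable_cst.
  by apply: (@bounded_integrable (fun=> C ^+ 2) `|C ^+ 2|) => //; apply: measurable_cst.
by move=> x Dx; apply: le_trans (fC _ Dx) (ler_norm _).
Qed.

Lemma L2M_bounded f g (C : R) : measurable_fun D f -> L2 g ->
  (forall x, D x -> `|f x| <= C) -> L2 (fun x => f x * g x).
Proof.
move=> mf Lg fC; apply: (@L2_le _ (fun x => C * g x)) (L2Z _ Lg) _.
  exact: measurable_funM mf (proj1 Lg).
move=> x Dx; rewrite !normrM ler_wpM2r //.
by apply: le_trans (fC _ Dx) (ler_norm _).
Qed.

Local Notation ip := (ip mu D).

Lemma ipE f g : ip f g = \int[mu]_(x in D) (f x * g x).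
Proof. by rewrite ip.unlock. Qed.

Lemma ipC f g : ip f g = ip g f.
Proof. by rewrite !ipE; apply: eq_Rintegral => x _; rewrite mulrC. Qed.

Lemma eq_ip f f' g g' : {in D, f =1 f'} -> {in D, g =1 g'} ->
  ip f g = ip f' g'.
Proof. by move=> ff' gg'; rewrite !ipE; apply: eq_Rintegral => x Dx; rewrite ff' // gg'. Qed.

Lemma ip0l f : ip (fun=> 0) f = 0.
Proof.
rewrite ipE; transitivity (\int[mu]_(x in D) (0 : R)); last by rewrite Rintegral_cst // mul0r.
by apply: eq_Rintegral => x _; rewrite mul0r.
Qed.

Lemma ipDl f g h : L2 f -> L2 g -> L2 h ->
  ip (fun x => f x + g x) h = ip f h + ip g h.
Proof.
move=> Lf Lg Lh; rewrite !ipE -RintegralD //; try exact: L2_mul_integrable.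
by apply: eq_Rintegral => x _; rewrite mulrDl.
Qed.

Lemma ipZl a f h : L2 f -> L2 h -> ip (fun x => a * f x) h = a * ip f h.
Proof.
move=> Lf Lh; rewrite !ipE -RintegralZl //; last exact: L2_mul_integrable.
by apply: eq_Rintegral => x _; rewrite mulrA.
Qed.

Lemma ipDr f g h : L2 f -> L2 g -> L2 h ->
  ip h (fun x => f x + g x) = ip h f + ip h g.
Proof. by move=> *; rewrite ipC ipDl // ipC (ipC g). Qed.

Lemma ipZr a f h : L2 f -> L2 h -> ip h (fun x => a * f x) = a * ip h f.
Proof. by move=> *; rewrite ipC ipZl // ipC. Qed.

Lemma ipBl f g h : L2 f -> L2 g -> L2 h ->
  ip (fun x => f x - g x) h = ip f h - ip g h.
Proof.
move=> Lf Lg Lh; rewrite ipDl //; last exact: L2N.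
rewrite -[in RHS]mulN1r -ipZl //; congr (_ + _).
by apply: eq_ip => // x _; rewrite mulN1r.
Qed.

Lemma ipBr f g h : L2 f -> L2 g -> L2 h ->
  ip h (fun x => f x - g x) = ip h f - ip h g.
Proof. by move=> *; rewrite ipC ipBl // ipC (ipC g). Qed.

Lemma ip_ge0 f : 0 <= ip f f.
Proof. by rewrite ipE; apply: Rintegral_ge0 => x _; rewrite -expr2 sqr_ge0. Qed.

Lemma ip_sqr f : ip f f = \int[mu]_(x in D) f x ^+ 2.
Proof. by rewrite ipE; apply: eq_Rintegral => x _; rewrite expr2. Qed.

Lemma le_ip f g : L2 f -> L2 g ->
  (forall x, D x -> `|f x| <= `|g x|) -> ip f f <= ip g g.
Proof.
move=> Lf Lg fg; rewrite !ipE; apply: le_Rintegral => //; try exact: L2_mul_integrable.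
move=> x Dx; have : `|f x| ^+ 2 <= `|g x| ^+ 2.
  by rewrite lerXn2r ?nnegrE // fg.
by rewrite !real_normK ?num_real // !expr2.
Qed.

Lemma ip_add f g : L2 f -> L2 g ->
  ip (fun x => f x + g x) (fun x => f x + g x) = ip f f + ip f g *+ 2 + ip g g.
Proof.
move=> Lf Lg; have Lfg := L2D Lf Lg.
rewrite (ipDl Lf Lg Lfg) (ipDr Lf Lg Lf) (ipDr Lf Lg Lg) (ipC g f); ring.
Qed.

Lemma ip_sub f g : L2 f -> L2 g ->
  ip (fun x => f x - g x) (fun x => f x - g x) = ip f f - ip f g *+ 2 + ip g g.
Proof.
move=> Lf Lg; have Lfg := L2B Lf Lg.
rewrite (ipBl Lf Lg Lfg) (ipBr Lf Lg Lf) (ipBr Lf Lg Lg) (ipC g f); ring.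
Qed.

Lemma ipD_le f g : L2 f -> L2 g ->
  ip (fun x => f x + g x) (fun x => f x + g x) <= (ip f f + ip g g) *+ 2.
Proof.
move=> Lf Lg; have := ip_ge0 (fun x => f x - g x).
by rewrite ip_sub // ip_add //; lra.
Qed.

Lemma L2_0 : L2 (fun=> 0).
Proof.
split; first exact: measurable_cst.
have := integrable0 mu D; apply: eq_integrable => // x _ /=.
by rewrite expr0n.
Qed.

Lemma L2_sum (n : nat) (F : 'I_n -> T -> R) :
  (forall i, L2 (F i)) -> L2 (fun x => \sum_(i < n) F i x).
Proof.
elim: n F => [|n IH] F LF.
  rewrite (_ : (fun _ => _) = (fun=> 0)); first exact: L2_0.
  by apply/funext => x; rewrite big_ord0.
rewrite (_ : (fun _ => _) = fun x => F ord0 x + \sum_(i < n) F (lift ord0 i) x).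
  by apply: L2D => //; apply: IH.
by apply/funext => x; rewrite big_ord_recl.
Qed.

Lemma ip_sum (n : nat) (F : 'I_n -> T -> R) h : (forall i, L2 (F i)) -> L2 h ->
  ip (fun x => \sum_(i < n) F i x) h = \sum_(i < n) ip (F i) h.
Proof.
move=> LF Lh; elim: n F LF => [|n IH] F LF.
  rewrite big_ord0; apply: etrans (ip0l h).
  by apply: eq_ip => // x _; rewrite big_ord0.
rewrite big_ord_recl -IH; last by move=> i; apply: LF.
rewrite -ipDl //; last exact: L2_sum.
by apply: eq_ip => // x _; rewrite big_ord_recl.
Qed.

End square_integrable_functions.

Lemma discriminant_bound (R : realFieldType) (a b c : R) : 0 <= a ->
  (forall t, 0 <= a * t ^+ 2 + b * t *+ 2 + c) -> b ^+ 2 <= a * c.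
Proof.
move=> a0 H; have [a00|an0] := eqVneq a 0.
  have [->|b0] := eqVneq b 0; first by rewrite a00 mul0r expr0n.
  (* With [a = 0] the function is affine; it is nonnegative at 0, which gives c >= 0, and takes the
     value - c - 2 at t = - (c + 1) / b. *)
  have E t : 0 <= b * t *+ 2 + c by have := H t; rewrite a00 mul0r add0r.
  have := E (- (c + 1) / b); rewrite mulrCA divff // mulr1.
  have := E ((c + 1) / b); rewrite mulrCA divff // mulr1.
  have := E 0; rewrite mulr0 mul0rn add0r; lra.
have a_gt0 : 0 < a by rewrite lt_def an0.
have := H (- b / a).
have -> : a * (- b / a) ^+ 2 + b * (- b / a) *+ 2 + c = (a * c - b ^+ 2) / a by field.
by rewrite pmulr_lge0 ?invr_gt0 // subr_ge0.
Qed.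

Lemma cauchy_schwarz d (T : measurableType d) (R : realType)
    (mu : {measure set T -> \bar R}) (D : set T) (f g : T -> R) :
  measurable D -> L2 mu D f -> L2 mu D g ->
  ip mu D f g ^+ 2 <= ip mu D f f * ip mu D g g.
Proof.
move=> mD Lf Lg; apply: discriminant_bound; first exact: ip_ge0.
move=> t; have := ip_ge0 mu D (fun x => t * f x + g x).
have Ltf : L2 mu D (fun x => t * f x) by exact: L2Z.
rewrite ipDl ?ipDr ?ipZr ?ipZl //; try exact: L2D.
by rewrite (ipC _ _ g f); congr (_ <= _); ring.
Qed.

(** * Measurability in the plane and integration over the cell *)

Lemma open_measurable_prod (R : realType) (O : set (R * R)) :
  open O -> measurable O.
Proof.
(* Squares with rational centre and half-side: countably many, and measurable for the product
   sigma-algebra. *)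
move=> oO; pose B (k : rat * rat * rat) : set (R * R) :=
  `](ratr k.1.1 - ratr k.2), (ratr k.1.1 + ratr k.2)[%classic `*`
  `](ratr k.1.2 - ratr k.2), (ratr k.1.2 + ratr k.2)[%classic.
have -> : O = \bigcup_k (if `[< B k `<=` O >] then B k else set0).
  apply/seteqP; split => [[x y] Oxy|x [k _]]; last first.
    by case: ifPn => [/asboolP|//]; exact.
  have /nbhs_ballP[e /= e0 He] : nbhs (x, y) O by exact: open_nbhs_nbhs.
  have e20 : 0 < e / 2 by rewrite divr_gt0.
  have [r] := rat_in_itvoo e20; rewrite in_itv /= => /andP[r0 re].
  have xr : x - ratr r < x + ratr r by lra.
  have yr : y - ratr r < y + ratr r by lra.
  have [p] := rat_in_itvoo xr; rewrite in_itv /= => /andP[px xp].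
  have [q] := rat_in_itvoo yr; rewrite in_itv /= => /andP[qy yq].
  exists (p, q, r) => //=; case: ifPn => [_|/asboolP[]].
    by split; rewrite /= in_itv /=; apply/andP; split; lra.
  move=> [x' y'] [/=]; rewrite !in_itv /= => /andP[? ?] /andP[? ?].
  by apply: He; split; rewrite /ball /= ltr_norml; apply/andP; split; lra.
apply: countable_bigcupT_measurable => // k; case: ifP => // _.
by apply: measurableX; exact: measurable_itv.
Qed.

Lemma continuous_measurable_prod (R : realType) (D : set (R * R))
  (f : R * R -> R) : continuous f -> measurable_fun D f.
Proof.
move=> cf; apply: (measurable_funS measurableT (subsetT _)).
apply: (measurability _ (RGenOpens.measurableE R)).
move=> _ [_ [a [b ->] <-]]; rewrite setTI; apply: open_measurable_prod.
by move/continuousP: cf; apply; exact: interval_open.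
Qed.

Section cell.
Context (R : realType) (L1 : R).
Hypothesis hL1 : 0 < L1.
Implicit Types f g : R * R -> R.

Lemma measurable_cell :
  measurable (cell L1 : set (measurableTypeR R * measurableTypeR R)).
Proof. by apply: measurableX; exact: measurable_itv. Qed.

Lemma lebesgue_measure_segment (a b : R) : a <= b ->
  lebesgue_measure (`[a, b]%classic : set R) = (b - a)%:E.
Proof.
rewrite lebesgue_measure_itv /= lte_fin le_eqVlt => /predU1P[->|->//].
by rewrite ltxx subrr.
Qed.

Lemma leb2_rectangle (a b c e : R) : a <= b -> c <= e ->
  leb2 R (`[a, b]%classic `*` `[c, e]%classic) = ((b - a) * (e - c))%:E.
Proof.
move=> ab ce; rewrite product_measure1E; [|exact: measurable_itv..].
by rewrite EFinM; congr mule; exact: lebesgue_measure_segment.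
Qed.

Lemma cell_measure : leb2 R (cell L1) = L1%:E.
Proof.
rewrite leb2_rectangle; [|exact: ltW|lra].
by congr _%:E; field.
Qed.

Lemma cell_finite : (leb2 R (cell L1) < +oo)%E.
Proof. by rewrite cell_measure ltry. Qed.

Lemma continuous_bounded_cell f : continuous f ->
  exists C, forall x, cell L1 x -> `|f x| <= C.
Proof.
move=> cf; have : compact (f @` cell L1).
  apply: continuous_compact; first exact: continuous_subspaceT.
  by apply: compact_setX; exact: segment_compact.
move=> /compact_bounded [M [_ HM]]; exists (M + 1) => x cx.
by apply: HM; [rewrite ltrDl|exists x].
Qed.

Lemma continuous_L2 f : continuous f -> L2 (leb2 R) (cell L1) f.
Proof.
move=> cf; have [C fC] := continuous_bounded_cell cf.
apply: (@L2_bounded _ _ R (leb2 R) _ measurable_cell f C cell_finite _ fC).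
exact: continuous_measurable_prod.
Qed.

Lemma continuous_integrable f : continuous f ->
  (leb2 R).-integrable (cell L1) (EFin \o f).
Proof.
move=> cf; have [C fC] := continuous_bounded_cell cf.
apply: (@bounded_integrable _ _ R (leb2 R) _ measurable_cell f C cell_finite _ fC).
exact: continuous_measurable_prod.
Qed.

(** Fubini is applied on the whole plane, to the extension by zero, which has to be recognised slice
    by slice. *)
Lemma cell_patch f x y : ((EFin \o f) \_ (cell L1)) (x, y) =
  (((fun x => ((fun y => (f (x, y))%:E) \_ `[- 2^-1, 2^-1]) y) \_ `[0, L1]) x).
Proof.
rewrite /patch /cell !mem_setE; case: (boolP (x \in _)) => xL.
  case: (boolP (y \in _)) => yL; first by rewrite ifT // inE; split.
  by rewrite ifF //; apply/negbTE; rewrite notin_setE => -[_ /=]; apply/negP.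
by rewrite ifF //; apply/negbTE; rewrite notin_setE => -[/= + _]; apply/negP.
Qed.

(** Fubini for vanishing inner integrals: below, these are integrals of exact derivatives. *)
Lemma Rintegral_cell0_1 f : continuous f ->
  (forall y, (\int[lebesgue_measure]_(x in `[0%R, L1]) (f (x, y))%:E = 0)%E) ->
  \int[leb2 R]_(x in cell L1) f x = 0.
Proof.
move=> cf f0; rewrite /Rintegral integral_mkcond -integral21_prod_meas1; last first.
  by rewrite -integrable_mkcond; [exact: continuous_integrable|exact: measurable_cell].
rewrite integral0_eq // => y _; rewrite /fubini_G.
transitivity (\int[@lebesgue_measure R]_(x in `[0%R, L1])
    (((fun y : R => (f (x, y))%:E) \_ `[(- 2^-1)%R, 2^-1%R]%classic) y))%E.
  apply: etrans; last by apply/esym; exact: integral_mkcond.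
  by apply: eq_integral => x _; exact: cell_patch.
rewrite /patch; case: (y \in _); first exact: f0.
by rewrite integral0.
Qed.

Lemma Rintegral_cell0_2 f : continuous f ->
  (forall x, (\int[lebesgue_measure]_(y in `[(- 2^-1)%R, 2^-1%R]) (f (x, y))%:E = 0)%E) ->
  \int[leb2 R]_(x in cell L1) f x = 0.
Proof.
move=> cf f0; rewrite /Rintegral integral_mkcond -integral12_prod_meas1; last first.
  by rewrite -integrable_mkcond; [exact: continuous_integrable|exact: measurable_cell].
rewrite integral0_eq // => x _; rewrite /fubini_F.
transitivity (\int[@lebesgue_measure R]_y (if x \in `[0%R, L1] then
   ((fun y : R => (f (x, y))%:E) \_ `[(- 2^-1)%R, 2^-1%R]%classic) y else 0%E))%E.
  by apply: eq_integral => y _; rewrite cell_patch /patch mem_setE.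
case: (x \in _); last by rewrite integral0.
by rewrite -(f0 x); apply/esym; exact: integral_mkcond.
Qed.

End cell.

(** * Continuously differentiable functions *)

Lemma continuous_slice1 (R : realType) (h : R * R -> R) (y : R) :
  continuous h -> continuous (fun t => h (t, y)).
Proof.
move=> ch t.
have H : {for t, continuous (fun s : R => (s, y))} by exact: (cvg_pair cvg_id (cvg_cst y)).
exact: (@continuous_comp R (R * R)%type R (fun s => (s, y)) h t H (ch (t, y))).
Qed.
Lemma continuous_slice2 (R : realType) (h : R * R -> R) (x : R) :
  continuous h -> continuous (fun t => h (x, t)).
Proof.
move=> ch t.
have H : {for t, continuous (fun s : R => (x, s))} by exact: (cvg_pair (cvg_cst x) cvg_id).
exact: (@continuous_comp R (R * R)%type R (fun s => (x, s)) h t H (ch (x, t))).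
Qed.

Section gradients.
Context (R : realType).
Implicit Types (f : R * R -> R) (g : 'I_2 -> R * R -> R).

(** The gradient is a parameter rather than [partial j f], so that the calculus rules below produce
    it as an explicit formula; [C1_partial] returns to [partial]. *)
Record C1_gradient f g : Prop := {
  C1_continuous : continuous f ;
  C1_derive : forall j x, is_derive x (basis_vector R j) f (g j x) ;
  C1_gradient_continuous : forall j, continuous (g j) }.

(** Both sides have the same difference quotients. This gives access to the one-variable chain
    rule. *)
Lemma is_derive_line f (x v : R * R) (df : R) :
  is_derive x v f df <-> is_derive (0 : R) 1 (fun t => f (t *: v + x)) df.
Proof.
have E : (fun h : R => h^-1 *: ((f \o shift x) (h *: v) - f x)) =
    (fun h : R => h^-1 *: (((fun t => f (t *: v + x)) \o shift (0 : R)) (h *: 1) -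
                           f (0 *: v + x))).
  by apply/funext => h /=; rewrite addr0 scale0r add0r /GRing.scale /= mulr1.
by split=> -[d e]; (split; [move: d|move: e]);
  rewrite /derivable /derive E.
Qed.

Lemma C1_comp (h h' : R -> R) f g : (forall y : R, is_derive y 1 h (h' y)) ->
  continuous h' -> C1_gradient f g ->
  C1_gradient (fun x => h (f x)) (fun j x => h' (f x) * g j x).
Proof.
move=> dh ch' [cf df cg]; split.
- have ch : continuous h.
    by move=> y; apply: differentiable_continuous; apply/derivable1_diffP; case: (dh y).
  by move=> x; apply: continuous_comp; [exact: cf|exact: ch].
- move=> j x; apply/is_derive_line.
  have /is_derive_line d1 := df j x.
  have d2 : is_derive (f (0 *: basis_vector R j + x)) 1 h (h' (f x)).
    by rewrite scale0r add0r.
  have := @is_derive1_comp _ _ _ _ _ _ d2 d1.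
  exact.
- move=> j x; apply: cvgM; last exact: cg.
  by apply: continuous_comp; [exact: cf|exact: ch'].
Qed.

Lemma C1D f1 f2 g1 g2 : C1_gradient f1 g1 -> C1_gradient f2 g2 ->
  C1_gradient (fun x => f1 x + f2 x) (fun j x => g1 j x + g2 j x).
Proof.
move=> [cf1 df1 cg1] [cf2 df2 cg2]; split.
- by move=> x; apply: cvgD; [exact: cf1|exact: cf2].
- by move=> j x; apply: is_deriveD.
- by move=> j x; apply: cvgD; [exact: cg1|exact: cg2].
Qed.

Lemma C1M f1 f2 g1 g2 : C1_gradient f1 g1 -> C1_gradient f2 g2 ->
  C1_gradient (fun x => f1 x * f2 x)
    (fun j x => f1 x * g2 j x + f2 x * g1 j x).
Proof.
move=> [cf1 df1 cg1] [cf2 df2 cg2]; split.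
- by move=> x; apply: cvgM; [exact: cf1|exact: cf2].
- by move=> j x; apply: is_deriveM.
- move=> j x; apply: cvgD; apply: cvgM;
    by [exact: cf1|exact: cf2|exact: cg1|exact: cg2].
Qed.

Lemma C1_cst (c : R) : C1_gradient (fun=> c) (fun _ _ => 0).
Proof.
split; [by move=> x; exact: cvg_cst| |by move=> j x; exact: cvg_cst].
by move=> j x; exact: is_derive_cst.
Qed.

Lemma C1Z (c : R) f g : C1_gradient f g ->
  C1_gradient (fun x => c * f x) (fun j x => c * g j x).
Proof.
move=> fg; have := C1M (C1_cst c) fg; congr C1_gradient.
by apply/funext => j; apply/funext => x; rewrite mulr0 addr0.
Qed.

Lemma C1N f g : C1_gradient f g ->
  C1_gradient (fun x => - f x) (fun j x => - g j x).
Proof.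
move=> /(C1Z (-1)); congr C1_gradient; first by apply/funext => x; rewrite mulN1r.
by apply/funext => j; apply/funext => x; rewrite mulN1r.
Qed.

Lemma C1B f1 f2 g1 g2 : C1_gradient f1 g1 -> C1_gradient f2 g2 ->
  C1_gradient (fun x => f1 x - f2 x) (fun j x => g1 j x - g2 j x).
Proof. by move=> fg1 /C1N; exact: C1D. Qed.

Lemma is_derive_affine (a b t : R) : is_derive t 1 (fun s => s * a + b) a.
Proof.
have d1 : is_derive t 1 (fun s : R => s * a) a.
  have := @is_deriveM _ _ id (cst a) t 1 _ _ (is_derive_id _ _) (is_derive_cst _ _ _).
  by move=> H; apply: is_derive_eq; rewrite /= scaler0 add0r /GRing.scale /= mulr1.
have := @is_deriveD _ _ _ _ (cst b) t 1 _ _ d1 (is_derive_cst _ _ _).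
by rewrite addr0.
Qed.

Lemma C1_fst : C1_gradient (fun x => x.1) (fun j _ => (basis_vector R j).1).
Proof.
split; [by move=> x; exact: cvg_fst| |by move=> j x; exact: cvg_cst].
move=> j x; apply/is_derive_line => /=.
exact: (is_derive_affine (basis_vector R j).1 x.1 0).
Qed.

Lemma C1_snd : C1_gradient (fun x => x.2) (fun j _ => (basis_vector R j).2).
Proof.
split; [by move=> x; exact: cvg_snd| |by move=> j x; exact: cvg_cst].
move=> j x; apply/is_derive_line => /=.
exact: (is_derive_affine (basis_vector R j).2 x.2 0).
Qed.

Lemma eq_C1 f f' g g' : f =1 f' -> (forall j, g j =1 g' j) ->
  C1_gradient f g -> C1_gradient f' g'.
Proof.
move=> ff' gg'; congr C1_gradient; first exact/funext.
by apply/funext => j; apply/funext => x; exact: gg'.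
Qed.

Lemma C1_partial f g : C1_gradient f g -> forall j, partial j f = g j.
Proof.
by move=> [_ df _] j; apply/funext => x; rewrite /partial; exact: derive_val.
Qed.

Lemma test_C1_gradient (L1 : R) f :
  test_function L1 f -> C1_gradient f (fun j => partial j f).
Proof.
move=> [cf df c1 _ _]; by split => // j x; exact/derivableP.
Qed.

Lemma C1_test (L1 d : R) f g : C1_gradient f g ->
  (forall x1 x2, f (x1 + L1, x2) = f (x1, x2)) -> 0 < d ->
  (forall x1 x2, 2^-1 - d <= `|x2| -> f (x1, x2) = 0) ->
  test_function L1 f.
Proof.
move=> fg per d0 van; have pE := C1_partial fg; case: fg => cf df cg.
split; [exact: cf| | |exact: per|by exists d].
- by move=> j x; case: (df j x).
- by move=> j; rewrite pE; exact: cg.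
Qed.

Lemma test_near_wall (L1 : R) f : test_function L1 f -> exists2 d : R, 0 < d &
  forall x, 2^-1 - d <= `|x.2| -> f x = 0.
Proof. by case=> _ _ _ _ [d d0 H]; exists d => // -[x1 x2]; exact: H. Qed.

Lemma is_derive_slice1 f g (x y : R) : C1_gradient f g ->
  is_derive x 1 (fun t => f (t, y)) (g ord0 (x, y)).
Proof.
move=> [_ /(_ ord0 (x, y)) /is_derive_line d _].
rewrite (_ : (fun t => f (t, y)) =
  (fun t => f (t *: basis_vector R ord0 + (x, y))) \o (fun t : R => t - x)); last first.
  by apply/funext => t /=; congr f; congr pair; rewrite /= /GRing.scale /=; ring.
have d1 : is_derive x 1 (fun t : R => t - x) 1.
  by have := is_derive_affine 1 (- x) x; under eq_fun do rewrite mulr1.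
rewrite -[g _ _]mulr1; apply: is_derive1_comp.
by rewrite subrr.
Qed.

Lemma is_derive_slice2 f g (x y : R) : C1_gradient f g ->
  is_derive y 1 (fun t => f (x, t)) (g ord_max (x, y)).
Proof.
move=> [_ /(_ ord_max (x, y)) /is_derive_line d _].
rewrite (_ : (fun t => f (x, t)) =
  (fun t => f (t *: basis_vector R ord_max + (x, y))) \o (fun t : R => t - y)); last first.
  by apply/funext => t /=; congr f; congr pair; rewrite /= /GRing.scale /=; ring.
have d1 : is_derive y 1 (fun t : R => t - y) 1.
  by have := is_derive_affine 1 (- y) y; under eq_fun do rewrite mulr1.
rewrite -[g _ _]mulr1; apply: is_derive1_comp.
by rewrite subrr.
Qed.

Lemma FTC_is_derive (F f : R -> R) (a b : R) : a < b ->
  (forall t : R, is_derive t 1 F (f t)) -> continuous f ->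
  (\int[lebesgue_measure]_(x in `[a, b]) (f x)%:E = (F b - F a)%:E)%E.
Proof.
move=> ab dF cf.
have cF : continuous F.
  by move=> y; apply: differentiable_continuous; apply/derivable1_diffP; case: (dF y).
rewrite (@continuous_FTC2 _ f F) ?EFinB //.
- exact: continuous_subspaceT.
- split; first by move=> t _; case: (dF t).
  + by apply: cvg_at_right_filter; exact: cF.
  + by apply: cvg_at_left_filter; exact: cF.
- by move=> t _; rewrite derive1E; exact: derive_val.
Qed.

Lemma Rintegral_gradient1 (L1 : R) f g : 0 < L1 -> C1_gradient f g ->
  (forall x1 x2, f (x1 + L1, x2) = f (x1, x2)) ->
  \int[leb2 R]_(x in cell L1) g ord0 x = 0.
Proof.
move=> L0 fg per; apply: Rintegral_cell0_1 => //.
  exact: (C1_gradient_continuous fg).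
move=> y; have cg : continuous (fun t => g ord0 (t, y)).
  by apply: continuous_slice1; exact: (C1_gradient_continuous fg).
have -> := FTC_is_derive L0 (fun t => is_derive_slice1 t y fg) cg.
by rewrite -{1}(add0r L1) per subrr.
Qed.

Lemma Rintegral_gradient2 (L1 : R) f g : 0 < L1 -> C1_gradient f g ->
  (forall x1, f (x1, - 2^-1) = f (x1, 2^-1)) ->
  \int[leb2 R]_(x in cell L1) g ord_max x = 0.
Proof.
move=> L0 fg van; apply: Rintegral_cell0_2 => //.
  exact: (C1_gradient_continuous fg).
move=> x; have cg : continuous (fun t => g ord_max (x, t)).
  by apply: continuous_slice2; exact: (C1_gradient_continuous fg).
have lt : - 2^-1 < 2^-1 :> R by lra.
have -> := FTC_is_derive lt (fun t => is_derive_slice2 x t fg) cg.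
by rewrite van subrr.
Qed.

Lemma ord2P (j : 'I_2) : j = ord0 \/ j = ord_max.
Proof. by case: j => -[|[|//]] ?; [left|right]; apply/val_inj. Qed.

Lemma test_gradient_integral (L1 : R) f (j : 'I_2) : 0 < L1 ->
  test_function L1 f -> \int[leb2 R]_(x in cell L1) partial j f x = 0.
Proof.
move=> L0 tf; have fg := test_C1_gradient tf.
have [d d0 van] := test_near_wall tf.
case: (ord2P j) => ->.
  by apply: (Rintegral_gradient1 L0 fg); exact: test_periodic tf.
apply: (Rintegral_gradient2 L0 fg) => x1.
by rewrite !van //= ?normrN ger0_norm; lra.
Qed.

End gradients.

(** * The Lax-Milgram theorem *)

Lemma le0_small (R : realFieldType) (x C : R) : 0 <= C ->
  (forall e, 0 < e -> x <= e * C) -> x <= 0.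
Proof.
move=> C0 H; rewrite leNgt; apply/negP => x0.
have e0 : 0 < x / 2 / (C + 1) by rewrite !divr_gt0 // ltr_wpDl.
have := H _ e0; rewrite mulrAC ler_pdivlMr ?ltr_wpDl //; nra.
Qed.

Lemma geometric_small (R : archiRealFieldType) (q r : R) : 0 <= q < 1 -> 0 <= r ->
  forall e, 0 < e -> exists n, q ^+ n * r <= e.
Proof.
move=> /andP[q0 q1] r0 e e0; have [->|qn0] := eqVneq q 0.
  by exists 1%N; rewrite mul0r ltW.
have qp : 0 < q by rewrite lt_def qn0.
(* Bernoulli's inequality for 1 / q. *)
have bern n : 1 + n%:R * (q^-1 - 1) <= (q^-1) ^+ n.
  elim: n => [|n IH]; first by rewrite mul0r addr0 expr0.
  have q1' : 0 <= q^-1 - 1 by rewrite subr_ge0 invf_ge1 // ltW.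
  rewrite exprS -natr1; have n0 : 0 <= n%:R :> R by rewrite ler0n.
  set a := q^-1 in IH q1' *; set b := a ^+ n in IH *; set c := n%:R in IH n0 *.
  have := mulr_ge0 n0 (mulr_ge0 q1' q1').
  nra.
have d0 : 0 < q^-1 - 1 by rewrite subr_gt0 invf_gt1.
have [n Hn] : exists n : nat, r / e / (q^-1 - 1) <= n%:R.
  exists (Num.truncn (r / e / (q^-1 - 1))).+1; apply: ltW.
  exact: truncnS_gt.
exists n; rewrite -(invrK (q ^+ n)) -exprVn mulrC ler_pdivrMr ?exprn_gt0 ?invr_gt0 //.
apply: le_trans (ler_wpM2l (ltW e0) (bern n)).
move: Hn; rewrite ler_pdivrMr // ler_pdivrMr // mulrC; nra.
Qed.

Section lax_milgram.
Context (R : realType) (E : lmodType R) (X : set E) (sp : E -> E -> R).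
Hypothesis X0 : X 0.
Hypothesis XL : forall a u v, X u -> X v -> X (a *: u + v).
Hypothesis spL : forall a u v w, X u -> X v -> X w ->
  sp (a *: u + v) w = a * sp u w + sp v w.
Hypothesis spC : forall u v, X u -> X v -> sp u v = sp v u.
Hypothesis sp_ge0 : forall u, X u -> 0 <= sp u u.
Hypothesis sp_complete : forall u : nat -> E, (forall n, X (u n)) ->
  (forall n, sp (u n.+1 - u n) (u n.+1 - u n) <= (4^-1) ^+ n) ->
  exists2 v, X v & forall e, 0 < e ->
    exists N, forall n, (N <= n)%N -> sp (u n - v) (u n - v) <= e.

Definition linear_on (g : E -> R) := forall a u v, X u -> X v ->
  g (a *: u + v) = a * g u + g v.

Lemma linear_on_comb g a b u v : linear_on g -> X u -> X v ->
  g (a *: u + b *: v) = a * g u + b * g v.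
Proof.
move=> gL Xu Xv; have Xbv : X (b *: v) by rewrite -[_ *: _]addr0; apply: XL.
rewrite gL //; congr (_ + _); rewrite -[b *: v]addr0 gL //.
by have := gL (-1) 0 0 X0 X0; rewrite scaler0 addr0; lra.
Qed.

Lemma linear_onB g u v : linear_on g -> X u -> X v -> g (u - v) = g u - g v.
Proof.
move=> gL Xu Xv; rewrite -(scale1r u) -scaleN1r linear_on_comb // scale1r; ring.
Qed.

Lemma X_comb a b u v : X u -> X v -> X (a *: u + b *: v).
Proof. by move=> Xu Xv; apply: XL => //; rewrite -[_ *: _]addr0; apply: XL. Qed.

Lemma X_sub u v : X u -> X v -> X (u - v).
Proof. by move=> Xu Xv; rewrite -(scale1r u) -scaleN1r; apply: X_comb. Qed.

Lemma sp_linear w : X w -> linear_on (sp ^~ w).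
Proof. by move=> Xw a u v Xu Xv; apply: spL. Qed.

Lemma sp_comb a b u v : X u -> X v ->
  sp (a *: u + b *: v) (a *: u + b *: v) =
  a ^+ 2 * sp u u + (a * b * sp u v) *+ 2 + b ^+ 2 * sp v v.
Proof.
move=> Xu Xv; have Xc := X_comb a b Xu Xv.
rewrite (linear_on_comb _ _ (sp_linear Xc)) // (spC Xu Xc) (spC Xv Xc).
rewrite (linear_on_comb _ _ (sp_linear Xu)) // (linear_on_comb _ _ (sp_linear Xv)) //.
rewrite (spC Xv Xu); ring.
Qed.

Lemma sp_sub u v : X u -> X v ->
  sp (u - v) (u - v) = sp u u - sp u v *+ 2 + sp v v.
Proof.
move=> Xu Xv; have := sp_comb 1 (-1) Xu Xv; rewrite scale1r scaleN1r => ->; ring.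
Qed.

Lemma sp_cauchy_schwarz u v : X u -> X v -> sp u v ^+ 2 <= sp u u * sp v v.
Proof.
move=> Xu Xv; apply: discriminant_bound; first exact: sp_ge0.
move=> t; have := sp_ge0 (X_comb t 1 Xu Xv); rewrite sp_comb //; congr (_ <= _); ring.
Qed.

(** The representative minimises [J z] = |z|^2 - 2 g z. The form [sp] is only semidefinite, since
    functions are not identified almost everywhere, so [z] is characterised by its products with the
    elements of [X] alone. *)
Lemma riesz (g : E -> R) (K : R) : linear_on g ->
  (forall v, X v -> g v ^+ 2 <= K * sp v v) ->
  exists2 z, X z & forall w, X w -> g w = sp z w.
Proof.
move=> gL gB'; pose K' := `|K|.
have K0 : 0 <= K' by exact: normr_ge0.
have gB v : X v -> g v ^+ 2 <= K' * sp v v.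
  move=> Xv; apply: le_trans (gB' v Xv) _; apply: ler_wpM2r; first exact: sp_ge0.
  exact: ler_norm.
pose J z := sp z z - g z *+ 2; pose S := [set J z | z in X].
have JK z : X z -> - K' <= J z.
  move=> Xz; have := gB z Xz; have := sp_ge0 Xz; rewrite /J.
  move: (sp z z) (g z) => s t s0 H; rewrite leNgt; apply/negP => c.
  have c1 : s + K' < t *+ 2 by lra.
  have : (s + K') ^+ 2 < (t *+ 2) ^+ 2 by rewrite ltrXn2r // ?addr_ge0 //; lra.
  have := sqr_ge0 (s - K'); nra.
have hS : has_inf S.
  split; first by exists (J 0), 0.
  by exists (- K') => _ [z Xz <-]; exact: JK.
have Jm z : X z -> inf S <= J z.
  by move=> Xz; apply: ge_inf; [exact: hS.2|exists z].
(* Small enough for consecutive terms of the minimising sequence to be within 4^-n in squared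
   distance, as [sp_complete] requires. *)
pose e (n : nat) : R := (4^-1) ^+ n / 16.
have e0 n : 0 < e n by rewrite /e divr_gt0 ?exprn_gt0 ?invr_gt0.
have /choice[z Hz] : forall n, exists z, X z /\ J z < inf S + e n.
  by move=> n; have [_ [z Xz <-] Hz] := inf_adherent (e0 n) hS; exists z.
have Xz n : X (z n) by case: (Hz n).
have Hd n : sp (z n.+1 - z n) (z n.+1 - z n) <= (4^-1) ^+ n.
  (* Parallelogram identity: a quarter of the squared distance is the mean of the two values of [J]
     minus its value at the midpoint, which is at least the infimum. *)
  have := Jm _ (X_comb 2^-1 2^-1 (Xz n.+1) (Xz n)).
  rewrite /J sp_comb // linear_on_comb // sp_sub //.
  have := (Hz n).2; have := (Hz n.+1).2; rewrite /J /e exprS.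
  have : 0 < (4^-1 : R) ^+ n by rewrite exprn_gt0 ?invr_gt0.
  move: ((4^-1) ^+ n) (inf S) (sp _ _) (sp _ _) (sp _ _) (g _) (g _) => *; lra.
have [v Xv Hv] := sp_complete Xz Hd; exists v => // w Xw.
(* Approximate Euler-Lagrange equation: on the line through [z n] in direction [w], [J] falls at
   most [e n] below its value at [z n], which bounds the discriminant. *)
have Hn n : (sp (z n) w - g w) ^+ 2 <= e n * sp w w.
  rewrite mulrC; apply: discriminant_bound; first exact: sp_ge0.
  move=> t; have := Jm _ (X_comb 1 t (Xz n) Xw); rewrite /J sp_comb // linear_on_comb //.
  have := (Hz n).2; rewrite /J expr1n !mul1r; lra.
apply/eqP; rewrite -subr_eq0 -sqrf_eq0 eq_le sqr_ge0 andbT.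
apply: (@le0_small _ _ (4 * sp w w)); first by rewrite mulr_ge0 // sp_ge0.
move=> eps eps0; have [N HN] := Hv eps eps0.
have q1 : 0 <= (4^-1 : R) < 1 by lra.
have [k Hk] := geometric_small q1 ler01 eps0.
pose n := maxn N k.
have nN := HN n (leq_maxl _ _); have := Hn n.
have en : e n <= eps.
  rewrite /e; apply: le_trans Hk; rewrite mulr1.
  have : (4^-1 : R) ^+ n <= 4^-1 ^+ k by apply: ler_wiXn2l; [lra|lra|exact: leq_maxr].
  have : 0 < (4^-1 : R) ^+ n by rewrite exprn_gt0 ?invr_gt0.
  lra.
have := sp_cauchy_schwarz (X_sub (Xz n) Xv) Xw.
rewrite (linear_onB (sp_linear Xw)) //.
have w0 := sp_ge0 Xw.
have := ler_wpM2r w0 nN; have := ler_wpM2r w0 en.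
move: (sp (z n - v) _ * _) (e n * _) => p q pe qe H1 H2.
have := sqr_ge0 ((sp (z n) w - g w) + (sp (z n) w - sp v w)).
nra.
Qed.

(** Relaxation on residuals. If [z] represents l - B u, replacing u by u + th z multiplies the
    squared norm of the residual by at most q = 1 - c^2 / C' < 1. Approximate solutions with
    geometrically small residuals are Cauchy by coercivity, and their limit solves the equation. No
    uniqueness is claimed. *)
Theorem lax_milgram (B : E -> E -> R) (l : E -> R) (c C K : R) : 0 < c ->
  (forall w, X w -> linear_on (B ^~ w)) -> (forall u, X u -> linear_on (B u)) ->
  (forall u v, X u -> X v -> B u v ^+ 2 <= C * (sp u u * sp v v)) ->
  (forall u, X u -> c * sp u u <= B u u) ->
  linear_on l -> (forall v, X v -> l v ^+ 2 <= K * sp v v) ->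
  exists2 u, X u & forall v, X v -> B u v = l v.
Proof.
move=> c0 BLl BLr BC' Bc lL lK.
(* The term c^2 ensures c^2 <= C', hence q >= 0. *)
pose C' := `|C| + c ^+ 2; have C0 : 0 < C'.
  by rewrite ltr_wpDl // ?exprn_gt0.
have BC u v : X u -> X v -> B u v ^+ 2 <= C' * (sp u u * sp v v).
  move=> Xu Xv; apply: le_trans (BC' u v Xu Xv) _.
  apply: ler_wpM2r; first by rewrite mulr_ge0 ?sp_ge0.
  by rewrite /C' (le_trans (ler_norm C)) // lerDl sqr_ge0.
have resid u : X u -> exists2 z, X z & forall w, X w -> l w - B u w = sp z w.
  move=> Xu; apply: (@riesz _ ((K + C' * sp u u) *+ 2)).
    by move=> a v w Xv Xw; rewrite lL // BLr //; ring.
  move=> v Xv; have := lK v Xv; have := BC u v Xu Xv.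
  have := sqr_ge0 (l v + B u v); rewrite mulrA; nra.
have rieszB u : X u -> exists2 z, X z & forall w, X w -> B u w = sp z w.
  move=> Xu; apply: (@riesz _ (C' * sp u u)); first exact: BLr.
  by move=> v Xv; rewrite -mulrA BC.
pose th := c / C'; pose q := 1 - c ^+ 2 / C'.
have cC : c ^+ 2 <= C' by rewrite /C' lerDr.
have q01 : 0 <= q < 1.
  by rewrite /q subr_ge0 ler_pdivrMr // mul1r cC /= ltrBlDr ltrDl divr_gt0 // exprn_gt0.
have step u z : X u -> X z -> (forall w, X w -> l w - B u w = sp z w) ->
    exists u' z', [/\ X u', X z', (forall w, X w -> l w - B u' w = sp z' w) &
      sp z' z' <= q * sp z z].
  move=> Xu Xz Hz; have [a Xa Ha] := rieszB z Xz.
  exists (1 *: u + th *: z), (1 *: z + (- th) *: a); split.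
  - exact: X_comb.
  - exact: X_comb.
  - move=> w Xw; rewrite (linear_on_comb _ _ (BLl w Xw)) //.
    rewrite (linear_on_comb _ _ (sp_linear Xw)) // -Hz // -Ha //; ring.
  - rewrite sp_comb // (spC Xz Xa).
    have aa : sp a a <= C' * sp z z.
      have := BC z a Xz Xa; rewrite Ha //.
      have [->|a0] := eqVneq (sp a a) 0.
        by move=> _; rewrite mulr_ge0 ?sp_ge0 // ltW.
      have ap : 0 < sp a a by rewrite lt_def a0 sp_ge0.
      by rewrite expr2 mulrA ler_pM2r.
    (* The new squared norm |z|^2 - 2 th (a, z) + th^2 |a|^2 is at most (1 - 2 th c + th^2 C')
       |z|^2, and th = c / C' minimises this factor, giving q. *)
    have := Bc z Xz; rewrite Ha //; have := sp_ge0 Xz => s0 Bz.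
    have th0 : 0 < th by rewrite divr_gt0.
    have h1 := ler_wpM2l (ltW th0) Bz.
    have h2 := ler_wpM2l (sqr_ge0 th) aa.
    have e1 : q * sp z z = sp z z - (th * (c * sp z z)) *+ 2 + th ^+ 2 * (C' * sp z z).
      by rewrite /q /th; field; rewrite gt_eqF.
    rewrite e1; move: h1 h2; rewrite expr1n !mul1r sqrrN mulNr; lra.
have approx : forall e, 0 < e -> exists u z, [/\ X u, X z,
    (forall w, X w -> l w - B u w = sp z w) & sp z z <= e].
  have [z0 Xz0 Hz0] := resid 0 X0.
  have H n : exists u z, [/\ X u, X z, (forall w, X w -> l w - B u w = sp z w) &
      sp z z <= q ^+ n * sp z0 z0].
    elim: n => [|n [u [z [Xu Xz Hz zq]]]].
      by exists 0, z0; rewrite expr0 mul1r.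
    have [u' [z' [Xu' Xz' Hz' zq']]] := step u z Xu Xz Hz.
    exists u', z'; split => //; apply: le_trans zq' _.
    by rewrite exprS -mulrA ler_wpM2l //; case/andP: q01.
  move=> e e0; have [n Hn] := geometric_small q01 (sp_ge0 Xz0) e0.
  have [u [z [Xu Xz Hz zq]]] := H n; exists u, z; split => //.
  exact: le_trans zq Hn.
pose e (n : nat) : R := c ^+ 2 * ((4^-1) ^+ n / 4).
have e0 n : 0 < e n by rewrite /e mulr_gt0 ?divr_gt0 ?exprn_gt0 ?invr_gt0.
have /choice[uz Huz] : forall n, exists uz, [/\ X uz.1, X uz.2,
    (forall w, X w -> l w - B uz.1 w = sp uz.2 w) & sp uz.2 uz.2 <= e n].
  by move=> n; have [u [z H]] := approx (e n) (e0 n); exists (u, z).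
pose u n := (uz n).1; pose z n := (uz n).2.
have Xu n : X (u n) by case: (Huz n).
have Xz n : X (z n) by case: (Huz n).
have Hz n w : X w -> l w - B (u n) w = sp (z n) w by case: (Huz n) => _ _ H _; exact: H.
have ze n : sp (z n) (z n) <= e n by case: (Huz n).
have Hd n : sp (u n.+1 - u n) (u n.+1 - u n) <= (4^-1) ^+ n.
  set d := u n.+1 - u n; have Xd : X d by exact: X_sub.
  have d0 := sp_ge0 Xd.
  (* Subtracting the residual equations gives B d d = (z_n - z_(n+1), d): coercivity turns small
     residuals into small increments, at the price of the factor c^2 put into [e]. *)
  have h1 : c * sp d d <= sp (z n - z n.+1) d.
    apply: le_trans (Bc d Xd) _.
    rewrite {1}/d (linear_onB (BLl d Xd)) // (linear_onB (sp_linear Xd)) //.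
    by rewrite -!Hz //; lra.
  have h2 := sp_cauchy_schwarz (X_sub (Xz n) (Xz n.+1)) Xd.
  have h3 : sp (z n - z n.+1) (z n - z n.+1) <= c ^+ 2 * (4^-1) ^+ n.
    have := sp_ge0 (X_comb 1 1 (Xz n) (Xz n.+1)).
    rewrite sp_sub // sp_comb //.
    have := ze n; have := ze n.+1; rewrite /e (exprS _ n).
    have : 0 < c ^+ 2 * (4^-1) ^+ n by rewrite mulr_gt0 ?exprn_gt0 ?invr_gt0.
    set p := (4^-1) ^+ n; set c2 := c ^+ 2.
    have -> : c2 * (4^-1 * p / 4) = (c2 * p) / 16 by field.
    have -> : c2 * (p / 4) = (c2 * p) / 4 by field.
    move: (c2 * p) (sp (z n) (z n)) (sp (z n) _) (sp _ _) => *; lra.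
  have [->|dn0] := eqVneq (sp d d) 0; first by rewrite exprn_ge0 // invr_ge0.
  have dp : 0 < sp d d by rewrite lt_def dn0.
  have h4 : (c * sp d d) ^+ 2 <= sp (z n - z n.+1) d ^+ 2.
    by rewrite lerXn2r ?nnegrE // ?mulr_ge0 ?(ltW c0) // (le_trans _ h1) // mulr_ge0 // ltW.
  have h5 : c ^+ 2 * sp d d * sp d d <= c ^+ 2 * (4^-1) ^+ n * sp d d.
    apply: le_trans (ler_wpM2r d0 h3); apply: le_trans h2.
    by apply: le_trans h4; rewrite exprMn expr2 mulrA.
  by move: h5; rewrite ler_pM2r // ler_pM2l // exprn_gt0.
have [v Xv Hv] := sp_complete Xu Hd; exists v => // w Xw.
apply/eqP; rewrite -subr_eq0 -sqrf_eq0 eq_le sqr_ge0 andbT.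
have w0 := sp_ge0 Xw.
apply: (@le0_small _ _ (2 * ((1 + C') * sp w w))).
  by rewrite !mulr_ge0 // addr_ge0 // ltW.
move=> eps eps0; have [N HN] := Hv eps eps0.
have q1 : 0 <= (4^-1 : R) < 1 by lra.
have [k Hk] := geometric_small q1 (sqr_ge0 c) eps0.
pose n := maxn N k.
have nN := HN n (leq_maxl _ _).
have en : e n <= eps.
  apply: le_trans Hk; rewrite /e.
  have : (4^-1 : R) ^+ n <= 4^-1 ^+ k by apply: ler_wiXn2l; [lra|lra|exact: leq_maxr].
  have : 0 < (4^-1 : R) ^+ n by rewrite exprn_gt0 ?invr_gt0.
  have := sqr_ge0 c; nra.
have b1 := BC _ w (X_sub (Xu n) Xv) Xw.
have b2 := sp_cauchy_schwarz (Xz n) Xw.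
have b1' : B (u n - v) w ^+ 2 <= eps * (C' * sp w w).
  apply: le_trans b1 _; rewrite mulrCA ler_wpM2r // mulr_ge0 // ltW //.
have b2' : sp (z n) w ^+ 2 <= eps * sp w w.
  by apply: le_trans b2 _; rewrite ler_wpM2r // (le_trans (ze n)).
have E1 : B v w - l w = - (B (u n - v) w + sp (z n) w).
  by rewrite (linear_onB (BLl w Xw)) // -Hz //; ring.
rewrite E1 sqrrN; have := sqr_ge0 (B (u n - v) w - sp (z n) w).
have -> : eps * (2 * ((1 + C') * sp w w)) =
  2 * (eps * (C' * sp w w)) + 2 * (eps * sp w w) by ring.
move: b1' b2'; rewrite !sqrrD sqrrN mulrN; lra.
Qed.

End lax_milgram.

(** * Completeness of L^2 *)

Lemma limn_einf_le (R : realType) (u : (\bar R)^nat) (C : \bar R) :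
  (forall n, (u n <= C)%E) -> (limn_einf u <= C)%E.
Proof.
move=> uC; apply: le_trans (limn_einf_sup u) _; rewrite limn_esup_lim.
apply: lime_le; first exact: is_cvg_esups.
by near=> n; apply: ge_ereal_sup => _ [k _ <-].
Unshelve. all: by end_near. Qed.

Section L2_completeness.
Context d (T : measurableType d) (R : realType).
Variables (mu : {measure set T -> \bar R}) (D : set T).
Hypotheses (mD : measurable D) (finD : (mu D < +oo)%E).

Lemma Rintegral_fineK (f : T -> R) : mu.-integrable D (EFin \o f) ->
  (\int[mu]_(x in D) (f x)%:E)%E = (\int[mu]_(x in D) f x)%:E.
Proof. by move=> fi; rewrite /Rintegral fineK //; exact: integrable_fin_num. Qed.

(** Split off the first increment and use |a + b|^2 <= 2 |a|^2 + 2 |b|^2: the constant reproduces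
    itself, 2 (K + 4 K / 4) = 4 K. *)
Lemma ip_geometric_dist (f : nat -> T -> R) (K : R) : 0 <= K ->
  (forall n, L2 mu D (f n)) ->
  (forall n, ip mu D (fun x => f n.+1 x - f n x) (fun x => f n.+1 x - f n x)
     <= K * (4^-1) ^+ n) ->
  forall k n, ip mu D (fun x => f n x - f (k + n)%N x)
    (fun x => f n x - f (k + n)%N x) <= 4 * K * (4^-1) ^+ n.
Proof.
move=> K0 Lf df; elim => [|k IH] n.
  have -> : ip mu D (fun x => f n x - f (0 + n)%N x) (fun x => f n x - f (0 + n)%N x) = 0.
    rewrite -(ip0l mu mD (fun=> 0)).
    by apply: eq_ip => x _; rewrite add0n subrr.
  by rewrite mulr_ge0 ?mulr_ge0 ?exprn_ge0 ?invr_ge0.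
have L1' := L2B mD (Lf n) (Lf n.+1).
have L2' := L2B mD (Lf n.+1) (Lf (k + n.+1)%N).
have -> : (k.+1 + n = k + n.+1)%N by rewrite addSnnS.
have -> : ip mu D (fun x => f n x - f (k + n.+1)%N x) (fun x => f n x - f (k + n.+1)%N x) =
  ip mu D (fun x => (f n x - f n.+1 x) + (f n.+1 x - f (k + n.+1)%N x))
    (fun x => (f n x - f n.+1 x) + (f n.+1 x - f (k + n.+1)%N x)).
  by apply: eq_ip => x _; rewrite addrA subrK.
apply: le_trans (ipD_le mD L1' L2') _.
have := IH n.+1; have := df n.
have -> : ip mu D (fun x => f n.+1 x - f n x) (fun x => f n.+1 x - f n x) =
  ip mu D (fun x => f n x - f n.+1 x) (fun x => f n x - f n.+1 x).
  by rewrite !ipE; apply: eq_Rintegral => x _; ring.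
rewrite (exprS _ n).
set p := (4^-1) ^+ n.
have -> : 4 * K * (4^-1 * p) = K * p by field.
rewrite -(mulrA 4); move: (K * p) (ip _ _ _ _) (ip _ _ _ _) => *; lra.
Qed.

(** From |t| <= 2^n t^2 + 2^-n, the n-th increment has integral at most (K + mu D) 2^-n. The sum of
    the absolute increments is therefore integrable, hence finite almost everywhere. *)
Lemma ae_cvg_geometric (f : nat -> T -> R) (K : R) : 0 <= K ->
  (forall n, L2 mu D (f n)) ->
  (forall n, ip mu D (fun x => f n.+1 x - f n x) (fun x => f n.+1 x - f n x)
     <= K * (4^-1) ^+ n) ->
  {ae mu, forall x, D x -> cvgn (f ^~ x)}.
Proof.
move=> K0 Lf df; pose h n x := `|f n.+1 x - f n x|.
have Ldf n : L2 mu D (fun x => f n.+1 x - f n x) by exact: L2B.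
have mh n : measurable_fun D (h n).
  by apply: measurableT_comp => //; exact: (proj1 (Ldf n)).
pose m := fine (mu D).
have m0 : 0 <= m by exact: fine_ge0.
have bound n : (\int[mu]_(x in D) (h n x)%:E <= ((K + m) * (2^-1) ^+ n)%:E)%E.
  pose F x : R := 2 ^+ n * ((f n.+1 x - f n x) * (f n.+1 x - f n x)) + (2^-1) ^+ n * 1.
  have i1 : mu.-integrable D (EFin \o (fun x => (f n.+1 x - f n x) * (f n.+1 x - f n x))).
    exact: L2_mul_integrable.
  have i2 : mu.-integrable D (EFin \o (fun=> 1 : R)).
    apply: (@bounded_integrable _ _ _ mu _ mD _ 1) => // x _; last by rewrite normr1.
  have i1' := integrableZl mD (2 ^+ n) i1.
  have i2' := integrableZl mD (2^-1 ^+ n) i2.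
  have iF : mu.-integrable D (EFin \o F).
    by have := integrableD mD i1' i2'; apply: eq_integrable.
  have : (\int[mu]_(x in D) (h n x)%:E <= \int[mu]_(x in D) (F x)%:E)%E.
    apply: ge0_le_integral => //.
    - by move=> x _; rewrite lee_fin normr_ge0.
    - exact/measurable_EFinP.
    - by case/integrableP: iF.
    - move=> x _; rewrite lee_fin /h /F mulr1 exprVn.
      have : 0 < 2 ^+ n :> R by rewrite exprn_gt0.
      move: (2 ^+ n) => a a0; set t := f n.+1 x - f n x.
      rewrite -expr2 -(real_normK (num_real t)); move: `|t| (normr_ge0 t) => s s0.
      rewrite -subr_ge0.
      have -> : a * s ^+ 2 + a^-1 - s = ((a * s - 2^-1) ^+ 2 + 3 / 4) / a.
        by field; rewrite gt_eqF.
      by rewrite divr_ge0 ?(ltW a0) // addr_ge0 ?sqr_ge0 //; lra.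
  move/le_trans; apply; rewrite Rintegral_fineK // lee_fin /F RintegralD //.
  rewrite !RintegralZl // Rintegral_cst // mul1r -/m.
  have := df n; rewrite ipE => dfn.
  have p0 : 0 <= (2 : R) ^+ n by rewrite exprn_ge0.
  have := ler_wpM2l p0 dfn; rewrite mulrCA -exprMn.
  have -> : 2 * 4^-1 = 2^-1 :> R by field.
  rewrite mulrDl (mulrC m); lra.
have mS : measurable_fun D (fun x => (\big[+%E/0%E]_(0 <= n <oo) (h n x)%:E)%E).
  apply: (@ge0_emeasurable_sum _ _ _ _ (fun n x => (h n x)%:E) xpredT); first by move=> n x _ _; rewrite lee_fin normr_ge0.
  by move=> n _; exact/measurable_EFinP.
have sumlt : (\int[mu]_(x in D) \big[+%E/0%E]_(0 <= n <oo) (h n x)%:E < +oo)%E.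
  rewrite integral_nneseries //; last 2 first.
    by move=> n; exact/measurable_EFinP.
    by move=> n x _; rewrite lee_fin normr_ge0.
  apply: (@le_lt_trans _ _ (\big[+%E/0%E]_(0 <= n <oo) ((K + m) * (2^-1) ^+ n)%:E)%E).
    by apply: lee_nneseries => // n _ _; apply: integral_ge0 => x _; rewrite lee_fin normr_ge0.
  have cv := @cvg_geometric_series R (K + m) 2^-1.
  have q1 : `|2^-1 : R| < 1 by rewrite ger0_norm; lra.
  have := cv q1 => cv1.
  have -> : (\big[+%E/0%E]_(0 <= n <oo) ((K + m) * (2^-1) ^+ n)%:E)%E =
     ((K + m) / (1 - 2^-1))%:E.
    apply/cvg_lim => //; under eq_fun do rewrite sumEFin.
    by apply: cvg_EFin; [exact: nearW|exact: cv1].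
  exact: ltry.
have intS : mu.-integrable D (fun x => (\big[+%E/0%E]_(0 <= n <oo) (h n x)%:E)%E).
  apply/integrableP; split => //.
  rewrite (eq_integral (fun x => \big[+%E/0%E]_(0 <= n <oo) (h n x)%:E)%E) // => x _.
  by rewrite gee0_abs // nneseries_ge0 // => n _ _; rewrite lee_fin normr_ge0.
have := integrable_ae mD intS; apply: filterS => x Hx Dx.
have hx := Hx Dx.
have cvh : cvgn (series (h ^~ x)).
  apply: nnseries_is_cvg; first by move=> n; exact: normr_ge0.
  by rewrite -ge0_fin_numE // nneseries_ge0 // => n _ _; rewrite lee_fin normr_ge0.
have cvs : cvgn (series (fun n => f n.+1 x - f n x)) by apply: normed_cvg.
have E : f ^~ x = (fun n => f 0%N x + series (fun n => f n.+1 x - f n x) n).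
  apply/funext => n; rewrite /series /= telescope_sumr //; ring.
by rewrite E; apply: is_cvgD => //; exact: is_cvg_cst.
Qed.

(** The limit is defined everywhere as an upper limit, hence is measurable with no choice on the
    null set of divergence; Fatou's lemma passes the bounds of [ip_geometric_dist] to it. *)
Lemma L2_complete (f : nat -> T -> R) (K : R) : 0 <= K ->
  (forall n, L2 mu D (f n)) ->
  (forall n, ip mu D (fun x => f n.+1 x - f n x) (fun x => f n.+1 x - f n x)
     <= K * (4^-1) ^+ n) ->
  exists2 g, L2 mu D g &
    forall n, ip mu D (fun x => f n x - g x) (fun x => f n x - g x) <=
      4 * K * (4^-1) ^+ n.
Proof.
move=> K0 Lf df; have aecv := ae_cvg_geometric K0 Lf df.
pose g x := fine (limn_esup (fun n => (f n x)%:E)).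
have mg : measurable_fun D g.
  apply: (measurableT_comp (fine_measurable measurableT)).
  by apply: measurable_fun_limn_esup => n; apply/measurable_EFinP; exact: (proj1 (Lf n)).
have gE x : cvgn (f ^~ x) -> f n x @[n --> \oo] --> g x.
  move=> cvf; have cvE : (f n x)%:E @[n --> \oo] --> (limn (f ^~ x))%:E.
    by apply: cvg_EFin; [exact: nearW|exact: cvf].
  by rewrite /g (cvg_limn_einf_sup cvE).2.
have key n : (\int[mu]_(x in D) ((f n x - g x) ^+ 2)%:E <= (4 * K * (4^-1) ^+ n)%:E)%E.
  pose u k x := ((f n x - f (k + n)%N x) ^+ 2)%:E.
  have mu' k : measurable_fun D (u k).
    apply/measurable_EFinP; apply: measurable_funX.
    by apply: measurable_funB; [exact: (proj1 (Lf n))|exact: (proj1 (Lf (k + n)%N))].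
  have -> : (\int[mu]_(x in D) ((f n x - g x) ^+ 2)%:E =
      \int[mu]_(x in D) limn_einf (u ^~ x))%E.
    apply: ae_eq_integral => //.
    - apply/measurable_EFinP; apply: measurable_funX.
      by apply: measurable_funB => //; exact: (proj1 (Lf n)).
    - rewrite (_ : (fun x => _) = (fun x => - limn_esup (fun k => - u k x))%E).
        apply: (measurableT_comp (@oppe_measurable R setT)).
        apply: measurable_fun_limn_esup => k.
        exact: (measurableT_comp (@oppe_measurable R setT)).
      apply/funext => x; rewrite -limn_einfN; congr limn_einf.
      by apply/funext => k; rewrite [RHS]oppeK.
    - move: aecv; apply: filterS => x cvx Dx /=.
      have cvf := gE x (cvx Dx).
      have cvu : u k x @[k --> \oo] --> ((f n x - g x) ^+ 2)%:E.
        apply: cvg_EFin; first exact: nearW.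
        apply: (@cvg_comp _ _ _ _ (fun t : R => t ^+ 2) _ (nbhs (f n x - g x))); last first.
          exact: exprn_continuous.
        apply: cvgB; first exact: cvg_cst.
        by move: cvf; rewrite -(cvg_shiftn n).
      by rewrite (cvg_limn_einf_sup cvu).1.
  apply: le_trans (fatou mu mD mu' _) _.
    by move=> k x _; rewrite lee_fin sqr_ge0.
  apply: limn_einf_le => k; rewrite Rintegral_fineK; last first.
    by have [] := L2B mD (Lf n) (Lf (k + n)%N).
  by rewrite lee_fin -ip_sqr; exact: ip_geometric_dist.
have Ld n : L2 mu D (fun x => f n x - g x).
  split; first by apply: measurable_funB => //; exact: (proj1 (Lf n)).
  apply/integrableP; split.
    apply/measurable_EFinP; apply: measurable_funX.
    by apply: measurable_funB => //; exact: (proj1 (Lf n)).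
  apply: le_lt_trans (ltry (4 * K * (4^-1) ^+ n)); apply: le_trans (key n).
  rewrite le_eqVlt; apply/orP; left; apply/eqP; apply: eq_integral => x _.
  by rewrite gee0_abs // lee_fin sqr_ge0.
have Lg : L2 mu D g.
  have := L2B mD (Lf 0%N) (Ld 0%N); congr L2.
  by apply/funext => x; ring.
exists g => // n; rewrite ip_sqr -lee_fin -Rintegral_fineK ?key //.
by case: (Ld n).
Qed.

Lemma ip_eq0_ae (f : T -> R) : L2 mu D f -> ip mu D f f = 0 ->
  {ae mu, forall x, D x -> f x = 0}.
Proof.
move=> Lf f0; have [mf f2] := Lf.
have : (\int[mu]_(x in D) `|(f x ^+ 2)%:E| = 0)%E.
  rewrite (eq_integral (fun x => (f x ^+ 2)%:E)); last first.
    by move=> x _; rewrite gee0_abs // lee_fin sqr_ge0.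
  by rewrite Rintegral_fineK // -ip_sqr f0.
have mf2 : measurable_fun D (fun x => (f x ^+ 2)%:E) by case/integrableP: f2.
move/(ae_eq_integral_abs mu mD mf2); apply: filterS => x Hx Dx; have := Hx Dx => /= -[] /eqP.
by rewrite sqrf_eq0 => /eqP.
Qed.

Lemma ip_ae0 (h f : T -> R) : measurable_fun D h -> measurable_fun D f ->
  {ae mu, forall x, D x -> h x = 0} -> ip mu D h f = 0.
Proof.
move=> mh mf h0; rewrite ipE /Rintegral.
have -> : (\int[mu]_(x in D) (h x * f x)%:E = \int[mu]_(x in D) (cst 0%E) x)%E.
  apply: ae_eq_integral mD _ _ _ => //.
    by apply/measurable_EFinP; exact: measurable_funM.
  by move: h0; apply: filterS => x Hx Dx /=; rewrite Hx // mul0r.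
by rewrite integral0.
Qed.

Lemma ae_mono (P Q : T -> Prop) : {ae mu, forall x, P x} ->
  (forall x, P x -> Q x) -> {ae mu, forall x, Q x}.
Proof. by move=> aeP PQ; move: aeP; apply: filterS. Qed.

End L2_completeness.

(** * The space H^1_0 *)

Lemma sum2 (V : nmodType) (F : 'I_2 -> V) :
  \sum_(i < 2) F i = F ord0 + F ord_max.
Proof.
rewrite big_ord_recl big_ord_recl big_ord0 addr0; congr (_ + F _).
exact/val_inj.
Qed.

(* Locked: unifying unfolded norms of different functions is prohibitively slow. *)
HB.lock Definition nrm d (T : measurableType d) (R : realType)
    (mu : {measure set T -> \bar R}) (D : set T) (f : T -> R) : R :=
  Num.sqrt (ip mu D f f).

Lemma sum3_lt (R : realFieldType) (a b c e : R) : 0 <= a -> 0 <= b -> 0 <= c ->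
  a + (b + c) < e -> [/\ a <= e, b <= e & c <= e].
Proof. by move=> *; split; lra. Qed.

Lemma sum3_sub (R : comRingType) (a b c a' b' c' : R) : a' + (b' + c') = 0 ->
  a + (b + c) = (a - a') + ((b - b') + (c - c')).
Proof.
move=> E; transitivity (a + (b + c) - (a' + (b' + c'))); last by ring.
by rewrite E subr0.
Qed.

Lemma six_terms (R : realFieldType) (e A B a1 a2 b1 b2 c1 c2 : R) :
  `|a1| <= e * A -> `|a2| <= e * A -> `|b1| <= e * B -> `|b2| <= e * B ->
  c1 + c2 = 0 -> `|a1 + b1 + c1 + (a2 + b2 + c2)| <= e * (2 * A + 2 * B).
Proof.
rewrite !ler_norml => /andP[? ?] /andP[? ?] /andP[? ?] /andP[? ?] ?.
apply/andP; split; lra.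
Qed.

Lemma sum3_quarter (R : realFieldType) (a b c e : R) : 0 < e ->
  a <= e / 4 -> b <= e / 4 -> c <= e / 4 -> a + (b + c) < e.
Proof. by move=> *; lra. Qed.

(** * The L^2 norm and its inequalities *)

Section L2_norm.
Context d (T : measurableType d) (R : realType).
Variables (mu : {measure set T -> \bar R}) (D : set T).
Hypothesis mD : measurable D.
Implicit Types f g : T -> R.

Local Notation nrm := (nrm mu D).

Lemma nrmE f : nrm f = Num.sqrt (ip mu D f f). Proof. by rewrite nrm.unlock. Qed.

Lemma nrm_ge0 f : 0 <= nrm f. Proof. by rewrite nrmE sqrtr_ge0. Qed.

Lemma nrm_sqr f : nrm f ^+ 2 = ip mu D f f.
Proof. by rewrite nrmE sqr_sqrtr // ip_ge0. Qed.

Lemma eq_nrm f g : {in D, f =1 g} -> nrm f = nrm g.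
Proof. by move=> fg; rewrite !nrmE; congr Num.sqrt; apply: eq_ip. Qed.

Lemma le_nrm_sqr f (a : R) : 0 <= a -> (nrm f <= a) = (ip mu D f f <= a ^+ 2).
Proof.
by move=> a0; rewrite -nrm_sqr ler_pXn2r // ?nnegrE // nrm_ge0.
Qed.

Lemma ip_le_nrm f g : L2 mu D f -> L2 mu D g ->
  `|ip mu D f g| <= nrm f * nrm g.
Proof.
move=> Lf Lg; rewrite -(ler_pXn2r (n := 2)) // ?nnegrE ?mulr_ge0 ?nrm_ge0 //.
rewrite real_normK ?num_real // exprMn !nrm_sqr; exact: cauchy_schwarz.
Qed.

Lemma nrmD f g : L2 mu D f -> L2 mu D g ->
  nrm (fun x => f x + g x) <= nrm f + nrm g.
Proof.
move=> Lf Lg; rewrite le_nrm_sqr ?addr_ge0 ?nrm_ge0 // ip_add // sqrrD !nrm_sqr.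
have := le_trans (ler_norm _) (ip_le_nrm Lf Lg); lra.
Qed.

Lemma nrmZ a f : L2 mu D f -> nrm (fun x => a * f x) = `|a| * nrm f.
Proof.
move=> Lf; rewrite !nrmE ipZl ?ipZr //; last exact: L2Z.
by rewrite mulrA -expr2 sqrtrM ?sqr_ge0 // sqrtr_sqr.
Qed.

Lemma nrmN f : nrm (fun x => - f x) = nrm f.
Proof. by rewrite !nrmE; congr Num.sqrt; rewrite !ipE; apply: eq_Rintegral => x _; rewrite mulrNN. Qed.

Lemma nrm_subrr f : nrm (fun x => f x - f x) = 0.
Proof.
rewrite nrmE; transitivity (Num.sqrt (ip mu D (fun=> 0) f)).
  by congr Num.sqrt; rewrite !ipE; apply: eq_Rintegral => x _; rewrite subrr !mul0r.
by rewrite ip0l // sqrtr0.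
Qed.

Lemma nrm_distC f g : nrm (fun x => f x - g x) = nrm (fun x => g x - f x).
Proof. by rewrite -nrmN; apply: eq_nrm => x _; rewrite opprB. Qed.

Lemma nrm_triangle f g h : L2 mu D f -> L2 mu D g -> L2 mu D h ->
  nrm (fun x => f x - h x) <=
  nrm (fun x => f x - g x) + nrm (fun x => g x - h x).
Proof.
move=> Lf Lg Lh; apply: le_trans (nrmD _ _); try exact: L2B.
by rewrite le_eqVlt; apply/orP; left; apply/eqP; apply: eq_nrm => x _; rewrite addrA subrK.
Qed.

Lemma nrm_approx f g : L2 mu D f -> L2 mu D g ->
  nrm f <= nrm g + nrm (fun x => f x - g x).
Proof.
move=> Lf Lg; apply: le_trans (nrmD Lg (L2B mD Lf Lg)).
by rewrite le_eqVlt; apply/orP; left; apply/eqP; apply: eq_nrm => x _; ring.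
Qed.

Lemma nrmM_bounded f g (M : R) : 0 <= M -> measurable_fun D f -> L2 mu D g ->
  (forall x, D x -> `|f x| <= M) -> nrm (fun x => f x * g x) <= M * nrm g.
Proof.
move=> M0 mf Lg fM; rewrite -[M]ger0_norm // -nrmZ //.
rewrite le_nrm_sqr ?nrm_ge0 // nrm_sqr; apply: le_ip => //.
- exact: L2M_bounded fM.
- exact: L2Z.
- by move=> x Dx; rewrite !normrM (ger0_norm M0) ler_wpM2r // fM.
Qed.

End L2_norm.

Section H10.
Context (R : realType) (L1 : R).
Hypothesis hL1 : 0 < L1.
Implicit Types (f : R * R -> R) (g : 'I_2 -> R * R -> R).

Notation LL := (L2 (leb2 R) (cell L1)).
Notation II := (ip (leb2 R) (cell L1)).
Notation NN := (nrm (leb2 R) (cell L1)).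
Let mC := @measurable_cell R L1.

(** A form of [in_H10] with finite real norms, one for each component, in place of a single extended
    integral; [in_H10P] translates. *)
Record H10 f g : Prop := {
  H10_L2 : LL f ;
  H10_grad_L2 : forall j, LL (g j) ;
  H10_approx : forall e : R, 0 < e -> exists2 phi, test_function L1 phi &
    NN (fun x => f x - phi x) <= e /\
    forall j, NN (fun x => g j x - partial j phi x) <= e }.

Lemma test_L2 phi : test_function L1 phi -> LL phi.
Proof. by case=> c _ _ _ _; exact: continuous_L2. Qed.

Lemma test_partial_L2 phi j : test_function L1 phi -> LL (partial j phi).
Proof. by case=> _ _ c _ _; exact: continuous_L2. Qed.

Lemma test_H10 phi : test_function L1 phi -> H10 phi (fun j => partial j phi).
Proof.
move=> tp; split; [exact: test_L2|by move=> j; exact: test_partial_L2|].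
by move=> e e0; exists phi => //; split => [|j]; rewrite nrm_subrr ?ltW.
Qed.

Lemma H10_integrand f g phi : LL f -> (forall j, LL (g j)) ->
  test_function L1 phi ->
  (\int[leb2 R]_(x in cell L1)
    ((f x - phi x) ^+ 2 + \sum_(j < 2) (g j x - partial j phi x) ^+ 2)%:E =
  (NN (fun x => f x - phi x) ^+ 2 +
   (NN (fun x => g ord0 x - partial ord0 phi x) ^+ 2 +
    NN (fun x => g ord_max x - partial ord_max phi x) ^+ 2))%:E)%E.
Proof.
move=> Lf Lg tp.
pose a x := (f x - phi x) ^+ 2; pose b j x := (g j x - partial j phi x) ^+ 2.
have i0 : (leb2 R).-integrable (cell L1) (EFin \o a).
  exact: proj2 (L2B mC Lf (test_L2 tp)).
have i1 j : (leb2 R).-integrable (cell L1) (EFin \o b j).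
  exact: proj2 (L2B mC (Lg j) (test_partial_L2 j tp)).
have i2 : (leb2 R).-integrable (cell L1) (EFin \o (fun x => b ord0 x + b ord_max x)).
  by have := integrableD mC (i1 ord0) (i1 ord_max); apply: eq_integrable.
have i3 : (leb2 R).-integrable (cell L1)
    (EFin \o (fun x => a x + (b ord0 x + b ord_max x))).
  by have := integrableD mC i0 i2; apply: eq_integrable.
have E (h : R * R -> R) : NN h ^+ 2 = \int[leb2 R]_(x in cell L1) h x ^+ 2.
  by rewrite nrm_sqr ip_sqr.
transitivity (\int[leb2 R]_(x in cell L1) (a x + (b ord0 x + b ord_max x))%:E)%E.
  by apply: eq_integral => x _; rewrite sum2.
rewrite (Rintegral_fineK mC i3); congr _%:E.
apply: etrans (RintegralD mC i0 i2) _; congr (_ + _); first exact/esym/E.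
by apply: etrans (RintegralD mC (i1 ord0) (i1 ord_max)) _; congr (_ + _); exact/esym/E.
Qed.

Lemma in_H10P f g : LL f -> (forall j, LL (g j)) -> in_H10 L1 f g <-> H10 f g.
Proof.
move=> Lf Lg; split => [H|[_ _ H]].
  split => // e e0; have e20 : 0 < e ^+ 2 by rewrite exprn_gt0.
  have [phi tp] := H _ e20; rewrite (H10_integrand Lf Lg tp) lte_fin => lt.
  have sq (h : R * R -> R) : NN h ^+ 2 <= e ^+ 2 -> NN h <= e.
    by rewrite (le_nrm_sqr _ _ _ (ltW e0)) (nrm_sqr (leb2 R) (cell L1) h).
  have [p0 p1 p2] := sum3_lt (sqr_ge0 _) (sqr_ge0 _) (sqr_ge0 _) lt.
  exists phi => //; split; first exact: (sq _ p0).
  by move=> j; case: (ord2P j) => ->; [exact: (sq _ p1)|exact: (sq _ p2)].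
(* Since e' <= 1, a norm at most e' has square at most e' <= e / 4; three such squares add up to
   less than e. *)
move=> e e0; pose e' := Num.min 1 (e / 4).
have e'0 : 0 < e' by rewrite lt_min ltr01 divr_gt0.
have [phi tp [h1 h2]] := H _ e'0; exists phi => //.
rewrite (H10_integrand Lf Lg tp) lte_fin.
have [e'1 e'4] : e' <= 1 /\ e' <= e / 4 by split; rewrite ge_min lexx ?orbT.
have sq (h : R * R -> R) : NN h <= e' -> NN h ^+ 2 <= e / 4.
  move=> he; have h0 := nrm_ge0 (leb2 R) (cell L1) h.
  rewrite expr2; apply: le_trans (ler_wpM2r h0 (le_trans he e'1)) _.
  by rewrite mul1r (le_trans he).
exact: sum3_quarter e0 (sq _ h1) (sq _ (h2 ord0)) (sq _ (h2 ord_max)).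
Qed.

Lemma H10_comb a f g f' g' : H10 f g -> H10 f' g' ->
  H10 (fun x => a * f x + f' x) (fun j x => a * g j x + g' j x).
Proof.
move=> [Lf Lg H] [Lf' Lg' H']; split.
- by apply: L2D => //; exact: L2Z.
- by move=> j; apply: L2D => //; exact: L2Z.
move=> e e0; pose e' := e / (1 + `|a|).
have a1 : 0 < 1 + `|a| by rewrite ltr_wpDr.
have e'0 : 0 < e' by rewrite divr_gt0.
have [phi tp [h1 h2]] := H _ e'0; have [phi' tp' [h1' h2']] := H' _ e'0.
have C := C1D (C1Z a (test_C1_gradient tp)) (test_C1_gradient tp').
have [d d0 van] := test_near_wall tp; have [d' d'0 van'] := test_near_wall tp'.
have tc : test_function L1 (fun x => a * phi x + phi' x).
  apply: (C1_test (d := Num.min d d') C).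
  - by move=> x1 x2; rewrite (test_periodic tp) (test_periodic tp').
  - by rewrite lt_min d0 d'0.
  - move=> x1 x2 hx.
    have hd : 2^-1 - d <= `|x2|.
      by apply: le_trans hx; rewrite lerD2l lerN2 ge_min lexx.
    have hd' : 2^-1 - d' <= `|x2|.
      by apply: le_trans hx; rewrite lerD2l lerN2 ge_min lexx orbT.
    by rewrite (van (x1, x2) hd) (van' (x1, x2) hd') mulr0 addr0.
exists (fun x => a * phi x + phi' x) => //.
have key (h k h' k' : R * R -> R) : LL h -> LL k -> LL h' -> LL k' ->
    NN (fun x => h x - k x) <= e' -> NN (fun x => h' x - k' x) <= e' ->
    NN (fun x => (a * h x + h' x) - (a * k x + k' x)) <= e.
  move=> Lh Lk Lh' Lk' n1 n2; have L' := L2B mC Lh Lk.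
  have -> : NN (fun x => (a * h x + h' x) - (a * k x + k' x)) =
      NN (fun x => a * (h x - k x) + (h' x - k' x)).
    by apply: eq_nrm => x _; ring.
  apply: le_trans (nrmD mC (L2Z mC a L') (L2B mC Lh' Lk')) _.
  rewrite (nrmZ mC) //; apply: le_trans (lerD (ler_wpM2l (normr_ge0 a) n1) n2) _.
  by rewrite /e' le_eqVlt; apply/orP; left; apply/eqP; field; rewrite gt_eqF.
split; first by apply: key => //; exact: test_L2.
move=> j; rewrite (C1_partial C); apply: key => //; exact: test_partial_L2.
Qed.

Lemma H10_limit f g : LL f -> (forall j, LL (g j)) ->
  (forall e, 0 < e -> exists f' g', [/\ H10 f' g', NN (fun x => f x - f' x) <= e &
    forall j, NN (fun x => g j x - g' j x) <= e]) -> H10 f g.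
Proof.
move=> Lf Lg H; split => // e e0.
have e20 : 0 < e / 2 by rewrite divr_gt0.
have [f' [g' [[Lf' Lg' H'] h1 h2]]] := H _ e20.
have [phi tp [h1' h2']] := H' _ e20; exists phi => //; split.
  by have := nrm_triangle mC Lf Lf' (test_L2 tp); lra.
move=> j; have := nrm_triangle mC (Lg j) (Lg' j) (test_partial_L2 j tp).
by have := h2 j; have := h2' j; lra.
Qed.

(* A continuous linear functional on H^1 that vanishes on the test functions vanishes on H^1_0. *)
Lemma H10_functional f g h (k : 'I_2 -> R * R -> R) : H10 f g -> LL h ->
  (forall j, LL (k j)) ->
  (forall phi, test_function L1 phi ->
     II h phi + \sum_(j < 2) II (k j) (partial j phi) = 0) ->
  II h f + \sum_(j < 2) II (k j) (g j) = 0.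
Proof.
move=> [Lf Lg H] Lh Lk H0; apply/eqP; rewrite -normr_eq0 eq_le normr_ge0 andbT.
apply: (@le0_small _ _ (NN h + \sum_(j < 2) NN (k j))).
  by rewrite sum2 !addr_ge0 ?nrm_ge0.
move=> e e0; have [phi tp [h1 h2]] := H _ e0.
have := H0 _ tp; rewrite !sum2 => E.
have -> : II h f + (II (k ord0) (g ord0) + II (k ord_max) (g ord_max)) =
  II h (fun x => f x - phi x) +
  (II (k ord0) (fun x => g ord0 x - partial ord0 phi x) +
   II (k ord_max) (fun x => g ord_max x - partial ord_max phi x)).
  have e0' := ipBr mC Lf (test_L2 tp) Lh.
  have e1 j := ipBr mC (Lg j) (test_partial_L2 j tp) (Lk j).
  by rewrite e0' !e1; exact: sum3_sub.
have b1 := ip_le_nrm mC Lh (L2B mC Lf (test_L2 tp)).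
have b2 j := ip_le_nrm mC (Lk j) (L2B mC (Lg j) (test_partial_L2 j tp)).
apply: le_trans (ler_normD _ _) _; rewrite mulrDr mulrDr.
apply: lerD; first by apply: le_trans b1 _; rewrite mulrC ler_wpM2r ?nrm_ge0.
apply: le_trans (ler_normD _ _) _.
by apply: lerD; apply: le_trans (b2 _) _; rewrite mulrC ler_wpM2r ?nrm_ge0.
Qed.

Lemma C1M_test f g psi : C1_gradient f g ->
  (forall x1 x2, f (x1 + L1, x2) = f (x1, x2)) -> test_function L1 psi ->
  test_function L1 (fun x => f x * psi x).
Proof.
move=> fg per tp; have [d d0 van] := test_near_wall tp.
apply: (C1_test (d := d) (C1M fg (test_C1_gradient tp))) => // x1 x2.
  by rewrite per (test_periodic tp).
by move=> hx; rewrite van ?mulr0.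
Qed.

Lemma C1_weak_gradient f g : C1_gradient f g ->
  (forall x1 x2, f (x1 + L1, x2) = f (x1, x2)) ->
  forall j psi, test_function L1 psi -> II f (partial j psi) = - II (g j) psi.
Proof.
move=> fg per j psi tp.
have Lf := continuous_L2 hL1 (C1_continuous fg).
have Lg := continuous_L2 hL1 (@C1_gradient_continuous _ _ _ fg j).
apply/eqP; rewrite -addr_eq0 (ipC (leb2 R) (cell L1) (g j)); apply/eqP.
have -> : II f (partial j psi) + II psi (g j) =
    \int[leb2 R]_(x in cell L1) (f x * partial j psi x + psi x * g j x).
  rewrite !ipE -RintegralD //.
  - exact: (L2_mul_integrable mC Lf (test_partial_L2 j tp)).
  - exact: (L2_mul_integrable mC (test_L2 tp) Lg).
have := test_gradient_integral j hL1 (C1M_test fg per tp).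
by rewrite (C1_partial (C1M fg (test_C1_gradient tp))).
Qed.

Lemma LL0 : LL (fun=> 0). Proof. exact: (L2_0 _ mC). Qed.

Lemma II0l f : II (fun=> 0) f = 0. Proof. exact: (ip0l (leb2 R) mC). Qed.

(** [H10_functional] with h = d_j psi and k equal to psi in position j: on test functions it
    vanishes by classical integration by parts. *)
Lemma H10_weak f g : H10 f g -> forall j psi, test_function L1 psi ->
  II f (partial j psi) = - II (g j) psi.
Proof.
move=> Hf j psi tp.
have := @H10_functional f g (partial j psi) (fun i => if i == j then psi else fun=> 0) Hf.
have E (F : 'I_2 -> R * R -> R) :
    \sum_(i < 2) II (if i == j then psi else fun=> 0) (F i) = II psi (F j).
  rewrite (bigD1 j) //= eqxx big1 ?addr0 // => i /negbTE ->; exact: II0l.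
rewrite E => /(_ (test_partial_L2 j tp)) H.
have : II (partial j psi) f + II psi (g j) = 0.
  apply: H => [i|phi tphi]; first by case: eqP => _; [exact: test_L2|exact: LL0].
  rewrite E.
  have := C1_weak_gradient (test_C1_gradient tphi) (test_periodic tphi) j tp.
  rewrite (ipC (leb2 R) (cell L1) phi) (ipC (leb2 R) (cell L1) (partial j phi)); lra.
rewrite (ipC (leb2 R) (cell L1) (partial j psi)) (ipC (leb2 R) (cell L1) psi); lra.
Qed.

Lemma LL1 : LL (fun=> 1).
Proof. by apply: continuous_L2 => // x; exact: cvg_cst. Qed.

(** [H10_functional] with h = 0 and k equal to 1 in position j. *)
Lemma H10_mean_gradient f g j : H10 f g -> \int[leb2 R]_(x in cell L1) g j x = 0.
Proof.
move=> Hf; have := @H10_functional f g (fun=> 0) (fun i => if i == j then fun=> 1 else fun=> 0) Hf.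
have E (F : 'I_2 -> R * R -> R) :
    \sum_(i < 2) II (if i == j then fun=> 1 else fun=> 0) (F i) = \int[leb2 R]_(x in cell L1) F j x.
  rewrite (bigD1 j) //= eqxx big1 ?addr0 => [|i /negbTE ->]; last exact: II0l.
  by rewrite ipE; apply: eq_Rintegral => x _; rewrite mul1r.
rewrite E => /(_ LL0) H; have : II (fun=> 0) f + \int[leb2 R]_(x in cell L1) g j x = 0.
  apply: H => [i|phi tphi]; first by case: eqP => _; [exact: LL1|exact: LL0].
  by rewrite E II0l add0r test_gradient_integral.
by rewrite II0l add0r.
Qed.

(* Integrating the derivative of x2 phi^2 gives |phi|^2 = - 2 (x2 phi, d2 phi), and |x2| <= 1/2. *)
Lemma test_poincare phi : test_function L1 phi -> NN phi <= NN (partial ord_max phi).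
Proof.
move=> tp; have Cp := test_C1_gradient tp.
have C := C1M (C1_snd R) (C1M Cp Cp).
have [d d0 van] := test_near_wall tp.
have van2 x1 : phi (x1, - 2^-1) = 0 /\ phi (x1, 2^-1) = 0.
  by split; apply: van => /=; rewrite ?normrN ger0_norm; lra.
have L0 := test_L2 tp; have L' := test_partial_L2 ord_max tp.
have C2 := C1_continuous (C1_snd R).
have Ly : LL (fun x => x.2 * phi x).
  by apply: (continuous_L2 hL1) => x; apply: cvgM; [exact: C2|exact: (test_continuous tp)].
have E : \int[leb2 R]_(x in cell L1) (x.2 * (phi x * partial ord_max phi x +
     phi x * partial ord_max phi x) + phi x * phi x * (basis_vector R ord_max).2) =
  2 * II (fun x => x.2 * phi x) (partial ord_max phi) + II phi phi.
  rewrite -(ipZl mC) // !ipE -RintegralD //.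
  - by apply: eq_Rintegral => x _ /=; ring.
  - by apply: (L2_mul_integrable mC) => //; exact: L2Z.
  - exact: (L2_mul_integrable mC).
have E0 := @Rintegral_gradient2 R L1 _ _ hL1 C.
rewrite E in E0.
have {}E : 2 * II (fun x => x.2 * phi x) (partial ord_max phi) + II phi phi = 0.
  by apply: E0 => x1 /=; rewrite (van2 x1).1 (van2 x1).2 !mulr0.
have b := ip_le_nrm mC Ly L'.
have b2 : NN (fun x => x.2 * phi x) <= 2^-1 * NN phi.
  apply: (nrmM_bounded mC) => //; first by apply: continuous_measurable_prod.
  by move=> [x1 x2] [_ /=]; rewrite in_itv /= ler_norml.
have [->|n0] := eqVneq (NN phi) 0; first exact: nrm_ge0.
have np : 0 < NN phi by rewrite lt_def n0 nrm_ge0.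
rewrite -(ler_pM2l np) -expr2 nrm_sqr.
have := ler_wpM2r (nrm_ge0 (leb2 R) (cell L1) (partial ord_max phi)) b2.
move: b; rewrite ler_norml => /andP[]; nra.
Qed.

Lemma H10_poincare f g : H10 f g -> NN f <= NN (g ord_max).
Proof.
move=> [Lf Lg H]; rewrite -subr_le0; apply: (@le0_small _ _ 2) => // e e0.
have [phi tp [h1 h2]] := H _ e0; have := test_poincare tp.
have := nrm_approx mC Lf (test_L2 tp).
have := nrm_approx mC (test_partial_L2 ord_max tp) (Lg ord_max).
rewrite (nrm_distC (leb2 R) (cell L1) (partial ord_max phi)); have := h2 ord_max; lra.
Qed.

Lemma H1_weak (u : H1 L1) j psi : test_function L1 psi ->
  II u (partial j psi) = - II (grad u j) psi.
Proof. by move=> tp; rewrite !ipE; exact: grad_weak. Qed.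

Lemma test_sqr psi : test_function L1 psi ->
  test_function L1 (fun x => psi x * psi x) /\
  forall j, partial j (fun x => psi x * psi x) = (fun x => 2 * (psi x * partial j psi x)).
Proof.
move=> tp; have Cp := test_C1_gradient tp; split.
  exact: C1M_test Cp (test_periodic tp) tp.
by move=> j; rewrite (C1_partial (C1M Cp Cp)); apply/funext => x; ring.
Qed.

(** * Skew-symmetry of advection by a bounded divergence-free field *)

Section advection.
Context (U : vector_field L1) (M : R).
Hypotheses (M0 : 0 <= M) (UM : forall i x, cell L1 x -> `|U i x| <= M).
Hypothesis divU : divergence_free U.

Lemma U_L2 i : LL (U i). Proof. exact: (H1_L2 (U i)). Qed.

Lemma U_mul_L2 j f : LL f -> LL (fun x => U j x * f x).
Proof. by move=> Lf; apply: (L2M_bounded mC (proj1 (U_L2 j)) Lf); exact: UM. Qed.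

Lemma U_mul_nrm j f : LL f -> NN (fun x => U j x * f x) <= M * NN f.
Proof. by move=> Lf; apply: (nrmM_bounded mC M0 (proj1 (U_L2 j)) Lf); exact: UM. Qed.

(** Since 2 phi d_j phi = d_j (phi^2) and phi^2 is a test function, the weak gradient of [U] turns
    the sum into - 1/2 the integral of (div U) phi^2. *)
Lemma test_advection_skew phi : test_function L1 phi ->
  \sum_(j < 2) II (fun x => U j x * partial j phi x) phi = 0.
Proof.
move=> tp; have [ts pE] := test_sqr tp.
have Lt := test_L2 ts; have L' j := test_partial_L2 j tp.
have E j : II (fun x => U j x * partial j phi x) phi =
    - 2^-1 * II (grad (U j) j) (fun x => phi x * phi x).
  have := H1_weak (U j) j ts; rewrite pE => H.
  have : II (U j) (fun x => 2 * (phi x * partial j phi x)) =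
      2 * II (fun x => U j x * partial j phi x) phi.
    rewrite -ipZl //; [|exact: U_mul_L2|exact: test_L2].
    by rewrite !ipE; apply: eq_Rintegral => x _; ring.
  by rewrite H; lra.
under eq_bigr do rewrite E.
rewrite -mulr_sumr -(@ip_sum _ _ _ (leb2 R) _ mC 2 (fun j => grad (U j) j)) //.
  rewrite (ip_ae0 mC) ?mulr0 //; last exact: (proj1 Lt).
  by apply: measurable_sum => j; exact: (proj1 (grad_L2 (U j) j)).
by move=> j; exact: (grad_L2 (U j) j).
Qed.

Lemma advection_skew f g : H10 f g ->
  \sum_(j < 2) II (fun x => U j x * g j x) f = 0.
Proof.
move=> [Lf Lg H]; apply/eqP; rewrite -normr_eq0 eq_le normr_ge0 andbT.
pose G := NN (g ord0) + NN (g ord_max) + 1.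
apply: (@le0_small _ _ (2 * (M * NN f) + 2 * (M * G) )).
  by rewrite /G !(addr_ge0, mulr_ge0, nrm_ge0).
(* The bound e' <= 1 keeps |d_j phi| below |g_j| + 1 <= [G], uniformly in the approximation. *)
move=> e e0; pose e' := Num.min 1 e.
have e'0 : 0 < e' by rewrite lt_min ltr01 e0.
have e'e : e' <= e /\ e' <= 1 by split; rewrite ge_min lexx ?orbT.
have [phi tp [h1 h2]] := H _ e'0.
have Lp := test_L2 tp; have L' j := test_partial_L2 j tp.
have E j : II (fun x => U j x * g j x) f =
  II (fun x => U j x * (g j x - partial j phi x)) f +
  II (fun x => U j x * partial j phi x) (fun x => f x - phi x) +
  II (fun x => U j x * partial j phi x) phi.
  rewrite ipBr //; last exact: U_mul_L2.
  have -> : II (fun x => U j x * (g j x - partial j phi x)) f =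
     II (fun x => U j x * g j x - U j x * partial j phi x) f.
    by apply: eq_ip => // x _; rewrite mulrBr.
  by rewrite ipBl //; [ring|exact: U_mul_L2..].
have B1 j : `|II (fun x => U j x * (g j x - partial j phi x)) f| <= e * (M * NN f).
  have Ld := L2B mC (Lg j) (L' j).
  apply: le_trans (ip_le_nrm mC (U_mul_L2 j Ld) Lf) _.
  rewrite mulrA ler_wpM2r ?nrm_ge0 //; apply: le_trans (U_mul_nrm j Ld) _.
  by rewrite mulrC ler_wpM2r // (le_trans (h2 j)) // e'e.1.
have B2 j : `|II (fun x => U j x * partial j phi x) (fun x => f x - phi x)| <= e * (M * G).
  have Ld := L2B mC Lf Lp.
  apply: le_trans (ip_le_nrm mC (U_mul_L2 j (L' j)) Ld) _.
  rewrite mulrC; apply: ler_pM; rewrite ?nrm_ge0 //; first by rewrite (le_trans h1) // e'e.1.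
  apply: le_trans (U_mul_nrm j (L' j)) _; apply: ler_wpM2l => //.
  apply: (@le_trans _ _ (NN (g j) + 1)).
    apply: le_trans (nrm_approx mC (L' j) (Lg j)) _; rewrite lerD2l.
    by rewrite (nrm_distC (leb2 R) (cell L1) (partial j phi)) (le_trans (h2 j)) // e'e.2.
  rewrite /G lerD2r; case: (ord2P j) => ->.
    by rewrite lerDl nrm_ge0.
  by rewrite lerDr nrm_ge0.
have := test_advection_skew tp; rewrite !sum2 => S0.
rewrite E (E ord_max); exact: six_terms (B1 _) (B1 _) (B2 _) (B2 _) S0.
Qed.

End advection.
End H10.

(** * Existence of passive fields *)

Lemma ip_combl d (T : measurableType d) (R : realType)
    (mu : {measure set T -> \bar R}) (D : set T) (mD : measurable D)
    (a : R) (f g h : T -> R) : L2 mu D f -> L2 mu D g -> L2 mu D h ->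
  ip mu D (fun x => a * f x + g x) h = a * ip mu D f h + ip mu D g h.
Proof. by move=> Lf Lg Lh; rewrite (ipDl mD (L2Z mD a Lf) Lg Lh) (ipZl mD). Qed.

Lemma ip_combr d (T : measurableType d) (R : realType)
    (mu : {measure set T -> \bar R}) (D : set T) (mD : measurable D)
    (a : R) (f g h : T -> R) : L2 mu D f -> L2 mu D g -> L2 mu D h ->
  ip mu D h (fun x => a * f x + g x) = a * ip mu D h f + ip mu D h g.
Proof. by move=> Lf Lg Lh; rewrite ipC (ip_combl mD) // !(ipC _ _ h). Qed.

Lemma le_sum_term (R : numDomainType) (n : nat) (F : 'I_n -> R) (i : 'I_n) :
  (forall j, 0 <= F j) -> F i <= \sum_(j < n) F j.
Proof. by move=> F0; rewrite (bigD1 i) //= lerDl sumr_ge0. Qed.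

(* Candidate values and gradients of vector fields; unlike [vector_field], a left module. *)
Definition jet (R : realType) := 'I_2 -> (R * R -> R) * ('I_2 -> R * R -> R).
HB.instance Definition _ (R : realType) := GRing.Lmodule.on (jet R).

Section existence.
Context (R : realType) (L1 : R).
Hypothesis hL1 : 0 < L1.

Notation LL := (L2 (leb2 R) (cell L1)).
Notation II := (ip (leb2 R) (cell L1)).
Notation NN := (nrm (leb2 R) (cell L1)).
Let mC := @measurable_cell R L1.

Implicit Types u v w : jet R.

Definition jet_div w (x : R * R) : R := \sum_(i < 2) (w i).2 i x.

(** The divergence vanishes in the sense of the L^2 norm, a condition that passes to combinations
    and limits without handling null sets; [ip_eq0_ae] recovers the almost everywhere statement. *)
Definition solenoidal w :=
  (forall i, H10 L1 (w i).1 (w i).2) /\ II (jet_div w) (jet_div w) = 0.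

Definition grad_ip u v : R := \sum_(i < 2) \sum_(j < 2) II ((u i).2 j) ((v i).2 j).

Lemma jet_L2 w i : solenoidal w -> LL (w i).1.
Proof. by case=> /(_ i)[]. Qed.

Lemma jet_grad_L2 w i j : solenoidal w -> LL ((w i).2 j).
Proof. by case=> /(_ i)[] _ /(_ j). Qed.

Lemma jet_div_L2 w : (forall i j, LL ((w i).2 j)) -> LL (jet_div w).
Proof. by move=> H; apply: (L2_sum mC) => i; exact: H. Qed.

Lemma solenoidal0 : solenoidal 0.
Proof.
split.
  move=> i; have t0 : test_function L1 (fun=> 0 : R).
    by apply: (C1_test (d := 1) (C1_cst (0 : R))).
  have := test_H10 hL1 t0; congr H10.
  by apply/funext => j; rewrite (C1_partial (C1_cst (0 : R))).
rewrite -(ip0l (leb2 R) mC (jet_div 0)); apply: eq_ip => // x _.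
by rewrite /jet_div sum2 addr0.
Qed.

Lemma solenoidal_comb a u v : solenoidal u -> solenoidal v -> solenoidal (a *: u + v).
Proof.
move=> su sv; split.
  by move=> i; apply: (H10_comb hL1 a (su.1 i) (sv.1 i)).
have Lu := jet_div_L2 (fun i j => jet_grad_L2 i j su).
have Lv := jet_div_L2 (fun i j => jet_grad_L2 i j sv).
have E : II (jet_div (a *: u + v)) (jet_div (a *: u + v)) =
    II (fun x => a * jet_div u x + jet_div v x) (fun x => a * jet_div u x + jet_div v x).
  by apply: eq_ip => x _; rewrite /jet_div !sum2 /=; rewrite mulrDr addrACA.
have h : 0 <= (II (fun x => a * jet_div u x) (fun x => a * jet_div u x) +
    II (jet_div v) (jet_div v)) *+ 2.
  by rewrite mulrn_wge0 // addr_ge0 ?ip_ge0.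
apply/eqP; rewrite eq_le ip_ge0 andbT E.
apply: le_trans (ipD_le mC (L2Z mC a Lu) Lv) _.
by rewrite (ipZl mC) // ?(ipZr mC) //; [rewrite su.2 sv.2 !mulr0 addr0|exact: L2Z].
Qed.

Lemma grad_ipC u v : grad_ip u v = grad_ip v u.
Proof. by apply: eq_bigr => i _; apply: eq_bigr => j _; exact: ipC. Qed.

Lemma grad_ip_ge0 u : 0 <= grad_ip u u.
Proof. by apply: sumr_ge0 => i _; apply: sumr_ge0 => j _; exact: ip_ge0. Qed.

Lemma grad_ip_comb a u v w : solenoidal u -> solenoidal v -> solenoidal w ->
  grad_ip (a *: u + v) w = a * grad_ip u w + grad_ip v w.
Proof.
move=> su sv sw; rewrite /grad_ip mulr_sumr -big_split; apply: eq_bigr => i _ /=.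
rewrite mulr_sumr -big_split; apply: eq_bigr => j _ /=.
exact: (ip_combl mC) (jet_grad_L2 i j su) (jet_grad_L2 i j sv) (jet_grad_L2 i j sw).
Qed.

Lemma grad_nrm_le u i j : NN ((u i).2 j) ^+ 2 <= grad_ip u u.
Proof.
rewrite nrm_sqr.
apply: le_trans (le_sum_term (F := fun j => II ((u i).2 j) ((u i).2 j)) j _) _.
  by move=> k; exact: ip_ge0.
apply: (le_sum_term (F := fun i => \sum_(j < 2) II ((u i).2 j) ((u i).2 j)) i) => k.
by apply: sumr_ge0 => l _; exact: ip_ge0.
Qed.

Lemma val_nrm_le u i : solenoidal u -> NN (u i).1 ^+ 2 <= grad_ip u u.
Proof.
move=> su; apply: le_trans (grad_nrm_le u i ord_max).
rewrite ler_pXn2r // ?nnegrE ?nrm_ge0 //.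
exact: (H10_poincare hL1 (su.1 i)).
Qed.

Lemma solenoidal_limit (u : nat -> jet R) v : (forall n, solenoidal (u n)) ->
  (forall i, LL (v i).1) -> (forall i j, LL ((v i).2 j)) ->
  (forall e, 0 < e -> exists n, (forall i, NN (fun x => (u n i).1 x - (v i).1 x) <= e) /\
     forall i j, NN (fun x => (u n i).2 j x - (v i).2 j x) <= e) ->
  solenoidal v.
Proof.
move=> su Lv Lgv H; split => [i|].
  apply: (H10_limit hL1) => // e e0; have [n [h1 h2]] := H e e0.
  exists (u n i).1, (u n i).2; split; first exact: (su n).1.
    by rewrite (nrm_distC (leb2 R) (cell L1) (v i).1).
  by move=> j; rewrite (nrm_distC (leb2 R) (cell L1) ((v i).2 j)).
have Ld := jet_div_L2 Lgv.
suff n0 : NN (jet_div v) <= 0.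
  move: n0; rewrite (le_nrm_sqr _ _ _ (lexx 0)) expr0n /= => n0.
  by apply/eqP; rewrite eq_le n0 ip_ge0.
apply: (@le0_small _ _ 2) => // e e0; have [n [_ h2]] := H e e0.
have Lu i j := jet_grad_L2 i j (su n).
have Lud := jet_div_L2 Lu.
have z : NN (jet_div (u n)) = 0 by rewrite nrmE (su n).2 sqrtr0.
apply: le_trans (nrm_approx mC Ld Lud) _; rewrite z add0r.
have -> : NN (fun x => jet_div v x - jet_div (u n) x) =
    NN (fun x => ((v ord0).2 ord0 x - (u n ord0).2 ord0 x) +
                 ((v ord_max).2 ord_max x - (u n ord_max).2 ord_max x)).
  by apply: eq_nrm => x _; rewrite /jet_div !sum2; ring.
apply: le_trans (nrmD mC (L2B mC (Lgv _ _) (Lu _ _)) (L2B mC (Lgv _ _) (Lu _ _))) _.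
rewrite mulr_natr mulr2n; apply: lerD.
  by rewrite (nrm_distC (leb2 R) (cell L1) ((v ord0).2 ord0)).
by rewrite (nrm_distC (leb2 R) (cell L1) ((v ord_max).2 ord_max)).
Qed.

(** By the Poincare inequality the increments of the values are controlled by those of the
    gradients, so [L2_complete] applies to each component of both, and [solenoidal_limit] keeps the
    limits compatible. *)
Lemma grad_ip_complete (u : nat -> jet R) : (forall n, solenoidal (u n)) ->
  (forall n, grad_ip (u n.+1 - u n) (u n.+1 - u n) <= (4^-1) ^+ n) ->
  exists2 v, solenoidal v & forall e, 0 < e ->
    exists N, forall n, (N <= n)%N -> grad_ip (u n - v) (u n - v) <= e.
Proof.
move=> su du.
have sd n : solenoidal (u n.+1 - u n).
  have := solenoidal_comb (-1) (su n) (su n.+1).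
  by rewrite scaleN1r addrC.
have dval i n : II (fun x => (u n.+1 i).1 x - (u n i).1 x)
    (fun x => (u n.+1 i).1 x - (u n i).1 x) <= 1 * (4^-1) ^+ n.
  rewrite mul1r; apply: le_trans (du n); apply: le_trans (val_nrm_le i (sd n)).
  by rewrite nrm_sqr.
have dgrad i j n : II (fun x => (u n.+1 i).2 j x - (u n i).2 j x)
    (fun x => (u n.+1 i).2 j x - (u n i).2 j x) <= 1 * (4^-1) ^+ n.
  rewrite mul1r; apply: le_trans (du n); apply: le_trans (grad_nrm_le _ i j).
  by rewrite nrm_sqr.
have /choice[f Hf] : forall i, exists g, LL g /\
    forall n, II (fun x => (u n i).1 x - g x) (fun x => (u n i).1 x - g x) <=
      4 * 1 * (4^-1) ^+ n.
  move=> i; have [g Lg Hg] := L2_complete mC (cell_finite hL1) ler01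
    (fun n => jet_L2 i (su n)) (dval i).
  by exists g.
have /choice[g Hg] : forall ij, exists g, LL g /\
    forall n, II (fun x => (u n ij.1).2 ij.2 x - g x)
      (fun x => (u n ij.1).2 ij.2 x - g x) <= 4 * 1 * (4^-1) ^+ n.
  move=> [i j]; have [h Lh Hh] := L2_complete mC (cell_finite hL1) ler01
    (fun n => jet_grad_L2 i j (su n)) (dgrad i j).
  by exists h.
pose v : jet R := fun i => (f i, fun j => g (i, j)).
have small (e : R) : 0 < e -> exists N, forall n, (N <= n)%N -> (4^-1) ^+ n <= e.
  move=> e0; have q1 : 0 <= (4^-1 : R) < 1 by apply/andP; split; lra.
  have [N HN] := geometric_small q1 ler01 e0; exists N => n Nn.
  apply: le_trans HN; rewrite mulr1; apply: ler_wiXn2l => //; lra.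
exists v.
  apply: (solenoidal_limit su) => [i|i j|e e0].
  - exact: (Hf i).1.
  - exact: (Hg (i, j)).1.
  have e4 : 0 < e ^+ 2 / 4 by rewrite divr_gt0 // exprn_gt0.
  have [N HN] := small _ e4.
  have bd : 4 * 1 * (4^-1) ^+ N <= e ^+ 2.
    by have := HN N (leqnn _); move: (_ ^+ N) (e ^+ 2) => p q; lra.
  exists N; split => [i|i j]; rewrite (le_nrm_sqr _ _ _ (ltW e0)); apply: le_trans bd.
    exact: (Hf i).2.
  exact: (Hg (i, j)).2.
move=> e e0; have e16 : 0 < e / 16 by rewrite divr_gt0.
have [N HN] := small _ e16; exists N => n Nn.
have bd i j : II (fun x => (u n i).2 j x - g (i, j) x) (fun x => (u n i).2 j x - g (i, j) x) <= e / 4.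
  apply: le_trans ((Hg (i, j)).2 n) _; have := HN n Nn.
  rewrite mulr1; move: (_ ^+ n) => p; lra.
have := bd ord0 ord0; have := bd ord0 ord_max; have := bd ord_max ord0; have := bd ord_max ord_max.
rewrite /grad_ip !sum2 /=.
move: (II _ _) (II _ _) (II _ _) (II _ _) => a b c d; lra.
Qed.

End existence.

Section Rintegral_sum.
Context d (T : measurableType d) (R : realType).
Variables (mu : {measure set T -> \bar R}) (D : set T).
Hypothesis mD : measurable D.

Lemma integrable_sum2 (F : 'I_2 -> T -> R) :
  (forall i, mu.-integrable D (EFin \o F i)) ->
  mu.-integrable D (EFin \o (fun x => \sum_(i < 2) F i x)).
Proof.
move=> iF; have := integrableD mD (iF ord0) (iF ord_max); apply: eq_integrable => //.
by move=> x _ /=; rewrite sum2 EFinD.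
Qed.

Lemma Rintegral_sum2 (F : 'I_2 -> T -> R) :
  (forall i, mu.-integrable D (EFin \o F i)) ->
  \int[mu]_(x in D) (\sum_(i < 2) F i x) = \sum_(i < 2) \int[mu]_(x in D) F i x.
Proof.
move=> iF; rewrite sum2 -RintegralD //.
by apply: eq_Rintegral => x _; rewrite sum2.
Qed.

End Rintegral_sum.

(** * The weak formulation and its solution *)

Section passive.
Context (R : realType) (L1 : R).
Hypothesis hL1 : 0 < L1.

Notation LL := (L2 (leb2 R) (cell L1)).
Notation II := (ip (leb2 R) (cell L1)).
Notation NN := (nrm (leb2 R) (cell L1)).
Let mC := @measurable_cell R L1.

Lemma H1_exists (f : R * R -> R) (g : 'I_2 -> R * R -> R) :
  LL f -> (forall j, LL (g j)) ->
  (forall j psi, test_function L1 psi -> II f (partial j psi) = - II (g j) psi) ->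
  exists u : H1 L1, H1_fun u = f /\ grad u = g.
Proof.
move=> Lf Lg H.
have W j psi : test_function L1 psi ->
    \int[leb2 R]_(x in cell L1) (f x * partial j psi x) =
    - \int[leb2 R]_(x in cell L1) (g j x * psi x).
  by move=> tp; rewrite -!ipE; exact: H.
by exists (Build_H1 Lf Lg W).
Qed.

Lemma laminar_C1 i : C1_gradient (@laminar R i) (laminar_grad i).
Proof.
case: (ord2P i) => ->.
  apply: eq_C1 (C1_snd R) => [x|j x]; first by rewrite /laminar eqxx.
  by rewrite /laminar_grad eqxx; case: (ord2P j) => ->.
apply: eq_C1 (C1_cst (0 : R)) => [x|j x]; first by rewrite /laminar.
by rewrite /laminar_grad.
Qed.

Lemma laminar_periodic i x1 x2 : @laminar R i (x1 + L1, x2) = laminar i (x1, x2).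
Proof. by []. Qed.

Lemma laminar_L2 i : LL (@laminar R i).
Proof. exact: (continuous_L2 hL1 (C1_continuous (laminar_C1 i))). Qed.

Lemma laminar_grad_L2 i j : LL (@laminar_grad R i j).
Proof. exact: (continuous_L2 hL1 (@C1_gradient_continuous _ _ _ (laminar_C1 i) j)). Qed.

Definition jet_of (v : vector_field L1) : jet R := fun i => (H1_fun (v i), grad (v i)).

Lemma H1_fun_L2 (v : H1 L1) : LL v. Proof. exact: H1_L2. Qed.

Lemma H1_grad_L2 (v : H1 L1) j : LL (grad v j). Proof. exact: grad_L2. Qed.

Lemma divergence_free_ip (v : vector_field L1) : divergence_free v ->
  II (jet_div (jet_of v)) (jet_div (jet_of v)) = 0.
Proof.
move=> dv; have Ld : LL (jet_div (jet_of v)).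
  by apply: jet_div_L2 => i j; exact: H1_grad_L2.
apply: (ip_ae0 mC (proj1 Ld) (proj1 Ld)).
exact: (ae_mono dv).
Qed.

Lemma no_slip_solenoidal (v : vector_field L1) : divergence_free v -> no_slip v ->
  solenoidal L1 (jet_of v).
Proof.
move=> dv nv; split; last exact: divergence_free_ip.
by move=> i; apply/(in_H10P hL1); [exact: H1_fun_L2|exact: H1_grad_L2|exact: nv].
Qed.

Lemma Rintegral_grad_dot (u v : vector_field L1) :
  \int[leb2 R]_(x in cell L1) grad_dot u v x =
  \sum_(i < 2) \sum_(j < 2) II (grad (u i) j) (grad (v i) j).
Proof.
have iF i j := L2_mul_integrable mC (H1_grad_L2 (u i) j) (H1_grad_L2 (v i) j).
rewrite /grad_dot (Rintegral_sum2 mC); last first.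
  by move=> i; apply: (integrable_sum2 mC (iF i)).
apply: eq_bigr => i _; rewrite (Rintegral_sum2 mC (iF i)).
by apply: eq_bigr => j _; rewrite ipE.
Qed.

Section with_velocity.
Context (U : vector_field L1) (M : R).
Hypotheses (M0 : 0 <= M) (UM : forall i x, cell L1 x -> `|U i x| <= M).
Hypothesis divU : divergence_free U.

Lemma Rintegral_advection (u v : vector_field L1) :
  \int[leb2 R]_(x in cell L1) advection U u v x =
  \sum_(i < 2) \sum_(j < 2) II (fun x => U j x * grad (u i) j x) (v i).
Proof.
have LU i j := U_mul_L2 UM j (H1_grad_L2 (u i) j).
have LS i := L2_sum mC (LU i).
rewrite /advection (Rintegral_sum2 mC); last first.
  by move=> i; exact: (L2_mul_integrable mC (LS i) (H1_fun_L2 (v i))).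
apply: eq_bigr => i _; rewrite -(ipE (leb2 R) (cell L1) _ (v i)).
exact: (ip_sum mC (LU i) (H1_fun_L2 (v i))).
Qed.

Definition advection_form (w v : jet R) : R :=
  \sum_(i < 2) \sum_(j < 2) II (fun x => U j x * (w i).2 j x) (v i).1.

Lemma advection_form_combl a u v w : solenoidal L1 u -> solenoidal L1 v ->
  solenoidal L1 w ->
  advection_form (a *: u + v) w = a * advection_form u w + advection_form v w.
Proof.
move=> su sv sw; rewrite /advection_form mulr_sumr -big_split; apply: eq_bigr => i _ /=.
rewrite mulr_sumr -big_split; apply: eq_bigr => j _ /=.
have Lu := U_mul_L2 UM j (jet_grad_L2 i j su).
have Lv := U_mul_L2 UM j (jet_grad_L2 i j sv).
rewrite -(ip_combl mC a Lu Lv (jet_L2 i sw)); apply: eq_ip => // x _.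
by rewrite mulrDr mulrCA.
Qed.

Lemma advection_form_combr a u v w : solenoidal L1 u -> solenoidal L1 v ->
  solenoidal L1 w ->
  advection_form w (a *: u + v) = a * advection_form w u + advection_form w v.
Proof.
move=> su sv sw; rewrite /advection_form mulr_sumr -big_split; apply: eq_bigr => i _ /=.
rewrite mulr_sumr -big_split; apply: eq_bigr => j _ /=.
have Lw := U_mul_L2 UM j (jet_grad_L2 i j sw).
exact: (ip_combr mC a (jet_L2 i su) (jet_L2 i sv) Lw).
Qed.

Lemma advection_form_skew w : solenoidal L1 w -> advection_form w w = 0.
Proof.
move=> sw; rewrite /advection_form big1 // => i _.
exact: (advection_skew hL1 M0 UM divU (sw.1 i)).
Qed.

Definition grad_nrm (w : jet R) : R := Num.sqrt (grad_ip L1 w w).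

Lemma grad_nrm_ge0 w : 0 <= grad_nrm w. Proof. exact: sqrtr_ge0. Qed.

Lemma grad_nrm_sqr w : grad_nrm w ^+ 2 = grad_ip L1 w w.
Proof. by rewrite sqr_sqrtr // grad_ip_ge0. Qed.

Lemma nrm_le_grad_nrm w i j : NN ((w i).2 j) <= grad_nrm w.
Proof.
rewrite -(ler_pXn2r (n := 2)) // ?nnegrE ?nrm_ge0 ?grad_nrm_ge0 //.
by rewrite grad_nrm_sqr; exact: grad_nrm_le.
Qed.

Lemma val_le_grad_nrm w i : solenoidal L1 w -> NN (w i).1 <= grad_nrm w.
Proof.
move=> sw; rewrite -(ler_pXn2r (n := 2)) // ?nnegrE ?nrm_ge0 ?grad_nrm_ge0 //.
by rewrite grad_nrm_sqr; exact: val_nrm_le.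
Qed.

Lemma sum22_le (F : 'I_2 -> 'I_2 -> R) (a : R) : (forall i j, `|F i j| <= a) ->
  `|\sum_(i < 2) \sum_(j < 2) F i j| <= 4 * a.
Proof.
move=> H; rewrite !sum2; have := H ord0 ord0; have := H ord0 ord_max.
have := H ord_max ord0; have := H ord_max ord_max; rewrite !ler_norml.
move=> /andP[? ?] /andP[? ?] /andP[? ?] /andP[? ?]; apply/andP; split; lra.
Qed.

Lemma advection_form_le w v : solenoidal L1 w -> solenoidal L1 v ->
  `|advection_form w v| <= 4 * (M * (grad_nrm w * grad_nrm v)).
Proof.
move=> sw sv; apply: sum22_le => i j.
have Lw := jet_grad_L2 i j sw.
apply: le_trans (ip_le_nrm mC (U_mul_L2 UM j Lw) (jet_L2 i sv)) _.
rewrite mulrA; apply: ler_pM; rewrite ?nrm_ge0 //; last exact: val_le_grad_nrm.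
apply: le_trans (U_mul_nrm M0 UM j Lw) _; rewrite ler_wpM2l //.
exact: nrm_le_grad_nrm.
Qed.

Lemma grad_ip_le w v : solenoidal L1 w -> solenoidal L1 v ->
  `|grad_ip L1 w v| <= 4 * (grad_nrm w * grad_nrm v).
Proof.
move=> sw sv; apply: sum22_le => i j.
apply: le_trans (ip_le_nrm mC (jet_grad_L2 i j sw) (jet_grad_L2 i j sv)) _.
by apply: ler_pM; rewrite ?nrm_ge0 // nrm_le_grad_nrm.
Qed.

Lemma norm_le_sqr (x a : R) : `|x| <= a -> x ^+ 2 <= a ^+ 2.
Proof.
move=> xa; rewrite -(real_normK (num_real x)) lerXn2r ?nnegrE //.
exact: le_trans xa.
Qed.

(** The equation for w = u - x2 e1: the laminar profile contributes U . grad (x2 e1) = U2 e1, whence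
    the right-hand side. In [lax_milgram] the coercivity constant is [nu] itself, advection being
    skew; the factors 4 in the continuity bound count the entries of the gradient. *)
Lemma solve_perturbation (nu : R) : 0 < nu ->
  exists2 w, solenoidal L1 w & forall v, solenoidal L1 v ->
    nu * grad_ip L1 w v + advection_form w v = - II (U ord_max) (v ord0).1.
Proof.
move=> nu0; have LU := H1_fun_L2 (U ord_max).
apply: (@lax_milgram R (jet R) (solenoidal L1) (grad_ip L1)
  (solenoidal0 hL1) (solenoidal_comb hL1)
  (@grad_ip_comb R L1) (fun u v _ _ => grad_ipC L1 u v) (fun u _ => grad_ip_ge0 L1 u)
  (grad_ip_complete hL1)
  (fun w v => nu * grad_ip L1 w v + advection_form w v)
  (fun v => - II (U ord_max) (v ord0).1) nu ((4 * nu + 4 * M) ^+ 2)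
  (NN (U ord_max) ^+ 2)) => //.
- move=> w sw a u v su sv; rewrite (@grad_ip_comb R L1) // advection_form_combl //; ring.
- move=> w sw a u v su sv; rewrite (grad_ipC _ w) (@grad_ip_comb R L1) //.
  rewrite advection_form_combr // !(grad_ipC _ w); ring.
- move=> u v su sv; rewrite -!grad_nrm_sqr -!exprMn; apply: norm_le_sqr.
  apply: le_trans (ler_normD _ _) _; rewrite normrM (gtr0_norm nu0) mulrDl.
  apply: lerD; last by rewrite -mulrA; exact: advection_form_le.
  rewrite -mulrA (mulrCA 4) ler_wpM2l ?(ltW nu0) //.
  exact: grad_ip_le.
- by move=> u su; rewrite advection_form_skew // addr0.
- move=> a u v su sv; rewrite (ip_combr mC a (jet_L2 _ su) (jet_L2 _ sv) LU); ring.
- move=> v sv; rewrite sqrrN -grad_nrm_sqr -exprMn; apply: norm_le_sqr.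
  apply: le_trans (ip_le_nrm mC LU (jet_L2 ord0 sv)) _.
  by rewrite ler_wpM2l ?nrm_ge0 // val_le_grad_nrm.
Qed.

Theorem passive_field_exists (nu : R) : 0 < nu ->
  exists u : vector_field L1, passive_field nu U u.
Proof.
move=> nu0; have [w sw Hw] := solve_perturbation nu0.
have /choice[u Hu] : forall i, exists u : H1 L1,
    H1_fun u = (fun x => (w i).1 x + laminar i x) /\
    grad u = (fun j x => (w i).2 j x + laminar_grad i j x).
  move=> i; apply: H1_exists.
  - exact: (L2D mC (jet_L2 i sw) (laminar_L2 i)).
  - by move=> j; exact: (L2D mC (jet_grad_L2 i j sw) (laminar_grad_L2 i j)).
  move=> j psi tp.
  rewrite (ipDl mC (jet_L2 i sw) (laminar_L2 i) (test_partial_L2 hL1 j tp)).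
  rewrite (ipDl mC (jet_grad_L2 i j sw) (laminar_grad_L2 i j) (test_L2 hL1 tp)).
  rewrite (H10_weak hL1 (sw.1 i) j tp).
  rewrite (C1_weak_gradient hL1 (laminar_C1 i) (laminar_periodic i) j tp).
  by rewrite opprD.
have uE i : H1_fun (u i) = (fun x => (w i).1 x + laminar i x) by case: (Hu i).
have gE i j : grad (u i) j = (fun x => (w i).2 j x + laminar_grad i j x).
  by case: (Hu i) => _ ->.
have Lwd := jet_div_L2 (fun i j => jet_grad_L2 i j sw).
exists u; split.
- apply: (ae_mono (ip_eq0_ae mC Lwd sw.2)) => x H Dx; apply: etrans (H Dx).
  apply: eq_bigr => i _; rewrite gE /laminar_grad.
  by case: (ord2P i) => ->; rewrite addr0.
- move=> i; apply/(in_H10P hL1).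
  + rewrite uE; exact: (L2B mC (L2D mC (jet_L2 i sw) (laminar_L2 i)) (laminar_L2 i)).
  + move=> j; rewrite gE.
    exact: (L2B mC (L2D mC (jet_grad_L2 i j sw) (laminar_grad_L2 i j)) (laminar_grad_L2 i j)).
  + have := sw.1 i; congr H10; first by apply/funext => x; rewrite uE addrK.
    by apply/funext => j; apply/funext => x; rewrite gE addrK.
move=> v dv nv; have sv := no_slip_solenoidal dv nv.
rewrite Rintegral_grad_dot Rintegral_advection.
have -> : \sum_(i < 2) \sum_(j < 2) II (grad (u i) j) (grad (v i) j) =
    grad_ip L1 w (jet_of v).
  (* The viscous term of x2 e1 is the integral of d2 v1, which vanishes because v1 is in H^1_0. *)
  have E : \sum_(i < 2) \sum_(j < 2) II (@laminar_grad R i j) (grad (v i) j) = 0.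
    rewrite !sum2.
    have z i j : (i == ord0) && (j == ord_max) = false ->
        II (@laminar_grad R i j) (grad (v i) j) = 0.
      move=> F; apply: etrans (ip0l (leb2 R) mC (grad (v i) j)).
      by apply: eq_ip => // x _; rewrite /laminar_grad F.
    rewrite (z ord0 ord0) // (z ord_max ord0) // (z ord_max ord_max) // !addr0 add0r.
    apply: etrans (H10_mean_gradient hL1 ord_max (sv.1 ord0)).
    by rewrite ipE; apply: eq_Rintegral => x _; rewrite /laminar_grad /= mul1r.
  rewrite -[RHS]addr0 -[X in _ = _ + X]E /grad_ip -big_split; apply: eq_bigr => i _ /=.
  rewrite -big_split; apply: eq_bigr => j _ /=.
  by rewrite gE (ipDl mC (jet_grad_L2 i j sw) (laminar_grad_L2 i j) (H1_grad_L2 (v i) j)).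
have -> : \sum_(i < 2) \sum_(j < 2) II (fun x => U j x * grad (u i) j x) (v i) =
    advection_form w (jet_of v) + II (U ord_max) (v ord0).
  (* The advection of x2 e1 cancels the right-hand side of the equation for w. *)
  have E : \sum_(i < 2) \sum_(j < 2) II (fun x => U j x * laminar_grad i j x) (v i) =
      II (U ord_max) (v ord0).
    rewrite !sum2.
    have z i j : (i == ord0) && (j == ord_max) = false ->
        II (fun x => U j x * laminar_grad i j x) (v i) = 0.
      move=> F; apply: etrans (ip0l (leb2 R) mC (v i)).
      by apply: eq_ip => // x _; rewrite /laminar_grad F mulr0.
    rewrite (z ord0 ord0) // (z ord_max ord0) // (z ord_max ord_max) // !addr0 add0r.
    by apply: eq_ip => // x _; rewrite /laminar_grad /= mulr1.
  rewrite -E /advection_form -big_split; apply: eq_bigr => i _ /=.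
  rewrite -big_split; apply: eq_bigr => j _ /=.
  rewrite -(ipDl mC (U_mul_L2 UM j (jet_grad_L2 i j sw))
    (U_mul_L2 UM j (laminar_grad_L2 i j)) (H1_fun_L2 (v i))).
  by apply: eq_ip => // x _; rewrite gE mulrDr.
by rewrite addrA Hw // addNr.
Qed.

End with_velocity.
End passive.

(** * Dissipation and momentum flux *)

Section lower_bound.
Context (R : realType) (L1 : R).
Hypothesis hL1 : 0 < L1.

Notation LL := (L2 (leb2 R) (cell L1)).
Notation II := (ip (leb2 R) (cell L1)).
Notation NN := (nrm (leb2 R) (cell L1)).
Let mC := @measurable_cell R L1.

Definition grad_norm (u : vector_field L1) : R := grad_nrm L1 (jet_of u).

Lemma grad_norm_sqr (u : vector_field L1) :
  grad_norm u ^+ 2 = \int[leb2 R]_(x in cell L1) grad_dot u u x.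
Proof. by rewrite /grad_norm grad_nrm_sqr Rintegral_grad_dot. Qed.

Lemma dissipation_grad_norm (nu : R) (u : vector_field L1) :
  dissipation nu u = nu * (L1^-1 * grad_norm u ^+ 2).
Proof. by rewrite /dissipation /average (cell_measure hL1) grad_norm_sqr. Qed.

Lemma nrm_le_grad_norm (u : vector_field L1) i j : NN (grad (u i) j) <= grad_norm u.
Proof. exact: nrm_le_grad_nrm L1 (jet_of u) i j. Qed.

Lemma grad_norm_le (u : vector_field L1) (a : R) : 0 <= a ->
  (forall i j, NN (grad (u i) j) <= a) -> grad_norm u <= 2 * a.
Proof.
move=> a0 H; rewrite -(ler_pXn2r (n := 2)) // ?nnegrE ?grad_nrm_ge0 ?mulr_ge0 //.
rewrite /grad_norm grad_nrm_sqr.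
have H2 i j : II (grad (u i) j) (grad (u i) j) <= a ^+ 2.
  by rewrite -(le_nrm_sqr _ _ _ a0).
have -> : (2 * a) ^+ 2 = \sum_(i < 2) \sum_(j < 2) a ^+ 2 by rewrite !sum2; ring.
by apply: ler_sum => i _; apply: ler_sum => j _; exact: H2.
Qed.

Lemma Rintegral_laminar_grad i j :
  \int[leb2 R]_(x in cell L1) laminar_grad i j x =
  if (i == ord0) && (j == ord_max) then L1 else 0.
Proof.
transitivity ((if (i == ord0) && (j == ord_max) then 1 else 0) * fine (leb2 R (cell L1)) : R).
  exact: (Rintegral_cst (leb2 R) mC).
by rewrite (cell_measure hL1); case: ifP => _; rewrite ?mul1r ?mul0r.
Qed.

(** The difference u - x2 e1 is in H^1_0 and so has mean gradient zero. This is how the boundary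
    values enter both lower bounds. *)
Lemma couette_mean_gradient (u : vector_field L1) i j : couette_bc u ->
  \int[leb2 R]_(x in cell L1) grad (u i) j x =
  if (i == ord0) && (j == ord_max) then L1 else 0.
Proof.
move=> /(_ i) cu; rewrite -Rintegral_laminar_grad.
have H : H10 L1 (fun x => u i x - laminar i x) (fun j x => grad (u i) j x - laminar_grad i j x).
  apply/(in_H10P hL1) => //.
    exact: (L2B mC (H1_fun_L2 (u i)) (laminar_L2 hL1 i)).
  by move=> k; exact: (L2B mC (H1_grad_L2 (u i) k) (laminar_grad_L2 hL1 i k)).
have := H10_mean_gradient hL1 j H.
have I1 h : LL h -> II h (fun=> 1) = \int[leb2 R]_(x in cell L1) h x.
  by move=> Lh; rewrite ipE; apply: eq_Rintegral => x _; rewrite mulr1.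
have Lu := H1_grad_L2 (u i) j; have Ll := laminar_grad_L2 hL1 i j.
rewrite -(I1 _ (L2B mC Lu Ll)) (ipBl mC Lu Ll (LL1 hL1)) !I1 // => /eqP.
by rewrite subr_eq0 => /eqP.
Qed.

(* (d1 + d2) O = d1 S turns the integral of O against all the entries of grad u into one of S. *)
Lemma oscillating_flux (u : H1 L1) (O S : R * R -> R) :
  test_function L1 O -> test_function L1 S ->
  (forall x, partial ord0 O x + partial ord_max O x = partial ord0 S x) ->
  \sum_(j < 2) II (grad u j) O = II (grad u ord0) S.
Proof.
move=> tO tS E; rewrite sum2.
have w0 := H1_weak u ord0 tO; have w1 := H1_weak u ord_max tO.
have w2 := H1_weak u ord0 tS.
have Lu := H1_fun_L2 u.
have := ipDr mC (test_partial_L2 hL1 ord0 tO) (test_partial_L2 hL1 ord_max tO) Lu.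
have -> : II u (fun x => partial ord0 O x + partial ord_max O x) = II u (partial ord0 S).
  by apply: eq_ip => // x _; rewrite E.
rewrite w0 w1 w2 -opprD => /eqP; rewrite eqr_opp => /eqP; exact.
Qed.

(** Test the equation with [v] and expand U_j v_i. The constant [kappa] meets the means of the d_j
    u_i, of which only that of d2 u1 survives; the oscillation [O], the same for all i and j, is
    traded for the small [S]; the rest is Cauchy-Schwarz. *)
Lemma passive_lower_bound (nu kappa : R) (U u v : vector_field L1)
    (O S : R * R -> R) (T : 'I_2 -> 'I_2 -> R * R -> R) (M : R) :
  0 <= nu -> 0 <= M -> (forall i x, cell L1 x -> `|U i x| <= M) ->
  passive_field nu U u -> divergence_free v -> no_slip v ->
  test_function L1 O -> test_function L1 S ->
  (forall x, partial ord0 O x + partial ord_max O x = partial ord0 S x) ->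
  (forall i j, LL (T i j)) ->
  (forall i j x, cell L1 x -> U j x * v i x = kappa + O x + T i j x) ->
  kappa * L1 <= grad_norm u * (4 * (nu * grad_norm v) + 2 * NN S +
    \sum_(i < 2) \sum_(j < 2) NN (T i j)).
Proof.
move=> nu0 M0 UM [du cu weak] dv nv tO tS OS LT Uv.
have LO := test_L2 hL1 tO; have LS := test_L2 hL1 tS.
have := weak v dv nv; rewrite (Rintegral_advection UM) Rintegral_grad_dot.
have E i j : II (fun x => U j x * grad (u i) j x) (v i) =
    kappa * (if (i == ord0) && (j == ord_max) then L1 else 0) +
    II (grad (u i) j) O + II (grad (u i) j) (T i j).
  have Lu := H1_grad_L2 (u i) j.
  have Lk : LL (fun=> kappa * 1) by exact: (L2Z mC kappa (LL1 hL1)).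
  rewrite -(couette_mean_gradient i j cu).
  have -> : \int[leb2 R]_(x in cell L1) grad (u i) j x = II (grad (u i) j) (fun=> 1).
    by rewrite ipE; apply: eq_Rintegral => x _; rewrite mulr1.
  rewrite -(ipZr mC kappa (LL1 hL1) Lu) -(ipDr mC Lk LO Lu).
  rewrite -(ipDr mC (L2D mC Lk LO) (LT i j) Lu) !ipE.
  apply: eq_Rintegral => x; rewrite inE => Dx.
  by rewrite mulrAC mulrC Uv // mulr1.
have -> : \sum_(i < 2) \sum_(j < 2) II (fun x => U j x * grad (u i) j x) (v i) =
    kappa * L1 + \sum_(i < 2) II (grad (u i) ord0) S +
    \sum_(i < 2) \sum_(j < 2) II (grad (u i) j) (T i j).
  rewrite -(eq_bigr _ (fun i _ => oscillating_flux (u i) tO tS OS)).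
  by rewrite !sum2 !E /=; ring.
move=> H.
have b1 : `|\sum_(i < 2) \sum_(j < 2) II (grad (u i) j) (grad (v i) j)| <=
    4 * (grad_norm u * grad_norm v).
  apply: sum22_le => i j.
  apply: le_trans (ip_le_nrm mC (H1_grad_L2 (u i) j) (H1_grad_L2 (v i) j)) _.
  by apply: ler_pM; rewrite ?nrm_ge0 // nrm_le_grad_norm.
have b2 i : `|II (grad (u i) ord0) S| <= grad_norm u * NN S.
  apply: le_trans (ip_le_nrm mC (H1_grad_L2 (u i) ord0) LS) _.
  by rewrite ler_wpM2r ?nrm_ge0 // nrm_le_grad_norm.
have b3 : `|\sum_(i < 2) \sum_(j < 2) II (grad (u i) j) (T i j)| <=
    grad_norm u * \sum_(i < 2) \sum_(j < 2) NN (T i j).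
  rewrite mulr_sumr; apply: le_trans (ler_norm_sum _ _ _) _; apply: ler_sum => i _.
  rewrite mulr_sumr; apply: le_trans (ler_norm_sum _ _ _) _; apply: ler_sum => j _.
  apply: le_trans (ip_le_nrm mC (H1_grad_L2 (u i) j) (LT i j)) _.
  by rewrite ler_wpM2r ?nrm_ge0 // nrm_le_grad_norm.
move: H b1 (b2 ord0) (b2 ord_max) b3.
rewrite (sum2 (fun i => II (grad (u i) ord0) S)).
move: (\sum_(i < 2) \sum_(j < 2) II _ _) (II _ S) (II _ S)
  (\sum_(i < 2) \sum_(j < 2) II _ (T _ _)) (\sum_(i < 2) \sum_(j < 2) NN _) (NN S)
  (grad_norm u) (grad_norm v) => p q r s t n gu gv H.
rewrite !ler_norml => /andP[h1 _] /andP[h2 _] /andP[h3 _] /andP[h4 _].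
have := ler_wpM2l nu0 h1; nra.
Qed.

End lower_bound.

(** * Cut-offs and boundary layers *)

Section one_dimensional.
Context (R : realType).
Implicit Types (f g p h : R -> R) (t y : R).

Lemma derive_eq f t (a b : R) : is_derive t 1 f a -> a = b -> is_derive t 1 f b.
Proof. by move=> d <-. Qed.

Lemma derive_id t : is_derive t 1 (fun s : R => s) 1.
Proof. exact: is_derive_id. Qed.

Lemma derive_cst (c t : R) : is_derive t 1 (fun _ : R => c) 0.
Proof. exact: is_derive_cst. Qed.

Lemma derive_add f g t (a b : R) : is_derive t 1 f a -> is_derive t 1 g b ->
  is_derive t 1 (fun s => f s + g s) (a + b).
Proof. by move=> d1 d2; exact: is_deriveD. Qed.

Lemma derive_mul f g t (a b : R) : is_derive t 1 f a -> is_derive t 1 g b ->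
  is_derive t 1 (fun s => f s * g s) (f t * b + g t * a).
Proof. by move=> d1 d2; exact: is_deriveM. Qed.

Lemma derive_scale (c : R) f t (a : R) : is_derive t 1 f a ->
  is_derive t 1 (fun s => c * f s) (c * a).
Proof.
move=> d1; apply: derive_eq (derive_mul (derive_cst c t) d1) _.
by rewrite mulr0 addr0.
Qed.

Lemma derive_comp f g t (a b : R) : is_derive (f t) 1 g b -> is_derive t 1 f a ->
  is_derive t 1 (fun s => g (f s)) (b * a).
Proof. by move=> d1 d2; exact: is_derive1_comp. Qed.

Lemma derive_continuous f f' : (forall t, is_derive t 1 f (f' t)) -> continuous f.
Proof.
by move=> d t; apply: differentiable_continuous; apply/derivable1_diffP; case: (d t).
Qed.

Lemma max0_continuous : continuous (fun t : R => Num.max 0 t).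
Proof.
move=> t; apply: (@continuous_max _ _ (cst 0) id) => //; exact: cvg_cst.
Qed.

(** Only t = 0 needs care: there each difference quotient is either that of [p], which tends to p' 0
    = 0, or 0. *)
Lemma derive_max0 p p' : (forall t, is_derive t 1 p (p' t)) -> p' 0 = 0 ->
  forall t, is_derive t 1 (fun s => p (Num.max 0 s)) (p' (Num.max 0 t)).
Proof.
move=> dp p0 t; have [t0|t0|t0] := ltgtP t 0.
- rewrite p0; apply: near_eq_is_derive (derive_cst (p 0) t).
  near=> s; rewrite max_l //; apply: ltW.
  by near: s; exact: lt_nbhsl.
- apply: near_eq_is_derive (dp t).
  near=> s; rewrite max_r //; apply: ltW.
  by near: s; exact: lt_nbhsr.
rewrite t0 p0.
have [c0 e0] := dp 0; rewrite p0 in e0.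
have L : (fun h : R => h^-1 *: (p (Num.max 0 (h *: (1 : R^o) + 0 : R)) - p (Num.max 0 0))) @ 0^' --> (0 : R).
  have /cvgr0Pnorm_le H : (fun h : R => h^-1 *: (p (h *: (1 : R^o) + 0 : R) - p 0)) @ 0^' --> (0 : R).
    have L : (fun h : R => h^-1 *: (p (h *: (1 : R^o) + 0 : R) - p 0)) @ 0^' -->
      ('D_1 p 0 : R) by exact: c0.
    by rewrite e0 in L.
  apply/cvgr0Pnorm_le => e e_gt0; have := H e e_gt0; apply: filterS => h.
  rewrite maxxx; have [h0|h0] := leP (h *: (1 : R^o) + 0 : R) 0; last by [].
  by rewrite subrr scaler0 normr0 => _; exact: ltW.
by split; [apply/cvg_ex; exists 0|apply: cvg_lim].
Unshelve. all: by end_near. Qed.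

(** Truncation to [0, 1], written with two positive parts so that two uses of [derive_max0]
    differentiate a composite with it. *)
Definition clamp t : R := 1 - Num.max 0 (1 - Num.max 0 t).

Lemma clamp_ge0 t : 0 <= clamp t.
Proof. by rewrite subr_ge0 ge_max ler01 gerBl le_max lexx. Qed.

Lemma clamp_le1 t : clamp t <= 1.
Proof. by rewrite gerBl le_max lexx. Qed.

Lemma clamp_0 t : t <= 0 -> clamp t = 0.
Proof. by move=> t0; rewrite /clamp (max_l t0) subr0 max_r ?ler01 // subrr. Qed.

Lemma clamp_1 t : 1 <= t -> clamp t = 1.
Proof.
move=> t1; have t0 : 0 <= t by exact: le_trans t1.
by rewrite /clamp (max_r t0) max_l ?subr0 // subr_le0.
Qed.

Lemma clamp_continuous : continuous clamp.
Proof.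
have cm : continuous (fun t : R => 1 - Num.max 0 t).
  by move=> t; apply: cvgB; [exact: cvg_cst|exact: max0_continuous].
by move=> t; exact: (@continuous_comp R R R _ _ t (cm t) (cm _)).
Qed.

Lemma derive_clamp p p' : (forall t, is_derive t 1 p (p' t)) ->
  p' 0 = 0 -> p' 1 = 0 ->
  forall t, is_derive t 1 (fun s => p (clamp s)) (p' (clamp t)).
Proof.
move=> dp p0 p1.
have E : (fun s : R => 1 + -1 * s) = (fun s => 1 - s) by apply/funext => s; rewrite mulN1r.
have dr t : is_derive t 1 (fun s : R => 1 - s) (-1).
  rewrite -E; apply: derive_eq (derive_add (derive_cst 1 t) (derive_scale (-1) (derive_id t))) _.
  by rewrite add0r mulr1.
have d1 t : is_derive t 1 (fun s => p (1 - s)) (- p' (1 - t)).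
  by apply: derive_eq (derive_comp (dp _) (dr t)) _; rewrite mulrN1.
have d2 t : is_derive t 1 (fun s => p (1 - Num.max 0 s)) (- p' (1 - Num.max 0 t)).
  by apply: (derive_max0 d1); rewrite subr0 p1 oppr0.
have d3 t : is_derive t 1 (fun s => p (1 - Num.max 0 (1 - s))) (p' (1 - Num.max 0 (1 - t))).
  by apply: derive_eq (derive_comp (d2 _) (dr t)) _; rewrite mulrN1 opprK.
apply: (derive_max0 d3); rewrite subr0 max_r ?ler01 // subrr //.
Qed.

(** The quintic step from 0 to 1 whose first two derivatives vanish at both ends, so that its
    composite with [clamp] is C^2. *)
Definition smoothstep t : R := t * t * t * (10 - 15 * t + 6 * (t * t)).
Definition smoothstep1 t : R := 30 * (t * t) * ((1 - t) * (1 - t)).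
Definition smoothstep2 t : R := 60 * t * (1 - t) * (1 - 2 * t).

Lemma derive_smoothstep t : is_derive t 1 smoothstep (smoothstep1 t).
Proof.
have d1 := derive_id t; have d2 := derive_mul d1 d1; have d3 := derive_mul d2 d1.
have dc := derive_cst 10 t.
have d4 := derive_add (derive_add dc (derive_scale (-15) d1)) (derive_scale 6 d2).
have := derive_mul d3 d4.
rewrite (_ : (fun s => _) = smoothstep).
  by move=> d; apply: derive_eq d _; rewrite /smoothstep1; ring.
by apply/funext => s; rewrite /smoothstep; ring.
Qed.

Lemma derive_smoothstep1 t : is_derive t 1 smoothstep1 (smoothstep2 t).
Proof.
have d1 := derive_id t; have d2 := derive_mul d1 d1.
have d3 := derive_add (derive_cst 1 t) (derive_scale (-1) d1).
have := derive_mul (derive_scale 30 d2) (derive_mul d3 d3).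
rewrite (_ : (fun s => _) = smoothstep1).
  by move=> d; apply: derive_eq d _; rewrite /smoothstep2; ring.
by apply/funext => s; rewrite /smoothstep1; ring.
Qed.

Lemma smoothstep2_continuous : continuous smoothstep2.
Proof.
have d (t : R) : is_derive t 1 smoothstep2 (60 * (1 - 6 * t + 6 * (t * t))).
  have d1 := derive_id t.
  have d3 := derive_add (derive_cst 1 t) (derive_scale (-1) d1).
  have d4 := derive_add (derive_cst 1 t) (derive_scale (-2) d1).
  have := derive_mul (derive_mul (derive_scale 60 d1) d3) d4.
  rewrite (_ : (fun s => _) = smoothstep2).
    by move=> dd; apply: derive_eq dd _; ring.
  by apply/funext => s; rewrite /smoothstep2; ring.
exact: (derive_continuous d).
Qed.

Lemma smoothstep_bounds t : 0 <= t <= 1 ->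
  [/\ 0 <= smoothstep t <= 1, `|smoothstep1 t| <= 30 & `|smoothstep2 t| <= 60].
Proof.
move=> /andP[t0 t1]; have s0 : 0 <= 1 - t by rewrite subr_ge0.
have s1 : 1 - t <= 1 by rewrite gerBl.
have prod01 (a b : R) : 0 <= a -> a <= 1 -> 0 <= b -> b <= 1 -> 0 <= a * b <= 1.
  by move=> *; rewrite mulr_ge0 //= mulr_ile1.
have /andP[tt0 tt1] := prod01 t t t0 t1 t0 t1.
have /andP[ss0 ss1] := prod01 (1 - t) (1 - t) s0 s1 s0 s1.
have /andP[ttt0 ttt1] := prod01 _ t tt0 tt1 t0 t1.
have /andP[sss0 sss1] := prod01 _ (1 - t) ss0 ss1 s0 s1.
have /andP[st0 st1] := prod01 _ (1 - t) t0 t1 s0 s1.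
have /andP[u0 u1] := prod01 _ _ tt0 tt1 ss0 ss1.
split.
- apply/andP; split.
    rewrite /smoothstep mulr_ge0 //.
    have := sqr_ge0 (t - 5 / 4); nra.
  rewrite -subr_ge0.
  have -> : 1 - smoothstep t =
      (1 - t) * (1 - t) * (1 - t) * (1 + 3 * t + 6 * (t * t)).
    by rewrite /smoothstep; ring.
  rewrite mulr_ge0 //; lra.
- rewrite /smoothstep1 -mulrA normrM (ger0_norm u0) ger0_norm //.
  by rewrite -[leRHS]mulr1 ler_wpM2l.
- rewrite /smoothstep2 -!mulrA normrM ger0_norm // -[leRHS]mulr1 ler_wpM2l //.
  rewrite mulrA normrM (ger0_norm st0) mulr_ile1 //.
  by rewrite ler_norml; apply/andP; split; lra.
Qed.

End one_dimensional.

(** * Cut-off profiles near the walls *)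

Section profiles.
Context (R : realType).
Implicit Types (y w : R).

(** Two derivatives, because the divergence corrector of the pump contains the first one and must
    itself be C^1. *)
Record C2_profile (h h1 h2 : R -> R) : Prop := {
  C2_derive1 : forall y, is_derive y 1 h (h1 y) ;
  C2_derive2 : forall y, is_derive y 1 h1 (h2 y) ;
  C2_continuous : continuous h2 }.

Lemma C2_continuous1 h h1 h2 : C2_profile h h1 h2 -> continuous h1.
Proof. by case=> _ d _; exact: derive_continuous d. Qed.

Lemma C2_continuous0 h h1 h2 : C2_profile h h1 h2 -> continuous h.
Proof. by case=> d _ _; exact: derive_continuous d. Qed.

Lemma C2_mul h h1 h2 k k1 k2 : C2_profile h h1 h2 -> C2_profile k k1 k2 ->
  C2_profile (fun y => h y * k y) (fun y => h y * k1 y + k y * h1 y)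
    (fun y => h y * k2 y + k y * h2 y + 2 * (h1 y * k1 y)).
Proof.
move=> H K; have ch := C2_continuous0 H; have ck := C2_continuous0 K.
have ch1 := C2_continuous1 H; have ck1 := C2_continuous1 K.
case: H K => dh dh1 ch2 [dk dk1 ck2]; split.
- by move=> y; exact: derive_mul.
- move=> y; apply: derive_eq (derive_add (derive_mul (dh y) (dk1 y)) (derive_mul (dk y) (dh1 y))) _.
  ring.
- move=> y; apply: cvgD.
    by apply: cvgD; apply: cvgM; [exact: ch|exact: ck2|exact: ck|exact: ch2].
  by apply: cvgM; [exact: cvg_cst|apply: cvgM; [exact: ch1|exact: ck1]].
Qed.

Lemma C2_comp (p p1 p2 : R -> R) h h1 h2 : C2_profile p p1 p2 -> C2_profile h h1 h2 ->
  C2_profile (fun y => p (h y)) (fun y => p1 (h y) * h1 y)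
    (fun y => p2 (h y) * (h1 y * h1 y) + p1 (h y) * h2 y).
Proof.
move=> P H; have ch := C2_continuous0 H; have ch1 := C2_continuous1 H.
have cp1 := C2_continuous1 P.
case: P H => dp dp1 cp2 [dh dh1 ch2]; split.
- by move=> y; exact: derive_comp.
- move=> y; apply: derive_eq (derive_mul (derive_comp (dp1 (h y)) (dh y)) (dh1 y)) _.
  ring.
- move=> y; apply: cvgD; apply: cvgM.
  + by apply: (@continuous_comp R R R h p2); [exact: ch|exact: cp2].
  + by apply: cvgM; exact: ch1.
  + by apply: (@continuous_comp R R R h p1); [exact: ch|exact: cp1].
  + exact: ch2.
Qed.

(* A smooth substitute for the distance to the walls |y| = 1/2. *)
Definition depth y : R := 4^-1 - y * y.
Definition cut_arg w y : R := (depth y - w) / w.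

Lemma C2_cut_arg w : C2_profile (cut_arg w) (fun y => - 2 / w * y) (fun=> - 2 / w).
Proof.
split.
- move=> y; have d1 := derive_id y.
  have := derive_scale w^-1 (derive_add (derive_cst (4^-1 - w) y) (derive_scale (-1) (derive_mul d1 d1))).
  rewrite (_ : (fun s => _) = cut_arg w).
    by move=> d; apply: derive_eq d _; ring.
  by apply/funext => s; rewrite /cut_arg /depth; ring.
- by move=> y; apply: derive_eq (derive_scale _ (derive_id y)) _; rewrite mulr1.
- by move=> y; exact: cvg_cst.
Qed.

Lemma C2_smooth_clamp : C2_profile (fun t : R => smoothstep (clamp t))
  (fun t => smoothstep1 (clamp t)) (fun t => smoothstep2 (clamp t)).
Proof.
split.
- apply: derive_clamp (@derive_smoothstep R) _ _; rewrite /smoothstep1; ring.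
- apply: derive_clamp (@derive_smoothstep1 R) _ _; rewrite /smoothstep2; ring.
- move=> t; apply: (@continuous_comp R R R (@clamp R) (@smoothstep2 R)).
    exact: clamp_continuous.
  exact: smoothstep2_continuous.
Qed.

(** Rises from 0 at depth w to 1 at depth 2 w. *)
Definition cut w y : R := smoothstep (clamp (cut_arg w y)).
Definition cut1 w y : R := smoothstep1 (clamp (cut_arg w y)) * (- 2 / w * y).
Definition cut2 w y : R :=
  smoothstep2 (clamp (cut_arg w y)) * ((- 2 / w * y) * (- 2 / w * y)) +
  smoothstep1 (clamp (cut_arg w y)) * (- 2 / w).

Lemma C2_cut w : C2_profile (cut w) (cut1 w) (cut2 w).
Proof. exact: C2_comp C2_smooth_clamp (C2_cut_arg w). Qed.

(** Indicator of the layer outside which [cut w] is 1; all pointwise bounds below are expressed with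
    it. *)
Definition near_wall w y : R := if depth y <= 2 * w then 1 else 0.

Lemma near_wall_01 w y : 0 <= near_wall w y <= 1.
Proof. by rewrite /near_wall; case: ifP; rewrite ?lexx ?ler01. Qed.

Lemma near_wall_le w w' y : w <= w' -> near_wall w y <= near_wall w' y.
Proof.
move=> ww'; rewrite /near_wall; case: ifPn => [h|_].
  by rewrite (le_trans h) // ler_pM2l.
by case: ifP.
Qed.

Lemma cut_bounds w y : 0 <= cut w y <= 1.
Proof.
by case: (@smoothstep_bounds _ (clamp (cut_arg w y)));
  rewrite ?clamp_ge0 ?clamp_le1.
Qed.

Lemma cut_arg_le0 w y : 0 < w -> depth y <= w -> cut_arg w y <= 0.
Proof. by move=> w0 h; rewrite /cut_arg pmulr_lle0 ?invr_gt0 // subr_le0. Qed.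

Lemma cut_arg_ge1 w y : 0 < w -> 2 * w <= depth y -> 1 <= cut_arg w y.
Proof. by move=> w0 h; rewrite /cut_arg ler_pdivlMr // mul1r; lra. Qed.

Lemma cut_wall w y : 0 < w -> depth y <= w ->
  [/\ cut w y = 0, cut1 w y = 0 & cut2 w y = 0].
Proof.
move=> w0 h; rewrite /cut /cut1 /cut2 clamp_0 ?cut_arg_le0 //.
by rewrite /smoothstep /smoothstep1 /smoothstep2; split; ring.
Qed.

Lemma cut_bulk w y : 0 < w -> 2 * w <= depth y ->
  [/\ cut w y = 1, cut1 w y = 0 & cut2 w y = 0].
Proof.
move=> w0 h; rewrite /cut /cut1 /cut2 clamp_1 ?cut_arg_ge1 //.
by rewrite /smoothstep /smoothstep1 /smoothstep2; split; ring.
Qed.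

Lemma cut_le_near_wall w y : 0 < w -> 1 - cut w y <= near_wall w y.
Proof.
move=> w0; rewrite /near_wall; case: ifPn => [_|].
  by rewrite gerBl; case/andP: (cut_bounds w y).
by rewrite -ltNge => /ltW/(cut_bulk w0)[-> _ _]; rewrite subrr.
Qed.

Lemma cut1_le w y : 0 < w -> `|y| <= 2^-1 -> `|cut1 w y| <= 30 / w * near_wall w y.
Proof.
move=> w0 hy; rewrite /near_wall; case: ifPn => [_|].
  rewrite mulr1 /cut1 normrM; apply: ler_pM => //.
    by case: (@smoothstep_bounds _ (clamp (cut_arg w y))); rewrite ?clamp_ge0 ?clamp_le1.
  rewrite mulNr mulNr normrN mulrAC normrM (gtr0_norm (_ : 0 < w^-1)) ?invr_gt0 //.
  by rewrite -[leRHS]mul1r ler_wpM2r ?invr_ge0 ?(ltW w0) // normrM ger0_norm //; lra.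
by rewrite -ltNge => /ltW/(cut_bulk w0)[_ -> _]; rewrite normr0 mulr0.
Qed.

Lemma cut2_le w y : 0 < w <= 1 -> `|y| <= 2^-1 ->
  `|cut2 w y| <= 120 / (w * w) * near_wall w y.
Proof.
move=> /andP[w0 w1] hy; rewrite /near_wall; case: ifPn => [_|].
  have [_ s1 s2] : [/\ 0 <= smoothstep (clamp (cut_arg w y)) <= 1,
     `|smoothstep1 (clamp (cut_arg w y))| <= 30 & `|smoothstep2 (clamp (cut_arg w y))| <= 60].
    by apply: smoothstep_bounds; rewrite clamp_ge0 clamp_le1.
  have W1 : 1 <= w^-1 by rewrite invf_ge1.
  have W0 : 0 <= w^-1 by rewrite invr_ge0 ltW.
  have e1 : `|- 2 / w * y| <= w^-1.
    rewrite mulNr mulNr normrN mulrAC normrM (ger0_norm W0).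
    by rewrite -[leRHS]mul1r ler_wpM2r // normrM ger0_norm //; lra.
  rewrite mulr1 invfM; apply: le_trans (ler_normD _ _) _.
  have -> : 120 * (w^-1 * w^-1) = 60 * (w^-1 * w^-1) + 30 * (2 * (w^-1 * w^-1)) :> R by ring.
  apply: lerD; rewrite normrM; apply: ler_pM => //.
    by rewrite normrM; apply: ler_pM.
  rewrite mulNr normrN ger0_norm ?mulr_ge0 // ler_pM2l // -[leLHS]mulr1.
  by rewrite ler_wpM2l.
by rewrite -ltNge => /ltW/(cut_bulk w0)[_ _ ->]; rewrite normr0 mulr0.
Qed.

Lemma C2_sin_pihalf : C2_profile (fun t => sin (pi / 2 * t))
  (fun t => pi / 2 * cos (pi / 2 * t)) (fun t => - (pi / 2 * (pi / 2)) * sin (pi / 2 * t)) .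
Proof.
have dl (t : R) : is_derive t 1 (fun s => pi / 2 * s) (pi / 2).
  by apply: derive_eq (derive_scale _ (derive_id t)) _; rewrite mulr1.
have d1 (t : R) : is_derive t 1 (fun t => sin (pi / 2 * t)) (pi / 2 * cos (pi / 2 * t)).
  by apply: derive_eq (derive_comp (is_derive_sin _) (dl t)) _; rewrite mulrC.
have d2 (t : R) : is_derive t 1 (fun t => pi / 2 * cos (pi / 2 * t))
    (- (pi / 2 * (pi / 2)) * sin (pi / 2 * t)).
  apply: derive_eq (derive_scale _ (derive_comp (is_derive_cos _) (dl t))) _; ring.
split=> // t; apply: cvgM; first exact: cvg_cst.
exact: (derive_continuous d1).
Qed.

Lemma C2_cos_pihalf : C2_profile (fun t => cos (pi / 2 * t))
  (fun t => - (pi / 2) * sin (pi / 2 * t)) (fun t => - (pi / 2 * (pi / 2)) * cos (pi / 2 * t)) .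
Proof.
have dl (t : R) : is_derive t 1 (fun s => pi / 2 * s) (pi / 2).
  by apply: derive_eq (derive_scale _ (derive_id t)) _; rewrite mulr1.
have d1 (t : R) : is_derive t 1 (fun t => cos (pi / 2 * t)) (- (pi / 2) * sin (pi / 2 * t)).
  apply: derive_eq (derive_comp (is_derive_cos _) (dl t)) _; ring.
have d2 (t : R) : is_derive t 1 (fun t => - (pi / 2) * sin (pi / 2 * t))
    (- (pi / 2 * (pi / 2)) * cos (pi / 2 * t)).
  apply: derive_eq (derive_scale _ (derive_comp (is_derive_sin _) (dl t))) _; ring.
split=> // t; apply: cvgM; first exact: cvg_cst.
exact: (derive_continuous d1).
Qed.

Lemma pihalf_bounds : 0 <= (pi : R) / 2 <= 2.
Proof. by case: (@pihalf_02_cos_pihalf R). Qed.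

Lemma normM_le (a b A B : R) : `|a| <= A -> `|b| <= B -> `|a * b| <= A * B.
Proof. by move=> *; rewrite normrM; apply: ler_pM. Qed.

Lemma normD_le (a b A B : R) : `|a| <= A -> `|b| <= B -> `|a + b| <= A + B.
Proof. by move=> *; apply: le_trans (ler_normD _ _) _; apply: lerD. Qed.

Lemma norm_sin_le1 (t : R) : `|sin t| <= 1.
Proof. by rewrite ler_norml sin_geN1 sin_le1. Qed.

Lemma norm_cos_le1 (t : R) : `|cos t| <= 1.
Proof. by rewrite ler_norml cos_geN1 cos_le1. Qed.

(* p1 and p2 are the first two derivatives of the outer function of a composite p o cut. *)
Lemma C2_comp_cut_le (p1 p2 : R -> R) w y : (forall t, `|p1 t| <= 4) ->
  (forall t, `|p2 t| <= 4) -> 0 < w <= 1 -> `|y| <= 2^-1 ->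
  `|p1 (cut w y) * cut1 w y| <= 64 * 64 / w * near_wall w y /\
  `|p2 (cut w y) * (cut1 w y * cut1 w y) + p1 (cut w y) * cut2 w y| <=
     64 * 64 / (w * w) * near_wall w y.
Proof.
move=> b1 b2 hw hy; have /andP[w0 w1] := hw.
have c1 := cut1_le w0 hy; have c2 := cut2_le hw hy.
have n01 := near_wall_01 w y; move: c1 c2 n01; set n := near_wall w y.
move=> c1 c2 /andP[n0 n1]; have W0 : 0 <= w^-1 by rewrite invr_ge0 ltW.
have nW : 0 <= w^-1 * n by rewrite mulr_ge0.
have nWW : 0 <= w^-1 * w^-1 * n by rewrite !mulr_ge0.
have nn : w^-1 * w^-1 * n * n <= w^-1 * w^-1 * n by rewrite -[leRHS]mulr1 ler_wpM2l.
rewrite (invfM w w) in c2 *; move: (w^-1) W0 nW nWW nn c1 c2 => W W0 nW nWW nn c1 c2.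
split.
  apply: le_trans (normM_le (b1 _) c1) _.
  by move: nW; rewrite -(mulrA (64 * 64)) -(mulrA 30); move: (W * n) => N; lra.
apply: le_trans (normD_le (normM_le (b2 _) (normM_le c1 c1)) (normM_le (b1 _) c2)) _.
have -> : 4 * (30 * W * n * (30 * W * n)) + 4 * (120 * (W * W) * n) =
  4 * (30 * 30) * (W * W * n * n) + 4 * 120 * (W * W * n) by ring.
rewrite -(mulrA (64 * 64)).
by move: (W * W * n * n) (W * W * n) nWW nn => N' N; lra.
Qed.

End profiles.

(** * Waves in boundary layers *)

Section boundary_layer.
Context (R : realType) (L1 : R).
Hypothesis hL1 : 0 < L1.

Notation LL := (L2 (leb2 R) (cell L1)).
Notation NN := (nrm (leb2 R) (cell L1)).
Let mC := @measurable_cell R L1.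

Definition layer (w : R) (x : R * R) : R := near_wall w x.2.

Definition layer_set (w : R) : set (measurableTypeR R * measurableTypeR R) :=
  [set x | depth x.2 <= 2 * w].

Lemma layer_indic w : layer w = \1_(layer_set w).
Proof.
apply/funext => x; rewrite /layer /near_wall indicE.
by case: ifP => h; [rewrite mem_set|rewrite memNset // /layer_set /= h].
Qed.

Lemma measurable_layer_set w : measurable (layer_set w).
Proof.
have C : continuous (fun x : R * R => depth x.2).
  have [_ C2] : continuous (fun x : R * R => x.2) /\ continuous (fun x : R * R => x.2).
    by split; exact: C1_continuous (C1_snd R).
  by move=> x; apply: cvgB; [exact: cvg_cst|apply: cvgM; exact: C2].
have := @continuous_measurable_prod R setT _ C.
move=> /(_ measurableT _ (measurable_itv `]-oo, 2 * w])); rewrite setTI.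
by congr measurable; apply/seteqP; split => x /=; rewrite in_itv.
Qed.

Lemma measurable_layer w : measurable_fun (cell L1) (layer w).
Proof. by rewrite layer_indic; apply: measurable_indic; exact: measurable_layer_set. Qed.

Lemma layer_01 w x : 0 <= layer w x <= 1.
Proof. exact: near_wall_01. Qed.

Lemma layer_L2 w : LL (layer w).
Proof.
apply: (@L2_bounded _ _ R (leb2 R) _ mC _ 1 (cell_finite hL1) (measurable_layer w)) => x _.
by have /andP[h0 h1] := layer_01 w x; rewrite ger0_norm.
Qed.

(** The depth (1/2 - |y|) (1/2 + |y|) is at least half the distance 1/2 - |y| to the nearer wall. *)
Lemma depth_le_strips (w y : R) : 0 <= w -> `|y| <= 2^-1 -> depth y <= 2 * w ->
  2^-1 - 4 * w <= y \/ y <= - 2^-1 + 4 * w.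
Proof.
rewrite /depth ler_norml => w0 /andP[y1 y2] h.
have [y0|y0] := leP 0 y; [left|right]; nra.
Qed.

Lemma layer_nrm_sqr w : 0 <= w -> NN (layer w) ^+ 2 <= 8 * w * L1.
Proof.
move=> w0; rewrite nrm_sqr ipE.
have -> : \int[leb2 R]_(x in cell L1) (layer w x * layer w x) =
    \int[leb2 R]_(x in cell L1) \1_(layer_set w) x.
  apply: eq_Rintegral => x _; rewrite -layer_indic /layer /near_wall.
  by case: ifP => _; rewrite ?mulr1 ?mulr0.
rewrite /Rintegral (integral_indic (leb2 R) mC (measurable_layer_set w)).
pose A : set (measurableTypeR R * measurableTypeR R) :=
  `[0, L1]%classic `*` `[2^-1 - 4 * w, 2^-1]%classic.
pose B : set (measurableTypeR R * measurableTypeR R) :=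
  `[0, L1]%classic `*` `[- 2^-1, - 2^-1 + 4 * w]%classic.
have mA : measurable A by apply: measurableX; exact: measurable_itv.
have mB : measurable B by apply: measurableX; exact: measurable_itv.
have w40 : 0 <= 4 * w by rewrite mulr_ge0.
have mS : measurable (layer_set w `&` cell L1).
  exact: measurableI (measurable_layer_set w) mC.
have le : (leb2 R (layer_set w `&` cell L1) <= (8 * w * L1)%:E)%E.
  apply: (@le_trans _ _ (leb2 R (A `|` B))).
    apply: le_measure; rewrite ?inE //; first exact: measurableU.
    move=> x [/= hx [/= x1 x2]]; move: x2; rewrite in_itv /= => x2.
    have hy : `|x.2| <= 2^-1 by rewrite ler_norml.
    have [h|h] := depth_le_strips w0 hy hx.
      by left; split => //=; rewrite in_itv /= h; case/andP: x2.
    by right; split => //=; rewrite in_itv /= h andbT; case/andP: x2.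
  apply: le_trans (measureU2 _ mA mB) _.
  have LA : leb2 R A = (L1 * (4 * w))%:E.
    rewrite leb2_rectangle ?(ltW hL1) ?gerBl //; congr _%:E; ring.
  have LB : leb2 R B = (L1 * (4 * w))%:E.
    rewrite leb2_rectangle ?(ltW hL1) ?lerDl //; congr _%:E; ring.
  rewrite [X in (X + _)%E]LA [X in (_ + X)%E]LB -EFinD lee_fin.
  by rewrite le_eqVlt; apply/orP; left; apply/eqP; ring.
rewrite -lee_fin fineK //; rewrite ge0_fin_numE //.
exact: le_lt_trans le (ltry _).
Qed.

Definition layer_const : R := Num.sqrt (8 * L1).

Lemma layer_const_gt0 : 0 < layer_const.
Proof. by rewrite sqrtr_gt0 mulr_gt0. Qed.

(** A layer of width w has area of order w and L^2 norm of order sqrt w; widths are written as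
    squares to avoid roots. *)
Lemma layer_nrm m : 0 <= m -> NN (layer (m ^+ 2)) <= layer_const * m.
Proof.
move=> m0; rewrite le_nrm_sqr ?mulr_ge0 ?(ltW layer_const_gt0) //.
rewrite -nrm_sqr exprMn sqr_sqrtr ?mulr_ge0 ?(ltW hL1) //.
by rewrite mulrAC; apply: layer_nrm_sqr; exact: sqr_ge0.
Qed.

Lemma nrm_le_layer (f : R * R -> R) (K K' m : R) : 0 <= m -> 0 <= K -> 0 <= K' ->
  LL f -> (forall x, cell L1 x ->
    `|f x| <= K * layer (m ^+ 2) x + K' * layer ((m ^+ 2) ^+ 2) x) ->
  NN f <= layer_const * (K * m + K' * m ^+ 2).
Proof.
move=> m0 K0 K'0 Lf H.
have Lz := layer_L2 (m ^+ 2); have Ld := layer_L2 ((m ^+ 2) ^+ 2).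
have Ls := L2D mC (L2Z mC K Lz) (L2Z mC K' Ld).
apply: (@le_trans _ _ (NN (fun x => K * layer (m ^+ 2) x + K' * layer ((m ^+ 2) ^+ 2) x))).
  rewrite le_nrm_sqr ?nrm_ge0 // nrm_sqr; apply: (le_ip mC) => // x Dx.
  by apply: le_trans (H x Dx) (ler_norm _).
apply: le_trans (nrmD mC (L2Z mC K Lz) (L2Z mC K' Ld)) _.
rewrite !(nrmZ mC) // !ger0_norm // mulrDr; apply: lerD; rewrite mulrCA ler_wpM2l //.
  exact: layer_nrm.
by apply: layer_nrm; exact: sqr_ge0.
Qed.

Lemma nrm_const (c : R) : 0 <= c -> NN (fun=> c) = c * Num.sqrt L1.
Proof.
move=> c0; rewrite nrmE ipE (_ : \int[leb2 R]_(x in cell L1) (c * c) = c ^+ 2 * L1).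
  by rewrite sqrtrM ?sqr_ge0 // sqrtr_sqr ger0_norm.
transitivity (c * c * fine (leb2 R (cell L1))); first exact: (Rintegral_cst (leb2 R) mC).
by rewrite (cell_measure hL1) expr2.
Qed.

End boundary_layer.

(** * Oscillations with wave vectors along (1, -1) *)

Section waves.
Context (R : realType) (L1 : R).
Implicit Types (h : R -> R) (k : R).

(** The phase depends on x1 - x2 only, so d1 + d2 ignores it and differentiates just the profile
    [h]. *)
Definition wave_cos h k (x : R * R) : R := h x.2 * cos (k * (x.1 - x.2)).
Definition wave_sin h k (x : R * R) : R := h x.2 * sin (k * (x.1 - x.2)).

Lemma C1_profile h h1 : (forall y : R, is_derive y 1 h (h1 y)) -> continuous h1 ->
  C1_gradient (fun x : R * R => h x.2) (fun j x => if j == ord0 then 0 else h1 x.2).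
Proof.
move=> dh ch1; apply: eq_C1 (C1_comp dh ch1 (C1_snd R)) => // j x.
by case: (ord2P j) => -> /=; rewrite ?mulr0 ?mulr1.
Qed.

Lemma C1_phase k : C1_gradient (fun x : R * R => k * (x.1 - x.2))
  (fun j x => if j == ord0 then k else - k).
Proof.
apply: eq_C1 (C1Z k (C1B (C1_fst R) (C1_snd R))) => // j x.
by case: (ord2P j) => -> /=; rewrite ?subr0 ?mulr1 // sub0r mulrN1.
Qed.

Lemma C1_wave_cos h h1 k : (forall y : R, is_derive y 1 h (h1 y)) -> continuous h1 ->
  C1_gradient (wave_cos h k) (fun j x => if j == ord0 then - k * wave_sin h k x
    else wave_cos h1 k x + k * wave_sin h k x).
Proof.
move=> dh ch1; have cns : continuous (fun t : R => - sin t).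
  by move=> t; apply: cvgN; exact: continuous_sin.
have := C1M (C1_profile dh ch1) (C1_comp (@is_derive_cos R) cns (C1_phase k)).
apply: eq_C1 => // j x; rewrite /wave_cos /wave_sin.
by case: (ord2P j) => -> /=; ring.
Qed.

Lemma C1_wave_sin h h1 k : (forall y : R, is_derive y 1 h (h1 y)) -> continuous h1 ->
  C1_gradient (wave_sin h k) (fun j x => if j == ord0 then k * wave_cos h k x
    else wave_sin h1 k x - k * wave_cos h k x).
Proof.
move=> dh ch1; have cc : continuous (fun t : R => cos t) by exact: continuous_cos.
have := C1M (C1_profile dh ch1) (C1_comp (@is_derive_sin R) cc (C1_phase k)).
apply: eq_C1 => // j x; rewrite /wave_cos /wave_sin.
by case: (ord2P j) => -> /=; ring.
Qed.

Definition wave_number k := exists n : nat, k * L1 = (pi *+ 2) *+ n.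

Lemma wave_number_natmul k n : wave_number k -> wave_number (n%:R * k).
Proof. by move=> [p E]; exists (n * p)%N; rewrite -mulrA E mulr_natl mulnC mulrnA. Qed.

Lemma wave_numberD k k' : wave_number k -> wave_number k' -> wave_number (k + k').
Proof. by move=> [p E] [p' E']; exists (p + p')%N; rewrite mulrDl E E' mulrnDr. Qed.

Lemma wave_cos_periodic h k x1 x2 : wave_number k ->
  wave_cos h k (x1 + L1, x2) = wave_cos h k (x1, x2).
Proof.
move=> [n E]; rewrite /wave_cos /=; congr (_ * _).
rewrite (_ : k * (x1 + L1 - x2) = k * (x1 - x2) + (pi *+ 2) *+ n).
  by rewrite (periodicn (@cosD2pi R)).
by rewrite -E; ring.
Qed.

Lemma wave_sin_periodic h k x1 x2 : wave_number k ->
  wave_sin h k (x1 + L1, x2) = wave_sin h k (x1, x2).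
Proof.
move=> [n E]; rewrite /wave_sin /=; congr (_ * _).
rewrite (_ : k * (x1 + L1 - x2) = k * (x1 - x2) + (pi *+ 2) *+ n).
  by rewrite (periodicn (@sinD2pi R)).
by rewrite -E; ring.
Qed.

Lemma wave_cos_le h k x : `|wave_cos h k x| <= `|h x.2|.
Proof. by rewrite normrM -[leRHS]mulr1 ler_wpM2l // norm_cos_le1. Qed.

Lemma wave_sin_le h k x : `|wave_sin h k x| <= `|h x.2|.
Proof. by rewrite normrM -[leRHS]mulr1 ler_wpM2l // norm_sin_le1. Qed.

End waves.

(** * The pump *)

Section pump.
Context (R : realType).
Variables (m Q : R).
Hypotheses (m0 : 0 < m) (m1 : m <= 2^-1) (Q0 : 0 < Q).

Let mn0 : m != 0. Proof. by rewrite gt_eqF. Qed.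
Let Qn0 : Q != 0. Proof. by rewrite gt_eqF. Qed.

(** With amplitude m, the slow wave has gradient m k0 ~ m^-2 in the bulk; the fast one has gradient
    m k1 ~ m^-3 on the outer layer, of L^2 norm m; the shear has gradient m^-4 on the inner layer,
    of L^2 norm m^2. Each contributes m^-2. *)
Definition outer_width : R := m ^+ 2.
Definition inner_width : R := (m ^+ 2) ^+ 2.
Definition outer_k : R := Q / m ^+ 3.
Definition inner_k : R := Q / m ^+ 4.

Notation z := outer_width.
Notation dl := inner_width.
Notation k0 := outer_k.
Notation k1 := inner_k.

Lemma outer_width_bounds : 0 < z <= 1.
Proof.
by rewrite /outer_width exprn_gt0 //= expr_le1 ?(ltW m0) // (le_trans m1) //; lra.
Qed.

Lemma inner_width_bounds : 0 < dl <= 1.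
Proof.
have /andP[z0 z1] := outer_width_bounds.
by rewrite /inner_width exprn_gt0 //= expr_le1 // ltW.
Qed.

Lemma inner_le_outer : dl <= z.
Proof.
have /andP[z0 z1] := outer_width_bounds.
by rewrite /inner_width expr2 -[leRHS]mulr1 ler_wpM2l // ltW.
Qed.

(** A sine here and a cosine in [pc] make pa^2 + pc^2 = 1 across the outer transition while both
    stay smooth; [pb] is [pc] cut off at the inner width. *)
Definition pa (y : R) : R := sin (pi / 2 * cut z y).
Definition pa1 (y : R) : R := pi / 2 * cos (pi / 2 * cut z y) * cut1 z y.
Definition pa2 (y : R) : R :=
  - (pi / 2 * (pi / 2)) * sin (pi / 2 * cut z y) * (cut1 z y * cut1 z y) +
  pi / 2 * cos (pi / 2 * cut z y) * cut2 z y.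

Lemma C2_pa : C2_profile pa pa1 pa2.
Proof. exact: C2_comp (@C2_sin_pihalf R) (C2_cut z). Qed.

Definition pc (y : R) : R := cos (pi / 2 * cut z y).
Definition pc1 (y : R) : R := - (pi / 2) * sin (pi / 2 * cut z y) * cut1 z y.
Definition pc2 (y : R) : R :=
  - (pi / 2 * (pi / 2)) * cos (pi / 2 * cut z y) * (cut1 z y * cut1 z y) +
  - (pi / 2) * sin (pi / 2 * cut z y) * cut2 z y.

Lemma C2_pc : C2_profile pc pc1 pc2.
Proof. exact: C2_comp (@C2_cos_pihalf R) (C2_cut z). Qed.

Definition pb (y : R) : R := cut dl y * pc y.
Definition pb1 (y : R) : R := cut dl y * pc1 y + pc y * cut1 dl y.
Definition pb2 (y : R) : R :=
  cut dl y * pc2 y + pc y * cut2 dl y + 2 * (cut1 dl y * pc1 y).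

Lemma C2_pb : C2_profile pb pb1 pb2.
Proof. exact: C2_mul (C2_cut dl) C2_pc. Qed.

Definition profile_bound : R := 64 * 64.
Notation K := profile_bound.

Lemma profile_bound_ge : 120 <= K.
Proof. by rewrite /profile_bound; lra. Qed.

Lemma profile_bound_gt0 : 0 < K.
Proof. by have := profile_bound_ge; lra. Qed.

Notation nz := (near_wall z).
Notation nd := (near_wall dl).

Let pih (t : R) : `|t| <= 1 -> `|pi / 2 * t| <= 4.
Proof.
move=> ht; have /andP[p0 p2] := @pihalf_bounds R.
rewrite normrM (ger0_norm p0); apply: (@le_trans _ _ (2 * 1)); last by lra.
exact: ler_pM.
Qed.

Let pih2 (t : R) : `|t| <= 1 -> `|- (pi / 2 * (pi / 2)) * t| <= 4.
Proof.
move=> ht; have /andP[p0 p2] := @pihalf_bounds R.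
rewrite normrM normrN (ger0_norm (mulr_ge0 p0 p0)); apply: (@le_trans _ _ (2 * 2 * 1)); last by lra.
by apply: ler_pM => //; [exact: mulr_ge0|exact: ler_pM].
Qed.

Let pih' (t : R) : `|t| <= 1 -> `|- (pi / 2) * t| <= 4.
Proof. by move=> /pih; rewrite mulNr normrN. Qed.

Lemma pa_le y : `|pa y| <= 1. Proof. exact: norm_sin_le1. Qed.

Lemma pc_le y : `|pc y| <= nz y.
Proof.
have /andP[z0 _] := outer_width_bounds.
rewrite /near_wall; case: ifPn => [_|]; first exact: norm_cos_le1.
by rewrite -ltNge => /ltW/(cut_bulk z0)[h _ _]; rewrite /pc h mulr1 cos_pihalf normr0.
Qed.

Section cell_bounds.
Variable y : R.
Hypothesis hy : `|y| <= 2^-1.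

Lemma pa12_le : `|pa1 y| <= K / z * nz y /\ `|pa2 y| <= K / (z * z) * nz y.
Proof.
by apply: (@C2_comp_cut_le R (fun t => pi / 2 * cos (pi / 2 * t))
    (fun t => - (pi / 2 * (pi / 2)) * sin (pi / 2 * t)) z y _ _ outer_width_bounds hy) => t;
  [apply: pih; exact: norm_cos_le1|apply: pih2; exact: norm_sin_le1].
Qed.

Lemma pc12_le : `|pc1 y| <= K / z * nz y /\ `|pc2 y| <= K / (z * z) * nz y.
Proof.
by apply: (@C2_comp_cut_le R (fun t => - (pi / 2) * sin (pi / 2 * t))
    (fun t => - (pi / 2 * (pi / 2)) * cos (pi / 2 * t)) z y _ _ outer_width_bounds hy) => t;
  [apply: pih'; exact: norm_sin_le1|apply: pih2; exact: norm_cos_le1].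
Qed.

Lemma cut_norm_le w : `|cut w y| <= 1.
Proof. by have /andP[h0 h1] := cut_bounds w y; rewrite ger0_norm. Qed.

Lemma pb_le : `|pb y| <= nz y.
Proof. by rewrite -[leRHS]mul1r; apply: normM_le; [exact: cut_norm_le|exact: pc_le]. Qed.

Lemma pc_le1 : `|pc y| <= 1. Proof. exact: norm_cos_le1. Qed.

Lemma pb1_le : `|pb1 y| <= K / z * nz y + K / dl * nd y.
Proof.
have [c1 _] := pc12_le; have /andP[d0 _] := inner_width_bounds.
apply: normD_le.
  by rewrite -[leRHS]mul1r; apply: normM_le; first exact: cut_norm_le.
apply: le_trans (normM_le pc_le1 (cut1_le d0 hy)) _; rewrite mul1r.
have /andP[n0 _] := near_wall_01 dl y; apply: ler_wpM2r => //.
by rewrite ler_wpM2r ?invr_ge0 ?(ltW d0) //; have := profile_bound_ge; lra.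
Qed.

Lemma pb2_le : `|pb2 y| <= K / (z * z) * nz y + 61 * K / (dl * dl) * nd y.
Proof.
have [c1 c2] := pc12_le; have hd := inner_width_bounds; have /andP[d0 d1] := hd.
have /andP[z0 z1] := outer_width_bounds.
have /andP[n0 n1] := near_wall_01 dl y; have /andP[nz0 nz1] := near_wall_01 z y.
have K120 := profile_bound_ge; have K0 := profile_bound_gt0.
have t1 : `|cut dl y * pc2 y| <= K / (z * z) * nz y.
  by rewrite -[leRHS]mul1r; apply: normM_le; first exact: cut_norm_le.
have t2 : `|pc y * cut2 dl y| <= K / (dl * dl) * nd y.
  apply: le_trans (normM_le pc_le1 (cut2_le hd hy)) _; rewrite mul1r.
  by apply: ler_wpM2r => //; rewrite ler_wpM2r // invr_ge0 mulr_ge0 // ltW.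
have t3 : `|2 * (cut1 dl y * pc1 y)| <= 60 * K / (dl * dl) * nd y.
  apply: le_trans (normM_le (lexx _) (normM_le (cut1_le d0 hy) c1)) _.
  rewrite ger0_norm //.
  have -> : 2 * (30 / dl * nd y * (K / z * nz y)) = 60 * K * (dl^-1 * z^-1) * nd y * nz y by ring.
  have p0 : 0 <= 60 * K * (dl^-1 * z^-1) * nd y.
    by rewrite !mulr_ge0 ?invr_ge0 // ltW.
  apply: (@le_trans _ _ (60 * K * (dl^-1 * z^-1) * nd y)).
    by rewrite -[leRHS]mulr1 ler_wpM2l.
  apply: ler_wpM2r => //; rewrite (invfM dl dl); apply: ler_wpM2l.
    by rewrite mulr_ge0 // ltW.
  apply: ler_wpM2l; first by rewrite invr_ge0 ltW.
  by rewrite lef_pV2 ?posrE //; exact: inner_le_outer.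
apply: le_trans (normD_le (normD_le t1 t2) t3) _.
by rewrite le_eqVlt; apply/orP; left; apply/eqP; ring.
Qed.

(** The defect equals pc^2 (1 - cut^2) for the inner cut-off, so it lives in the thin layer only.
    This is the gain from the second wave. *)
Lemma flux_defect_le : `|1 - (pa y * pa y + pb y * pb y)| <= 2 * nd y.
Proof.
have /andP[d0 d1] := inner_width_bounds.
have /andP[c0 c1] := cut_bounds dl y; have cw := cut_le_near_wall y d0.
have -> : 1 - (pa y * pa y + pb y * pb y) =
    pc y * pc y * ((1 - cut dl y) * (1 + cut dl y)).
  have := cos2Dsin2 (pi / 2 * cut z y); rewrite -/(pa y) -/(pc y) !expr2 => E.
  by rewrite /pb -[X in X - _]E; ring.
have s0 : 0 <= 1 - cut dl y by rewrite subr_ge0.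
rewrite -[leRHS]mul1r; apply: normM_le; first by rewrite -[leRHS]mulr1; exact: normM_le pc_le1 pc_le1.
rewrite mulrC; apply: normM_le; rewrite ger0_norm //; lra.
Qed.

End cell_bounds.

Lemma profiles_wall y : depth y <= dl ->
  [/\ pa y = 0, pa1 y = 0, pb y = 0 & pb1 y = 0].
Proof.
move=> h; have /andP[d0 _] := inner_width_bounds; have /andP[z0 _] := outer_width_bounds.
have [a1 a2 _] := cut_wall d0 h; have [b1 b2 _] := cut_wall z0 (le_trans h inner_le_outer).
by rewrite /pa /pa1 /pb /pb1 a1 a2 b1 b2 !(mulr0, mul0r, sin0, addr0).
Qed.

Definition pump2 (x : R * R) : R := m * (wave_sin pa k0 x + wave_sin pb k1 x).
(** The corrector added to the first component: its x1-derivative cancels (d1 + d2) [pump2], where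
    only the derivatives of the profiles remain. *)
Definition pump_err (x : R * R) : R :=
  m / k0 * wave_cos pa1 k0 x + m / k1 * wave_cos pb1 k1 x.
Definition pump1 (x : R * R) : R := pump2 x + pump_err x.

Definition dpump2 (j : 'I_2) (x : R * R) : R :=
  if j == ord0 then m * (k0 * wave_cos pa k0 x + k1 * wave_cos pb k1 x)
  else m * ((wave_sin pa1 k0 x - k0 * wave_cos pa k0 x) +
            (wave_sin pb1 k1 x - k1 * wave_cos pb k1 x)).

Definition dpump1 (j : 'I_2) (x : R * R) : R :=
  dpump2 j x + (if j == ord0 then
    m / k0 * (- k0 * wave_sin pa1 k0 x) + m / k1 * (- k1 * wave_sin pb1 k1 x)
  else m / k0 * (wave_cos pa2 k0 x + k0 * wave_sin pa1 k0 x) +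
       m / k1 * (wave_cos pb2 k1 x + k1 * wave_sin pb1 k1 x)).

Lemma C1_pump2 : C1_gradient pump2 dpump2.
Proof.
have [da _ _] := C2_pa; have [db _ _] := C2_pb.
apply: eq_C1 (C1Z m (C1D (C1_wave_sin k0 da (C2_continuous1 C2_pa))
   (C1_wave_sin k1 db (C2_continuous1 C2_pb)))) => // j x.
by rewrite /dpump2; case: ifP.
Qed.

Lemma C1_pump1 : C1_gradient pump1 dpump1.
Proof.
have [_ da ca] := C2_pa; have [_ db cb] := C2_pb.
apply: eq_C1 (C1D C1_pump2 (C1D (C1Z (m / k0) (C1_wave_cos k0 da ca))
   (C1Z (m / k1) (C1_wave_cos k1 db cb)))) => // j x.
by rewrite /dpump1; case: ifP.
Qed.

Lemma pump_div x : dpump1 ord0 x + dpump2 ord_max x = 0.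
Proof.
rewrite /dpump1 /dpump2 /= /outer_k /inner_k; field.
by rewrite Qn0 mn0.
Qed.

Lemma pump_wall x : depth x.2 <= dl -> pump1 x = 0 /\ pump2 x = 0.
Proof.
move=> /profiles_wall[a a1 b b1].
by rewrite /pump1 /pump_err /pump2 /wave_sin /wave_cos a a1 b b1 !(mul0r, addr0, mulr0).
Qed.

Lemma depth_near_wall (w y : R) : 0 <= w <= 2^-1 -> 2^-1 - w <= `|y| -> depth y <= w.
Proof.
move=> /andP[w0 w1] h; rewrite /depth; have : (2^-1 - w) ^+ 2 <= `|y| ^+ 2.
  by rewrite lerXn2r ?nnegrE //; lra.
rewrite real_normK ?num_real // !expr2; nra.
Qed.

End pump.

Lemma le_subr_eq (R : numDomainType) (a b c : R) : 0 <= c -> b - a = c -> a <= b.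
Proof. by move=> c0 E; rewrite -subr_ge0 E. Qed.

(** * Pointwise bounds on the pump and its gradient *)

Section pump_bounds.
Context (R : realType).
Variables (m Q : R).
Hypotheses (m0 : 0 < m) (m1 : m <= 2^-1) (Q0 : 0 < Q).

Let mn0 : m != 0. Proof. by rewrite gt_eqF. Qed.
Let Qn0 : Q != 0. Proof. by rewrite gt_eqF. Qed.
Let mm1 : m <= 1. Proof. by apply: le_trans m1 _; lra. Qed.
Let m3 : m ^+ 3 <= 1. Proof. by rewrite exprn_ile1 ?(ltW m0). Qed.

Notation z := (outer_width m).
Notation dl := (inner_width m).
Notation k0 := (outer_k m Q).
Notation k1 := (inner_k m Q).
Notation K := (profile_bound R).
Notation nz := (near_wall z).
Notation nd := (near_wall dl).

Let K0 : 0 < K. Proof. exact: profile_bound_gt0. Qed.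
Let k0_gt0 : 0 < k0. Proof. by rewrite divr_gt0 ?exprn_gt0. Qed.
Let k1_gt0 : 0 < k1. Proof. by rewrite divr_gt0 ?exprn_gt0. Qed.

Let mk0 : 0 <= m / k0. Proof. exact: divr_ge0 (ltW m0) (ltW k0_gt0). Qed.
Let mk1 : 0 <= m / k1. Proof. exact: divr_ge0 (ltW m0) (ltW k1_gt0). Qed.

Section at_point.
Variable x : R * R.
Hypothesis hx : `|x.2| <= 2^-1.

Let nz01 : 0 <= nz x.2 <= 1. Proof. exact: near_wall_01. Qed.
Let nd01 : 0 <= nd x.2 <= 1. Proof. exact: near_wall_01. Qed.
Let nz0 : 0 <= nz x.2. Proof. by case/andP: nz01. Qed.
Let nd0 : 0 <= nd x.2. Proof. by case/andP: nd01. Qed.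

Let pos (a b : R) : 0 <= a -> 0 < b -> 0 <= a / b.
Proof. by move=> a0 b0; rewrite divr_ge0 // ltW. Qed.

Lemma pump2_le : `|pump2 m Q x| <= 2 * m.
Proof.
rewrite mulrC; apply: normM_le; first by rewrite gtr0_norm.
have nz1 : nz x.2 <= 1 by case/andP: nz01.
apply: normD_le.
  exact: le_trans (wave_sin_le _ _ _) (pa_le _ _).
exact: le_trans (wave_sin_le _ _ _) (le_trans (pb_le m0 m1 x.2) nz1).
Qed.

Lemma weighted_le (a b A B w w' : R) : 0 <= a -> 0 <= b -> `|w| <= A -> `|w'| <= B ->
  `|a * w + b * w'| <= a * A + b * B.
Proof.
move=> a0 b0 hw hw'; apply: normD_le; apply: normM_le => //; by rewrite ger0_norm.
Qed.

Lemma pump_err_le :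
  `|pump_err m Q x| <= 2 * K / Q * m * (m * nz x.2 + nd x.2).
Proof.
have [a1 _] := pa12_le m0 m1 hx; have b1 := pb1_le m0 m1 hx.
apply: le_trans (weighted_le mk0 mk1 (le_trans (wave_cos_le _ _ _) a1)
  (le_trans (wave_cos_le _ _ _) b1)) _.
(* The exact gap between the two sides. *)
have c0 : 0 <= K / Q * (m ^+ 2 * nz x.2 * (1 - m) + m * nd x.2).
  by rewrite mulr_ge0 ?pos ?(ltW K0) // addr_ge0 ?mulr_ge0 ?exprn_ge0 ?(ltW m0) // subr_ge0.
apply: le_subr_eq c0 _. rewrite /outer_k /inner_k /outer_width /inner_width; field.
by rewrite Qn0 mn0.
Qed.

Lemma amplitude_le (w w' : R) : `|w| <= `|pa m x.2| -> `|w'| <= `|pb m x.2| ->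
  `|m * (k0 * w + k1 * w')| <= Q / m ^+ 2 + Q / m ^+ 3 * nz x.2.
Proof.
move=> hw hw'.
have -> : Q / m ^+ 2 + Q / m ^+ 3 * nz x.2 = m * (k0 * 1 + k1 * nz x.2).
  by rewrite /outer_k /inner_k; field.
apply: normM_le; first by rewrite gtr0_norm.
apply: (weighted_le (ltW k0_gt0) (ltW k1_gt0)).
  exact: le_trans hw (pa_le _ _).
exact: le_trans hw' (pb_le m0 m1 x.2).
Qed.

Lemma amplitude1_le (w w' : R) : `|w| <= `|pa1 m x.2| -> `|w'| <= `|pb1 m x.2| ->
  `|m * (w + w')| <= 2 * K / m * nz x.2 + K / m ^+ 3 * nd x.2.
Proof.
move=> hw hw'; have [a1 _] := pa12_le m0 m1 hx; have b1 := pb1_le m0 m1 hx.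
have -> : 2 * K / m * nz x.2 + K / m ^+ 3 * nd x.2 =
    m * (K / z * nz x.2 + (K / z * nz x.2 + K / dl * nd x.2)).
  by rewrite /outer_width /inner_width; field.
apply: normM_le; first by rewrite gtr0_norm.
by apply: normD_le; [exact: le_trans hw a1|exact: le_trans hw' b1].
Qed.

Lemma amplitude2_le (w w' : R) : `|w| <= `|pa2 m x.2| -> `|w'| <= `|pb2 m x.2| ->
  `|m / k0 * w + m / k1 * w'| <= K / Q * (nz x.2 + m * nz x.2 + 61 / m ^+ 3 * nd x.2).
Proof.
move=> hw hw'; have [_ a2] := pa12_le m0 m1 hx; have b2 := pb2_le m0 m1 hx.
have -> : K / Q * (nz x.2 + m * nz x.2 + 61 / m ^+ 3 * nd x.2) =
    m / k0 * (K / (z * z) * nz x.2) +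
    m / k1 * (K / (z * z) * nz x.2 + 61 * K / (dl * dl) * nd x.2).
  by rewrite /outer_width /inner_width /outer_k /inner_k; field; rewrite Qn0 mn0.
by apply: (weighted_le mk0 mk1); [exact: le_trans hw a2|exact: le_trans hw' b2].
Qed.

Definition grad_const : R := Q + 4 * K + 61 * K / Q.

(** The worst entry, d2 of [pump1]. The four groups come from differentiating the phases of [pump2],
    its profiles, the profiles of the corrector, and the phases of the corrector. *)
Lemma dpump_total : (Q / m ^+ 2 + Q / m ^+ 3 * nz x.2) +
  (2 * K / m * nz x.2 + K / m ^+ 3 * nd x.2) +
  (K / Q * (nz x.2 + m * nz x.2 + 61 / m ^+ 3 * nd x.2) +
  (2 * K / m * nz x.2 + K / m ^+ 3 * nd x.2)) <=
  Q / m ^+ 2 + grad_const / m ^+ 3 * nz x.2 + grad_const / m ^+ 3 * nd x.2.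
Proof.
have i3 : 0 < m ^+ 3 by rewrite exprn_gt0.
have c0 : 0 <= (4 * K * (1 - m ^+ 2) + K / Q * (61 - (1 + m) * m ^+ 3)) / m ^+ 3 * nz x.2
    + (Q + 2 * K) / m ^+ 3 * nd x.2.
  rewrite addr_ge0 // mulr_ge0 // pos //; last by rewrite addr_ge0 ?mulr_ge0 ?(ltW Q0) ?(ltW K0).
  have h2 : m ^+ 2 <= 1 by rewrite exprn_ile1 ?(ltW m0).
  have p1 : 0 <= 1 + m by rewrite addr_ge0 // ltW.
  have h3 : (1 + m) * m ^+ 3 <= 61.
    apply: le_trans (ler_wpM2l p1 m3) _; rewrite mulr1; move: mm1; lra.
  apply: addr_ge0; first by rewrite mulr_ge0 ?mulr_ge0 ?(ltW K0) // subr_ge0.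
  by rewrite mulr_ge0 ?pos ?(ltW K0) // subr_ge0.
apply: le_subr_eq c0 _; rewrite /grad_const; field.
by rewrite Qn0 mn0.
Qed.

Lemma dpump_le j : `|dpump1 m Q j x| <=
    Q / m ^+ 2 + grad_const / m ^+ 3 * nz x.2 + grad_const / m ^+ 3 * nd x.2 /\
  `|dpump2 m Q j x| <=
    Q / m ^+ 2 + grad_const / m ^+ 3 * nz x.2 + grad_const / m ^+ 3 * nd x.2.
Proof.
have tot := dpump_total; move: tot.
have i2 : 0 < m ^+ 2 by rewrite exprn_gt0.
have i3 : 0 < m ^+ 3 by rewrite exprn_gt0.
have K20 : 0 <= 2 * K by rewrite mulr_ge0 // ltW.
have A0 : 0 <= Q / m ^+ 2 + Q / m ^+ 3 * nz x.2.
  by apply: addr_ge0; [exact: pos (ltW Q0) i2|exact: mulr_ge0 (pos (ltW Q0) i3) nz0].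
have B0 : 0 <= 2 * K / m * nz x.2 + K / m ^+ 3 * nd x.2.
  by apply: addr_ge0; [exact: mulr_ge0 (pos K20 m0) nz0|exact: mulr_ge0 (pos (ltW K0) i3) nd0].
have C0 : 0 <= K / Q * (nz x.2 + m * nz x.2 + 61 / m ^+ 3 * nd x.2).
  apply: mulr_ge0 (pos (ltW K0) Q0) _; apply: addr_ge0.
    exact: addr_ge0 nz0 (mulr_ge0 (ltW m0) nz0).
  by apply: mulr_ge0 _ nd0; exact: pos.
have hA := @amplitude_le; have hB := @amplitude1_le; have hC := @amplitude2_le.
move: A0 B0 C0 hA hB hC; set A := Q / m ^+ 2 + Q / m ^+ 3 * nz x.2.
set B := 2 * K / m * nz x.2 + K / m ^+ 3 * nd x.2.
set C := K / Q * _; set D := Q / m ^+ 2 + grad_const / m ^+ 3 * nz x.2 + grad_const / m ^+ 3 * nd x.2.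
move=> A0 B0 C0 hA hB hC tot.
have kn0 : k0 != 0 by rewrite gt_eqF. have kn1 : k1 != 0 by rewrite gt_eqF.
have ws h k : `|- wave_sin h k x| <= `|h x.2| by rewrite normrN wave_sin_le.
have wc h k : `|- wave_cos h k x| <= `|h x.2| by rewrite normrN wave_cos_le.
have AB_D : A + B <= D by lra.
have d20 : `|dpump2 m Q ord0 x| <= A.
  by rewrite /dpump2 /=; apply: hA; exact: wave_cos_le.
have d21 : `|dpump2 m Q ord_max x| <= A + B.
  have -> : dpump2 m Q ord_max x =
     m * (k0 * (- wave_cos (pa m) k0 x) + k1 * (- wave_cos (pb m) k1 x)) +
     m * (wave_sin (pa1 m) k0 x + wave_sin (pb1 m) k1 x) by rewrite /dpump2 /=; ring.
  by apply: normD_le; [exact: hA|apply: hB; exact: wave_sin_le].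
have d10 : `|dpump1 m Q ord0 x| <= A + B.
  have -> : dpump1 m Q ord0 x = dpump2 m Q ord0 x +
     m * (- wave_sin (pa1 m) k0 x + - wave_sin (pb1 m) k1 x).
    by rewrite /dpump1 /=; field; rewrite kn0 kn1.
  by apply: normD_le; [exact: d20|exact: hB].
have d11 : `|dpump1 m Q ord_max x| <= A + B + (C + B).
  have -> : dpump1 m Q ord_max x = dpump2 m Q ord_max x +
     ((m / k0 * wave_cos (pa2 m) k0 x + m / k1 * wave_cos (pb2 m) k1 x) +
     m * (wave_sin (pa1 m) k0 x + wave_sin (pb1 m) k1 x)).
    by rewrite /dpump1 /=; field; rewrite kn0 kn1.
  apply: normD_le; first exact: d21.
  by apply: normD_le; [apply: hC; exact: wave_cos_le|apply: hB; exact: wave_sin_le].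
have A_D : A <= D by lra.
by case: (ord2P j) => ->; split; [exact: le_trans d10 AB_D|exact: le_trans d20 A_D
  |exact: le_trans d11 tot|exact: le_trans d21 AB_D].
Qed.

End at_point.
End pump_bounds.

(** * The flow *)

Section construction.
Context (R : realType) (L1 : R).
Hypothesis hL1 : 0 < L1.
Variable n : nat.
Hypothesis n2 : (2 <= n)%N.

Notation LL := (L2 (leb2 R) (cell L1)).
Notation NN := (nrm (leb2 R) (cell L1)).
Let mC := @measurable_cell R L1.

(** The basic wave number of the circle. With m = 1 / n, k0 and k1 are its multiples by n^3 and n^4,
    hence the waves are periodic. *)
Definition pump_Q : R := (pi *+ 2) / L1.
Notation Q := pump_Q.
Notation m := (n%:R^-1 : R).

Lemma pump_Q_gt0 : 0 < Q.
Proof. by rewrite divr_gt0 // pmulrn_lgt0 // pi_gt0. Qed.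

Lemma pump_m_gt0 : 0 < m.
Proof. by rewrite invr_gt0 ltr0n; exact: leq_trans n2. Qed.

Lemma pump_m_le : m <= 2^-1.
Proof. by rewrite lef_pV2 ?posrE ?ltr0n ?(leq_trans _ n2) // ler_nat. Qed.

Let Q0 := pump_Q_gt0.
Let m0 := pump_m_gt0.
Let m1 := pump_m_le.
Let nn0 : n%:R != 0 :> R. Proof. by rewrite pnatr_eq0 -lt0n (leq_trans _ n2). Qed.

Notation z := (outer_width m).
Notation dl := (inner_width m).
Notation k0 := (outer_k m Q).
Notation k1 := (inner_k m Q).
Notation pa := (pa m).
Notation pa1 := (pa1 m).
Notation pb := (pb m).
Notation pb1 := (pb1 m).
Notation pump1 := (pump1 m Q).
Notation pump2 := (pump2 m Q).

Let dl0 : 0 < dl. Proof. by case/andP: (inner_width_bounds m0 m1). Qed.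
Let k0_gt0 : 0 < k0. Proof. by rewrite divr_gt0 ?exprn_gt0. Qed.
Let k1_gt0 : 0 < k1. Proof. by rewrite divr_gt0 ?exprn_gt0. Qed.

Let dl_half : dl <= 2^-1.
Proof.
apply: le_trans (inner_le_outer m0 m1) _; rewrite /outer_width expr2.
by apply: le_trans (ler_pM (ltW m0) (ltW m0) m1 m1) _; lra.
Qed.

(** The difference k1 - k0, written as a natural multiple of k0 so that periodicity is immediate. *)
Definition k_diff : R := n.-1%:R * k0.
Definition k_sum : R := k1 + k0.

Lemma k_diffE : k_diff = k1 - k0.
Proof.
rewrite /k_diff -subn1 natrB ?(leq_trans _ n2) //.
by rewrite /inner_k /outer_k; field; rewrite nn0.
Qed.

Lemma k_diff_ge : k1 / 2 <= k_diff.
Proof.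
rewrite k_diffE; have -> : k0 = m * k1 by rewrite /inner_k /outer_k; field; rewrite nn0.
by have := ler_wpM2r (ltW k1_gt0) m1; lra.
Qed.

Lemma wave_number_k0 : wave_number L1 k0.
Proof.
exists (n ^ 3)%N; rewrite /outer_k /pump_Q -[RHS]mulr_natl natrX; field.
by rewrite nn0 gt_eqF.
Qed.

Lemma wave_number_k1 : wave_number L1 k1.
Proof.
exists (n ^ 4)%N; rewrite /inner_k /pump_Q -[RHS]mulr_natl natrX; field.
by rewrite nn0 gt_eqF.
Qed.

(** Depth dl / 2 instead of dl: between the two the shear leaves the laminar profile, so [flow]
    minus [laminar] is only known to vanish up to dl / 2. *)
Lemma test_of_C1 (f : R * R -> R) g : C1_gradient f g ->
  (forall x1 x2, f (x1 + L1, x2) = f (x1, x2)) ->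
  (forall x, depth x.2 <= dl / 2 -> f x = 0) -> test_function L1 f.
Proof.
move=> fg per van; apply: (C1_test (d := dl / 2) fg per); first by rewrite divr_gt0.
move=> x1 x2 hx; apply: van; apply: depth_near_wall hx.
by rewrite divr_ge0 ?(ltW dl0) //=; have := dl_half; have := dl0; lra.
Qed.

Let half_le (y : R) : depth y <= dl / 2 -> depth y <= dl.
Proof. by move=> h; have := dl0; lra. Qed.

Lemma pump_periodic x1 x2 : pump1 (x1 + L1, x2) = pump1 (x1, x2) /\
  pump2 (x1 + L1, x2) = pump2 (x1, x2).
Proof.
rewrite /pump1 /pump_err /pump2 !(wave_sin_periodic _ _ _ wave_number_k0).
by rewrite !(wave_sin_periodic _ _ _ wave_number_k1)
  !(wave_cos_periodic _ _ _ wave_number_k0) !(wave_cos_periodic _ _ _ wave_number_k1).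
Qed.

Definition pump (i : 'I_2) : R * R -> R := if i == ord0 then pump1 else pump2.
Definition dpump (i : 'I_2) : 'I_2 -> R * R -> R :=
  if i == ord0 then dpump1 m Q else dpump2 m Q.

Lemma C1_pump i : C1_gradient (pump i) (dpump i).
Proof.
rewrite /pump /dpump; case: ifP => _; [exact: C1_pump1|exact: C1_pump2].
Qed.

Lemma pump_periodic' i x1 x2 : pump i (x1 + L1, x2) = pump i (x1, x2).
Proof. by have [p1 p2] := pump_periodic x1 x2; rewrite /pump; case: ifP. Qed.

Lemma pump_wall' i x : depth x.2 <= dl -> pump i x = 0.
Proof. by move=> /(pump_wall Q m0 m1)[p1 p2]; rewrite /pump; case: ifP. Qed.

Lemma pump_test i : test_function L1 (pump i).
Proof.
apply: (test_of_C1 (C1_pump i) (@pump_periodic' i)) => x /half_le; exact: pump_wall'.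
Qed.

(* The mean shear: it takes the wall values +-1/2 and lives where the pump vanishes. *)
Definition shear (y : R) : R := y * (1 - cut (dl / 2) y).
Definition shear1 (y : R) : R := y * - cut1 (dl / 2) y + (1 - cut (dl / 2) y) * 1.

Lemma derive_shear (y : R) : is_derive y 1 shear (shear1 y).
Proof.
have d2 : is_derive y 1 (fun s => 1 - cut (dl / 2) s) (- cut1 (dl / 2) y).
  have -> : (fun s => 1 - cut (dl / 2) s) = (fun s => 1 + -1 * cut (dl / 2) s).
    by apply/funext => s; rewrite mulN1r.
  apply: derive_eq (derive_add (derive_cst 1 y) (derive_scale (-1) (C2_derive1 (C2_cut (dl / 2)) y))) _.
  by rewrite add0r mulN1r.
exact: derive_mul (derive_id y) d2.
Qed.

Lemma shear1_continuous : continuous shear1.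
Proof.
have c0 := C2_continuous0 (C2_cut (dl / 2)); have c1 := C2_continuous1 (C2_cut (dl / 2)).
move=> y; apply: cvgD; apply: cvgM.
- exact: cvg_id.
- by apply: cvgN; exact: c1.
- by apply: cvgB; [exact: cvg_cst|exact: c0].
- exact: cvg_cst.
Qed.

Lemma C1_shear : C1_gradient (fun x : R * R => shear x.2)
  (fun j x => if j == ord0 then 0 else shear1 x.2).
Proof. exact: C1_profile derive_shear shear1_continuous. Qed.

Lemma shear_wall y : depth y <= dl / 2 -> shear y = y.
Proof.
move=> h; have d20 : 0 < dl / 2 by rewrite divr_gt0.
by have [c _ _] := cut_wall d20 h; rewrite /shear c subr0 mulr1.
Qed.

Lemma shear_bulk y : dl <= depth y -> shear y = 0.
Proof.
move=> h; have d20 : 0 < dl / 2 by rewrite divr_gt0.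
have h' : 2 * (dl / 2) <= depth y by rewrite mulrCA divff ?mulr1.
by have [c _ _] := cut_bulk d20 h'; rewrite /shear c subrr mulr0.
Qed.

Lemma shear1_le y : `|y| <= 2^-1 -> `|shear1 y| <= 31 / dl * near_wall dl y.
Proof.
move=> hy; have d20 : 0 < dl / 2 by rewrite divr_gt0.
have w_le : near_wall (dl / 2) y <= near_wall dl y.
  by apply: near_wall_le; have := dl0; lra.
have /andP[n0 _] := near_wall_01 dl y.
have /andP[c0 c1] := cut_bounds (dl / 2) y.
have b1 : `|y * - cut1 (dl / 2) y| <= 30 / dl * near_wall dl y.
  apply: le_trans (normM_le hy (_ : _ <= 30 / (dl / 2) * near_wall (dl / 2) y)) _.
    by rewrite normrN; exact: cut1_le.
  have -> : 2^-1 * (30 / (dl / 2) * near_wall (dl / 2) y) = 30 / dl * near_wall (dl / 2) y.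
    by field; rewrite gt_eqF.
  by rewrite ler_wpM2l // divr_ge0 // ltW.
have b2 : `|(1 - cut (dl / 2) y) * 1| <= 1 / dl * near_wall dl y.
  rewrite mulr1 ger0_norm ?subr_ge0 //.
  apply: le_trans (cut_le_near_wall y d20) _; apply: le_trans w_le _.
  rewrite -[leLHS]mul1r ler_wpM2r // mul1r invf_ge1 //.
  by have := dl_half; lra.
apply: le_trans (normD_le b1 b2) _.
by rewrite -mulrDl -mulrDl le_eqVlt; apply/orP; left; apply/eqP; congr (_ / _ * _); ring.
Qed.

Definition flow (i : 'I_2) (x : R * R) : R :=
  if i == ord0 then shear x.2 + pump i x else pump i x.
Definition dflow (i j : 'I_2) (x : R * R) : R :=
  if i == ord0 then (if j == ord0 then 0 else shear1 x.2) + dpump i j x else dpump i j x.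

Lemma C1_flow i : C1_gradient (flow i) (dflow i).
Proof.
rewrite /flow /dflow; case: (i == ord0); last exact: C1_pump.
exact: C1D C1_shear (C1_pump i).
Qed.

Lemma flow_periodic i x1 x2 : flow i (x1 + L1, x2) = flow i (x1, x2).
Proof. by rewrite /flow pump_periodic'. Qed.

(** The pump vanishes up to depth dl and the shear from depth dl on. *)
Lemma flow_pump i j x : flow j x * pump i x = pump j x * pump i x.
Proof.
rewrite /flow; case: ifP => // _; have [h|h] := leP (depth x.2) dl.
  by rewrite !(pump_wall' _ h) !mulr0.
by rewrite (shear_bulk (ltW h)) add0r.
Qed.

Lemma flow_laminar_test i : test_function L1 (fun x => flow i x - laminar i x).
Proof.
have C := C1B (C1_flow i) (laminar_C1 R i).
apply: (test_of_C1 C).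
  by move=> x1 x2; rewrite flow_periodic.
move=> x h; rewrite /flow /laminar; case: ifP => _; rewrite (pump_wall' _ (half_le h)).
  by rewrite (shear_wall h) addr0 subrr.
by rewrite subr0.
Qed.

Lemma H1_of_C1 (f : 'I_2 -> R * R -> R) (g : 'I_2 -> 'I_2 -> R * R -> R) :
  (forall i, C1_gradient (f i) (g i)) ->
  (forall i x1 x2, f i (x1 + L1, x2) = f i (x1, x2)) ->
  exists u : vector_field L1, forall i, H1_fun (u i) = f i /\ grad (u i) = g i.
Proof.
move=> fg per; suff /choice[u Hu] : forall i, exists u : H1 L1, H1_fun u = f i /\ grad u = g i.
  by exists u.
move=> i; apply: H1_exists; first exact: (continuous_L2 hL1 (C1_continuous (fg i))).
  by move=> j; exact: (continuous_L2 hL1 (@C1_gradient_continuous _ _ _ (fg i) j)).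
exact: (C1_weak_gradient hL1 (fg i) (per i)).
Qed.

Lemma flow_bounded : exists M : R, 0 <= M /\ forall i x, cell L1 x -> `|flow i x| <= M.
Proof.
have [A HA] := continuous_bounded_cell L1 (C1_continuous (C1_flow ord0)).
have [B HB] := continuous_bounded_cell L1 (C1_continuous (C1_flow ord_max)).
exists (`|A| + `|B|); split; first exact: addr_ge0.
move=> i x Dx; case: (ord2P i) => ->.
  by apply: le_trans (HA x Dx) _; apply: le_trans (ler_norm A) _; rewrite lerDl.
by apply: le_trans (HB x Dx) _; apply: le_trans (ler_norm B) _; rewrite lerDr.
Qed.

Lemma flow_div x : \sum_(i < 2) dflow i i x = 0.
Proof. by rewrite sum2 /dflow /dpump /= add0r; exact: pump_div. Qed.

Lemma pump_div' x : \sum_(i < 2) dpump i i x = 0.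
Proof. by rewrite sum2 /dpump /=; exact: pump_div. Qed.

Let cell_hx x : cell L1 x -> `|x.2| <= 2^-1.
Proof. by move=> [_ /=]; rewrite in_itv /= ler_norml. Qed.

Definition flow_grad_bound : R :=
  Q * Num.sqrt L1 + layer_const L1 * (2 * grad_const Q + 31).

Lemma nrm_le_layers (f : R * R -> R) (c A B : R) : 0 <= c -> 0 <= A -> 0 <= B -> LL f ->
  (forall x, cell L1 x ->
    `|f x| <= c + A * near_wall z x.2 + B * near_wall dl x.2) ->
  NN f <= c * Num.sqrt L1 + layer_const L1 * (A * m + B * m ^+ 2).
Proof.
move=> c0 A0 B0 Lf H; have Lc : LL (fun=> c * 1) by exact: (L2Z mC c (LL1 hL1)).
have Lz := layer_L2 hL1 z; have Ld := layer_L2 hL1 dl.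
pose h x := A * layer z x + B * layer dl x.
have Lh : LL h by exact: (L2D mC (L2Z mC A Lz) (L2Z mC B Ld)).
have h0 x : 0 <= h x.
  have /andP[z0 _] := layer_01 z x; have /andP[d0 _] := layer_01 dl x.
  by apply: addr_ge0; apply: mulr_ge0.
apply: (@le_trans _ _ (NN (fun x => c * 1 + h x))).
  rewrite le_nrm_sqr ?nrm_ge0 // nrm_sqr.
  apply: (le_ip mC Lf (L2D mC Lc Lh)) => x Dx.
  apply: le_trans (H x Dx) _; rewrite mulr1 /h addrA.
  exact: ler_norm.
apply: le_trans (nrmD mC Lc Lh) _; apply: lerD.
  by rewrite (nrm_const hL1) ?mulr1.
apply: (@nrm_le_layer R L1 hL1 h A B m (ltW m0) A0 B0 Lh).
by move=> x _; rewrite ger0_norm.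
Qed.

Lemma grad_const_gt0 : 0 < grad_const Q.
Proof.
have K0 := profile_bound_gt0 R; rewrite /grad_const; apply: addr_gt0.
  by apply: addr_gt0 => //; exact: mulr_gt0.
by apply: divr_gt0 => //; exact: mulr_gt0.
Qed.

(** The pointwise bounds are m^-2 everywhere, m^-3 on the outer layer and m^-4 on the inner one,
    whose indicators have L^2 norms of order m and m^2. *)
Lemma flow_grad_le i j : NN (dflow i j) <= flow_grad_bound / m ^+ 2 /\
  NN (dpump i j) <= flow_grad_bound / m ^+ 2.
Proof.
have i2 : 0 < m ^+ 2 by rewrite exprn_gt0.
have i3 : 0 < m ^+ 3 by rewrite exprn_gt0.
have G0 := grad_const_gt0.
have Lf := continuous_L2 hL1 (@C1_gradient_continuous _ _ _ (C1_flow i) j).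
have Lp := continuous_L2 hL1 (@C1_gradient_continuous _ _ _ (C1_pump i) j).
have Q2 : 0 <= Q / m ^+ 2 by exact: ltW (divr_gt0 Q0 i2).
have G3 : 0 <= grad_const Q / m ^+ 3 by exact: ltW (divr_gt0 G0 i3).
have D31 : 0 <= 31 / dl by rewrite divr_ge0 // ltW.
have bp x : cell L1 x -> `|dpump i j x| <=
    Q / m ^+ 2 + grad_const Q / m ^+ 3 * near_wall z x.2 + grad_const Q / m ^+ 3 * near_wall dl x.2.
  by move=> /cell_hx hx; have [h1 h2] := dpump_le m0 m1 Q0 hx j; rewrite /dpump; case: ifP.
have bf x : cell L1 x -> `|dflow i j x| <= Q / m ^+ 2 +
    grad_const Q / m ^+ 3 * near_wall z x.2 +
    (grad_const Q / m ^+ 3 + 31 / dl) * near_wall dl x.2.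
  move=> Dx; have hx := cell_hx Dx; have /andP[d0 _] := near_wall_01 dl x.2.
  have s0 : 0 <= 31 / dl * near_wall dl x.2 by exact: mulr_ge0.
  rewrite (mulrDl (grad_const Q / m ^+ 3)) addrA /dflow; case: ifP => _; last by apply: le_trans (bp x Dx) _; rewrite lerDl.
  rewrite (addrC (if j == ord0 then 0 else shear1 x.2)); apply: normD_le; first exact: bp.
  by case: ifP => _; [rewrite normr0|exact: shear1_le].
have S0 : 0 <= Num.sqrt L1 by exact: sqrtr_ge0.
have lc0 := ltW (layer_const_gt0 hL1).
have final (B : R) : 0 <= B -> B * m ^+ 2 <= (grad_const Q + 31) / m ^+ 2 ->
   Q / m ^+ 2 * Num.sqrt L1 + layer_const L1 * (grad_const Q / m ^+ 3 * m + B * m ^+ 2) <=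
   flow_grad_bound / m ^+ 2.
  move=> B0 hB; have -> : flow_grad_bound / m ^+ 2 = Q / m ^+ 2 * Num.sqrt L1 +
      layer_const L1 * (grad_const Q / m ^+ 3 * m + (grad_const Q + 31) / m ^+ 2).
    by rewrite /flow_grad_bound; field; rewrite nn0.
  by rewrite lerD2l ler_wpM2l // lerD2l.
have m1' : m <= 1 by apply: le_trans m1 _; lra.
have hG : grad_const Q / m ^+ 3 * m ^+ 2 <= grad_const Q / m ^+ 2.
  have -> : grad_const Q / m ^+ 3 * m ^+ 2 = grad_const Q / m ^+ 2 * m by field; rewrite nn0.
  by rewrite -[leRHS]mulr1 ler_wpM2l // ltW // divr_gt0.
split.
  apply: le_trans (nrm_le_layers Q2 G3 (addr_ge0 G3 D31) Lf bf) _; apply: final; first exact: addr_ge0.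
  have -> : (grad_const Q / m ^+ 3 + 31 / dl) * m ^+ 2 =
      grad_const Q / m ^+ 3 * m ^+ 2 + 31 / m ^+ 2.
    by rewrite /inner_width; field; rewrite nn0.
  by rewrite (mulrDl (grad_const Q) 31) lerD2r.
apply: le_trans (nrm_le_layers Q2 G3 G3 Lp bp) _; apply: final => //.
by apply: le_trans hG _; rewrite (mulrDl (grad_const Q) 31) lerDl divr_ge0 // ltW.
Qed.

End construction.

(** * Momentum flux of the flow *)

(** To be read with g = [pump2], g + e = [pump1], M = m^2 / 2, w the defect of the profiles and o
    the oscillation. *)
Lemma flux_square (R : comRingType) (g e M w o : R) : g * g = M - M * w + o ->
  (g + e) * (g + e) - (M + o) = - (M * w) + (g * e + g * e + e * e).
Proof.
move=> gg; transitivity (g * g - (M + o) + (g * e + g * e + e * e)); first by ring.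
by rewrite gg; ring.
Qed.

Lemma flux_mixed (R : comRingType) (g e M w o : R) : g * g = M - M * w + o ->
  g * (g + e) - (M + o) = - (M * w) + g * e.
Proof. by move=> gg; rewrite mulrDr gg; ring. Qed.

Section momentum_flux.
Context (R : realType) (L1 : R).
Hypothesis hL1 : 0 < L1.
Variable n : nat.
Hypothesis n2 : (2 <= n)%N.

Notation LL := (L2 (leb2 R) (cell L1)).
Notation NN := (nrm (leb2 R) (cell L1)).

Notation Q := (pump_Q L1).
Notation m := (n%:R^-1 : R).

Let Q0 : 0 < Q := pump_Q_gt0 hL1.
Let m0 : 0 < m := pump_m_gt0 R n2.
Let m1 : m <= 2^-1 := pump_m_le R n2.
Let Qn0 : Q != 0. Proof. by rewrite gt_eqF. Qed.
Let nn0 : n%:R != 0 :> R. Proof. by rewrite pnatr_eq0 -lt0n (leq_trans _ n2). Qed.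

Notation z := (outer_width m).
Notation dl := (inner_width m).
Notation k0 := (outer_k m Q).
Notation k1 := (inner_k m Q).
Notation kd := (k_diff L1 n).
Notation ks := (k_sum L1 n).
Notation K := (profile_bound R).
Notation pa := (pa m).
Notation pa1 := (pa1 m).
Notation pb := (pb m).
Notation pb1 := (pb1 m).
Notation pump1 := (pump1 m Q).
Notation pump2 := (pump2 m Q).

Let dl0 : 0 < dl. Proof. by case/andP: (inner_width_bounds m0 m1). Qed.
Let k0_gt0 : 0 < k0. Proof. by rewrite divr_gt0 ?exprn_gt0. Qed.
Let k1_gt0 : 0 < k1. Proof. by rewrite divr_gt0 ?exprn_gt0. Qed.
Let kd0 : 0 < kd. Proof. by apply: lt_le_trans (k_diff_ge hL1 n2); rewrite divr_gt0. Qed.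
Let ks0 : 0 < ks. Proof. exact: addr_gt0. Qed.
Let K0 : 0 < K. Proof. exact: profile_bound_gt0. Qed.

Definition aa (y : R) : R := pa y * pa y.
Definition aa1 (y : R) : R := pa y * pa1 y + pa y * pa1 y.
Definition bb (y : R) : R := pb y * pb y.
Definition bb1 (y : R) : R := pb y * pb1 y + pb y * pb1 y.
Definition ab (y : R) : R := pa y * pb y.
Definition ab1 (y : R) : R := pa y * pb1 y + pb y * pa1 y.

Let C2_aa : C2_profile aa aa1 _ := C2_mul (C2_pa m) (C2_pa m).
Let C2_bb : C2_profile bb bb1 _ := C2_mul (C2_pb m) (C2_pb m).
Let C2_ab : C2_profile ab ab1 _ := C2_mul (C2_pa m) (C2_pb m).

(** What the product-to-sum formulas leave of [pump2] squared besides its mean part: beats at k1 -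
    k0 and k1 + k0 from the mixed product, double frequencies from the squares. *)
Definition flux_osc (x : R * R) : R := m ^+ 2 *
  ((wave_cos ab kd x - wave_cos ab ks x) -
   2^-1 * (wave_cos aa (2 * k0) x + wave_cos bb (2 * k1) x)).

(* Primitive in x1 of (d1 + d2) flux_osc: phases depend on x1 - x2, so only the profiles are hit. *)
Definition flux_pot (x : R * R) : R := m ^+ 2 *
  ((kd^-1 * wave_sin ab1 kd x - ks^-1 * wave_sin ab1 ks x) -
   2^-1 * ((2 * k0)^-1 * wave_sin aa1 (2 * k0) x + (2 * k1)^-1 * wave_sin bb1 (2 * k1) x)).

Lemma pump2_sqr x :
  pump2 x * pump2 x = m ^+ 2 / 2 * (aa x.2 + bb x.2) + flux_osc x.
Proof.
rewrite /pump2 /flux_osc /wave_sin /wave_cos (k_diffE L1 n2) /k_sum.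
rewrite !(mulrBl (x.1 - x.2)) !(mulrDl _ _ (x.1 - x.2)) -!(mulrA 2).
set s := k0 * (x.1 - x.2); set t := k1 * (x.1 - x.2).
have d2 (u : R) : 2 * u = u + u by ring.
rewrite !d2 cosB !cosD /aa /bb /ab.
have hs := cos2Dsin2 s; have ht := cos2Dsin2 t; rewrite !expr2 in hs ht.
move: hs ht; move: (pa x.2) (pb x.2) (cos s) (sin s) (cos t) (sin t) => a b cs ss ct st hs ht.
apply/eqP; rewrite -subr_eq0; apply/eqP.
(* After expansion the two sides differ by multiples of cos^2 + sin^2 - 1. *)
transitivity (m ^+ 2 / 2 * (a * a * (cs * cs + ss * ss - 1) + b * b * (ct * ct + st * st - 1))).
  by field; rewrite nn0.
by rewrite hs ht subrr !mulr0 addr0 mulr0.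
Qed.

Let C1c (h h1 h2 : R -> R) k (H : C2_profile h h1 h2) := C1_wave_cos k (C2_derive1 H) (C2_continuous1 H).
Let C1s (h h1 h2 : R -> R) k (H : C2_profile h h1 h2) :=
  C1_wave_sin k (C2_derive2 H) (C2_continuous H).

Lemma C1_flux_osc : exists2 g, C1_gradient flux_osc g &
  forall x, g ord0 x + g ord_max x = m ^+ 2 * ((wave_cos ab1 kd x - wave_cos ab1 ks x) -
   2^-1 * (wave_cos aa1 (2 * k0) x + wave_cos bb1 (2 * k1) x)).
Proof.
eexists; first exact: (C1Z (m ^+ 2) (C1B (C1B (C1c kd C2_ab) (C1c ks C2_ab))
  (C1Z 2^-1 (C1D (C1c (2 * k0) C2_aa) (C1c (2 * k1) C2_bb))))).
by move=> x /=; rewrite -/ab1 -/aa1 -/bb1; ring.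
Qed.

Lemma C1_flux_pot : exists2 g, C1_gradient flux_pot g &
  forall x, g ord0 x = m ^+ 2 * ((wave_cos ab1 kd x - wave_cos ab1 ks x) -
   2^-1 * (wave_cos aa1 (2 * k0) x + wave_cos bb1 (2 * k1) x)).
Proof.
eexists; first exact: (C1Z (m ^+ 2) (C1B (C1B (C1Z kd^-1 (C1s kd C2_ab)) (C1Z ks^-1 (C1s ks C2_ab)))
  (C1Z 2^-1 (C1D (C1Z (2 * k0)^-1 (C1s (2 * k0) C2_aa)) (C1Z (2 * k1)^-1 (C1s (2 * k1) C2_bb)))))).
have k00 : 2 * k0 != 0 by rewrite gt_eqF // mulr_gt0.
have k10 : 2 * k1 != 0 by rewrite gt_eqF // mulr_gt0.
by move=> x /=; rewrite !mulKf ?(gt_eqF kd0) ?(gt_eqF ks0).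
Qed.

Let wn_kd : wave_number L1 kd.
Proof. exact: wave_number_natmul (wave_number_k0 hL1 n2). Qed.
Let wn_ks : wave_number L1 ks.
Proof. exact: wave_numberD (wave_number_k1 hL1 n2) (wave_number_k0 hL1 n2). Qed.
Let wn_2k0 : wave_number L1 (2 * k0).
Proof. exact: (wave_number_natmul 2 (wave_number_k0 hL1 n2)). Qed.
Let wn_2k1 : wave_number L1 (2 * k1).
Proof. exact: (wave_number_natmul 2 (wave_number_k1 hL1 n2)). Qed.

Lemma products_wall y : depth y <= dl / 2 ->
  [/\ aa y = 0, aa1 y = 0, bb y = 0 & bb1 y = 0] /\ ab y = 0 /\ ab1 y = 0.
Proof.
move=> h; have h' : depth y <= dl by have := dl0; lra.
have [a _ b _] := profiles_wall m0 m1 h'.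
by rewrite /aa /aa1 /bb /bb1 /ab /ab1 a b !(mul0r, addr0).
Qed.

Lemma flux_osc_test : test_function L1 flux_osc.
Proof.
have [g C _] := C1_flux_osc; apply: (test_of_C1 n2 C) => [x1 x2|x h].
  rewrite /flux_osc !(wave_cos_periodic _ _ _ wn_kd) !(wave_cos_periodic _ _ _ wn_ks).
  by rewrite !(wave_cos_periodic _ _ _ wn_2k0) !(wave_cos_periodic _ _ _ wn_2k1).
have [[a _ b _] [c _]] := products_wall h.
by rewrite /flux_osc /wave_cos a b c !(mul0r, subr0, addr0, mulr0).
Qed.

Lemma flux_pot_test : test_function L1 flux_pot.
Proof.
have [g C _] := C1_flux_pot; apply: (test_of_C1 n2 C) => [x1 x2|x h].
  rewrite /flux_pot !(wave_sin_periodic _ _ _ wn_kd) !(wave_sin_periodic _ _ _ wn_ks).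
  by rewrite !(wave_sin_periodic _ _ _ wn_2k0) !(wave_sin_periodic _ _ _ wn_2k1).
have [[_ a _ b] [_ c]] := products_wall h.
by rewrite /flux_pot /wave_sin a b c !(mul0r, subr0, addr0, mulr0).
Qed.

Lemma flux_transport x :
  partial ord0 flux_osc x + partial ord_max flux_osc x = partial ord0 flux_pot x.
Proof.
have [g C E] := C1_flux_osc; have [g' C' E'] := C1_flux_pot.
by rewrite !(C1_partial C) (C1_partial C') E E'.
Qed.

Section at_point.
Variable x : R * R.
Hypothesis hx : `|x.2| <= 2^-1.

Let nz := near_wall z x.2.
Let nd := near_wall dl x.2.
Let nz01 : 0 <= nz <= 1. Proof. exact: near_wall_01. Qed.
Let nd01 : 0 <= nd <= 1. Proof. exact: near_wall_01. Qed.
Let nz0 : 0 <= nz. Proof. by case/andP: nz01. Qed.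
Let nd0 : 0 <= nd. Proof. by case/andP: nd01. Qed.
Let pb1' : `|pb x.2| <= 1.
Proof. by apply: le_trans (pb_le m0 m1 x.2) _; case/andP: nz01. Qed.

(** Profiles varying at the inner scale occur only in terms divided by a wave number at least k1 /
    2, giving m^2 m^4 m^-4 on the inner layer; [aa1], divided by k0, varies at the outer scale only,
    giving m^2 m^3 m^-2. *)
Lemma flux_pot_le : `|flux_pot x| <= 8 * K / Q * m ^+ 3 * nz + 8 * K / Q * m ^+ 2 * nd.
Proof.
have [a1 _] := pa12_le m0 m1 hx; have b1 := pb1_le m0 m1 hx.
have ap := pa_le m x.2.
set A := K / z * nz in a1; set B := K / z * nz + K / dl * nd in b1.
have e1 : `|ab1 x.2| <= 1 * B + 1 * A by apply: normD_le; exact: normM_le.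
have e2 : `|aa1 x.2| <= 1 * A + 1 * A by apply: normD_le; exact: normM_le.
have e3 : `|bb1 x.2| <= 1 * B + 1 * B by apply: normD_le; exact: normM_le.
have i_kd : `|kd^-1| <= 2 * k1^-1.
  have k2 : 0 < k1 / 2 by exact: divr_gt0.
  have kdi : 0 < kd^-1 by rewrite invr_gt0.
  rewrite (gtr0_norm kdi).
  have -> : 2 * k1^-1 = (k1 / 2)^-1 by rewrite [RHS]invf_div.
  rewrite lef_pV2 ?posrE //.
  exact: (k_diff_ge hL1 n2).
have i_ks : `|ks^-1| <= k1^-1.
  have le : k1 <= ks by rewrite lerDl ltW.
  by rewrite gtr0_norm ?invr_gt0 // lef_pV2 ?posrE.
have i_2k0 : `|(2 * k0)^-1| <= 2^-1 * k0^-1.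
  by rewrite -(invfM 2 k0) gtr0_norm // invr_gt0 mulr_gt0.
have i_2k1 : `|(2 * k1)^-1| <= 2^-1 * k1^-1.
  by rewrite -(invfM 2 k1) gtr0_norm // invr_gt0 mulr_gt0.
have ws h k : `|wave_sin h k x| <= `|h x.2| by exact: wave_sin_le.
have f1 := normM_le i_kd (le_trans (ws ab1 kd) e1).
have f2 : `|- (ks^-1 * wave_sin ab1 ks x)| <= k1^-1 * (1 * B + 1 * A).
  by rewrite normrN; exact: normM_le i_ks (le_trans (ws ab1 ks) e1).
have f3 := normM_le i_2k0 (le_trans (ws aa1 (2 * k0)) e2).
have f4 := normM_le i_2k1 (le_trans (ws bb1 (2 * k1)) e3).
have h0 : `|2^-1 : R| <= 2^-1 by rewrite gtr0_norm.
have f5 := normM_le h0 (normD_le f3 f4); rewrite -normrN in f5.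
have m2 : `|m ^+ 2| <= m ^+ 2 by rewrite gtr0_norm // exprn_gt0.
apply: le_trans (normM_le m2 (normD_le (normD_le f1 f2) f5)) _.
have KQ : 0 <= K / Q by rewrite divr_ge0 // ltW.
have c0 : 0 <= K / Q * (m ^+ 2) * (m * nz * (15 / 2 - 13 / 2 * m) + 9 / 2 * nd).
  apply: mulr_ge0; first by rewrite mulr_ge0 // exprn_ge0 // ltW.
  apply: addr_ge0; last by rewrite mulr_ge0 // divr_ge0.
  by rewrite mulr_ge0 ?mulr_ge0 ?(ltW m0) //; have := m1; lra.
apply: le_subr_eq c0 _; rewrite /A /B /outer_k /inner_k /outer_width /inner_width; field.
by rewrite Qn0 nn0.
Qed.

Definition err_const : R := 2 * K / Q.
(** One for the profile defect, 2 [err_const] for each of the two cross terms of (g + e)^2, and the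
    last summand for e^2. *)
Definition flux_const : R := 1 + 4 * err_const + 2 * (err_const * err_const).

Lemma flux_rem_le i j :
  `|pump L1 n j x * pump L1 n i x - (m ^+ 2 / 2 + flux_osc x)| <=
  flux_const * m ^+ 3 * nz + flux_const * m ^+ 2 * nd.
Proof.
have hg : `|pump2 x| <= 2 * m by apply: pump2_le.
have he : `|pump_err m Q x| <= 2 * K / Q * m * (m * nz + nd) by apply: pump_err_le.
have hf := flux_defect_le m0 m1 x.2.
have E0 : 0 <= err_const by apply: ltW; apply: divr_gt0 => //; exact: mulr_gt0.
(* Common spatial factor of all errors; the bound D <= 2 makes the quadratic error linear in it. *)
set D := m * nz + nd; have D0 : 0 <= D by rewrite addr_ge0 ?mulr_ge0 // ltW.
have D2 : D <= 2.
  have : m * nz <= 2^-1 * 1 by apply: ler_pM (ltW m0) nz0 m1 _; case/andP: nz01.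
  by have : nd <= 1 by [case/andP: nd01]; rewrite /D; lra.
have -> : flux_const * m ^+ 3 * nz + flux_const * m ^+ 2 * nd = flux_const * m ^+ 2 * D.
  by rewrite /D; ring.
set g := pump2 x in hg; set e := pump_err m Q x in he.
have {}he : `|e| <= err_const * m * D by exact: he.
have m20 : 0 <= m ^+ 2 by exact: exprn_ge0 (ltW m0).
have EE0 : 0 <= err_const * err_const by exact: mulr_ge0.
have hge : `|g * e| <= 2 * err_const * m ^+ 2 * D.
  have -> : 2 * err_const * m ^+ 2 * D = 2 * m * (err_const * m * D) by ring.
  exact: normM_le.
have hee : `|e * e| <= 2 * (err_const * err_const) * m ^+ 2 * D.
  apply: le_trans (normM_le he he) _.
  have -> : err_const * m * D * (err_const * m * D) =
    err_const * err_const * m ^+ 2 * D * D by ring.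
  have -> : 2 * (err_const * err_const) * m ^+ 2 * D =
    err_const * err_const * m ^+ 2 * D * 2 by ring.
  by apply: ler_wpM2l => //; exact: mulr_ge0 (mulr_ge0 EE0 m20) D0.
set w := 1 - (aa x.2 + bb x.2).
have hw : `|- (m ^+ 2 / 2 * w)| <= m ^+ 2 * D.
  rewrite normrN; apply: (@le_trans _ _ (m ^+ 2 / 2 * (2 * nd))).
    by apply: normM_le hf; rewrite ger0_norm // divr_ge0.
  have -> : m ^+ 2 / 2 * (2 * nd) = m ^+ 2 * nd by field; rewrite nn0.
  by rewrite ler_wpM2l // /D lerDr mulr_ge0 // ltW.
have gg : g * g = m ^+ 2 / 2 - m ^+ 2 / 2 * w + flux_osc x.
  by rewrite /g pump2_sqr /w; ring.
have p1 : pump1 x = g + e by [].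
have p2 : pump2 x = g by [].
have mD0 : 0 <= m ^+ 2 * D by exact: mulr_ge0.
have c1 : 0 <= 4 * err_const * (m ^+ 2 * D) by exact: mulr_ge0 (mulr_ge0 (ler0n _ 4) E0) mD0.
have c2 : 0 <= 2 * (err_const * err_const) * (m ^+ 2 * D) by exact: mulr_ge0 (mulr_ge0 (ler0n _ 2) EE0) mD0.
have c3 : 0 <= 2 * err_const * (m ^+ 2 * D) by exact: mulr_ge0 (mulr_ge0 (ler0n _ 2) E0) mD0.
have split1 : flux_const * m ^+ 2 * D = m ^+ 2 * D + 4 * err_const * (m ^+ 2 * D) +
    2 * (err_const * err_const) * (m ^+ 2 * D) by rewrite /flux_const; ring.
have b0 : `|- (m ^+ 2 / 2 * w)| <= flux_const * m ^+ 2 * D.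
  by apply: le_trans hw _; rewrite split1 -addrA lerDl addr_ge0.
have b1 : `|- (m ^+ 2 / 2 * w) + g * e| <= flux_const * m ^+ 2 * D.
  apply: le_trans (normD_le hw hge) _; rewrite split1.
  have -> : 2 * err_const * m ^+ 2 * D = 2 * err_const * (m ^+ 2 * D) by ring.
  have -> : 4 * err_const * (m ^+ 2 * D) =
    2 * err_const * (m ^+ 2 * D) + 2 * err_const * (m ^+ 2 * D) by ring.
  by rewrite -!addrA lerD2l lerDl addr_ge0.
have b2 : `|- (m ^+ 2 / 2 * w) + (g * e + g * e + e * e)| <= flux_const * m ^+ 2 * D.
  apply: le_trans (normD_le hw (normD_le (normD_le hge hge) hee)) _; rewrite split1.
  by rewrite le_eqVlt; apply/orP; left; apply/eqP; ring.
(* The four products contain the corrector twice, once, once and not at all. *)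
case: (ord2P i) => ->; case: (ord2P j) => ->; rewrite /pump /=.
- by rewrite p1 (flux_square e gg).
- by rewrite p1 p2 (flux_mixed e gg).
- by rewrite p1 p2 (mulrC (g + e)) (flux_mixed e gg).
- by rewrite p2 -[g in g * g]addr0 (flux_square 0 gg) !mulr0 !addr0.
Qed.

End at_point.

Let cell_hx x : cell L1 x -> `|x.2| <= 2^-1.
Proof. by move=> [_ /=]; rewrite in_itv /= ler_norml. Qed.

(** Both layers contribute equally: m^3 times the norm m, and m^2 times the norm m^2. *)
Lemma nrm_m4 (f : R * R -> R) (C : R) : 0 <= C -> LL f ->
  (forall x, cell L1 x -> `|f x| <=
     C * m ^+ 3 * near_wall z x.2 + C * m ^+ 2 * near_wall dl x.2) ->
  NN f <= 2 * (layer_const L1 * C) * m ^+ 4.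
Proof.
move=> C0 Lf H.
have p3 : 0 <= C * m ^+ 3 by apply: mulr_ge0 => //; exact: exprn_ge0 (ltW m0).
have p2 : 0 <= C * m ^+ 2 by apply: mulr_ge0 => //; exact: exprn_ge0 (ltW m0).
apply: le_trans (nrm_le_layers hL1 n2 (lexx 0) p3 p2 Lf _) _.
  by move=> x Dx; rewrite add0r; exact: H.
by rewrite mul0r add0r le_eqVlt; apply/orP; left; apply/eqP; ring.
Qed.

Lemma flux_pot_nrm : NN flux_pot <= 2 * (layer_const L1 * (8 * K / Q)) * m ^+ 4.
Proof.
apply: nrm_m4; first by exact: ltW (divr_gt0 (mulr_gt0 (ltr0Sn R 7) K0) Q0).
  exact: (test_L2 hL1 flux_pot_test).
by move=> x /cell_hx hx; exact: flux_pot_le.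
Qed.

Definition flux_rem (i j : 'I_2) (x : R * R) : R :=
  pump L1 n j x * pump L1 n i x - (m ^+ 2 / 2 + flux_osc x).

Lemma flux_rem_L2 i j : LL (flux_rem i j).
Proof.
apply: (continuous_L2 hL1); have [g C _] := C1_flux_osc.
exact: C1_continuous (C1B (C1M (C1_pump L1 n j) (C1_pump L1 n i)) (C1D (C1_cst (m ^+ 2 / 2)) C)).
Qed.

Lemma flux_const_gt0 : 0 < flux_const.
Proof.
have E0 : 0 <= err_const by apply: ltW; apply: divr_gt0 => //; exact: mulr_gt0.
rewrite /flux_const -addrA; apply: ltr_wpDr => //; apply: addr_ge0; apply: mulr_ge0 => //.
exact: mulr_ge0.
Qed.

Lemma flux_rem_nrm i j : NN (flux_rem i j) <= 2 * (layer_const L1 * flux_const) * m ^+ 4.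
Proof.
apply: nrm_m4; [exact: ltW flux_const_gt0|exact: flux_rem_L2|].
by move=> x /cell_hx hx; exact: flux_rem_le.
Qed.

End momentum_flux.

(** * Dissipation of the flow *)

Section shear_transport.
Context (R : realType) (L1 : R).
Hypothesis hL1 : 0 < L1.
Variable n : nat.
Hypothesis n2 : (2 <= n)%N.

Notation LL := (L2 (leb2 R) (cell L1)).
Notation II := (ip (leb2 R) (cell L1)).
Notation NN := (nrm (leb2 R) (cell L1)).
Let mC := @measurable_cell R L1.

Notation Q := (pump_Q L1).
Notation m := (n%:R^-1 : R).
Notation dl := (inner_width m).
Notation k0 := (outer_k m Q).
Notation k1 := (inner_k m Q).

Let Q0 : 0 < Q := pump_Q_gt0 hL1.
Let m0 : 0 < m := pump_m_gt0 R n2.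
Let m1 : m <= 2^-1 := pump_m_le R n2.
Let k0_gt0 : 0 < k0. Proof. by rewrite divr_gt0 ?exprn_gt0. Qed.
Let k1_gt0 : 0 < k1. Proof. by rewrite divr_gt0 ?exprn_gt0. Qed.

Definition flux_profile (y : R) : R := aa n y + bb n y.
Definition flux_profile1 (y : R) : R := aa1 n y + bb1 n y.

Let C2_aa := C2_mul (C2_pa m) (C2_pa m).
Let C2_bb := C2_mul (C2_pb m) (C2_pb m).

Let C1_flux_profile : C1_gradient (fun x : R * R => flux_profile x.2)
  (fun j x => if j == ord0 then 0 else flux_profile1 x.2).
Proof.
apply: eq_C1 (C1D (C1_profile (C2_derive1 C2_aa) (C2_continuous1 C2_aa))
  (C1_profile (C2_derive1 C2_bb) (C2_continuous1 C2_bb))) => // j x.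
by case: ifP => _; rewrite ?addr0.
Qed.

Let C1_flux_profile1 : exists2 g : 'I_2 -> R * R -> R,
  C1_gradient (fun x : R * R => flux_profile1 x.2) g & forall x, g ord0 x = 0.
Proof.
eexists; first exact: (C1D (C1_profile (C2_derive2 C2_aa) (C2_continuous C2_aa))
  (C1_profile (C2_derive2 C2_bb) (C2_continuous C2_bb))).
by move=> x /=; rewrite addr0.
Qed.

Lemma flux_profile_test : test_function L1 (fun x => flux_profile x.2).
Proof.
apply: (test_of_C1 n2 C1_flux_profile) => // x h.
by have [[a _ b _] _] := products_wall n2 h; rewrite /flux_profile a b addr0.
Qed.

(** A periodic primitive of [pump1] in x1: at each depth the pump has zero mean over the circle. *)
Definition pump_primitive (x : R * R) : R :=
  m * ((- k0^-1) * wave_cos (pa m) k0 x + (- k1^-1) * wave_cos (pb m) k1 x) +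
  (m / k0 / k0 * wave_sin (pa1 m) k0 x + m / k1 / k1 * wave_sin (pb1 m) k1 x).

Let C1_pump_primitive : exists2 g, C1_gradient pump_primitive g &
  forall x, g ord0 x = pump1 m Q x.
Proof.
eexists; first exact: (C1D (C1Z m (C1D
   (C1Z (- k0^-1) (C1_wave_cos k0 (C2_derive1 (C2_pa m)) (C2_continuous1 (C2_pa m))))
   (C1Z (- k1^-1) (C1_wave_cos k1 (C2_derive1 (C2_pb m)) (C2_continuous1 (C2_pb m))))))
  (C1D (C1Z (m / k0 / k0) (C1_wave_sin k0 (C2_derive2 (C2_pa m)) (C2_continuous (C2_pa m))))
   (C1Z (m / k1 / k1) (C1_wave_sin k1 (C2_derive2 (C2_pb m)) (C2_continuous (C2_pb m)))))).
move=> x /=; rewrite /pump1 /pump2 /pump_err.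
have := k0_gt0; have := k1_gt0; move: (k0) (k1) => a b b0 a0.
by field; rewrite !gt_eqF // ltr0n (leq_trans _ n2).
Qed.

Lemma pump_primitive_periodic x1 x2 :
  pump_primitive (x1 + L1, x2) = pump_primitive (x1, x2).
Proof.
have w0 := wave_number_k0 hL1 n2; have w1 := wave_number_k1 hL1 n2.
by rewrite /pump_primitive !(wave_cos_periodic _ _ _ w0) !(wave_cos_periodic _ _ _ w1)
  !(wave_sin_periodic _ _ _ w0) !(wave_sin_periodic _ _ _ w1).
Qed.

Lemma flow_flux_profile1 x :
  flow L1 n ord0 x * flux_profile1 x.2 = pump1 m Q x * flux_profile1 x.2.
Proof.
rewrite /flow /pump /= mulrDl; have [h|h] := leP (depth x.2) dl.
  have [a b c d] := profiles_wall m0 m1 h.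
  by rewrite /flux_profile1 /aa1 /bb1 a b c d !(mul0r, mulr0, addr0).
by rewrite (shear_bulk n2 (ltW h)) mul0r add0r.
Qed.

(* The pump oscillates in x1 and the mean shear vanishes where the profile varies. *)
Lemma flow_flux_profile1_ip :
  II (flow L1 n ord0) (fun x => flux_profile1 x.2) = 0.
Proof.
have [g Cg g0] := C1_pump_primitive; have [h Ch h0] := C1_flux_profile1.
have C := C1M Cg Ch; rewrite -(Rintegral_gradient1 hL1 C) ?ipE; last first.
  by move=> x1 x2; rewrite pump_primitive_periodic.
by apply: eq_Rintegral => x _ /=; rewrite h0 g0 mulr0 add0r flow_flux_profile1 mulrC.
Qed.

Lemma flux_profile_defect_nrm :
  NN (fun x => 1 - flux_profile x.2) <= 2 * layer_const L1 * m ^+ 2.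
Proof.
have Lf : LL (fun x => 1 - flux_profile x.2).
  exact: (L2B mC (LL1 hL1) (test_L2 hL1 flux_profile_test)).
apply: le_trans (nrm_le_layers hL1 n2 (lexx 0) (lexx 0) (ler0n R 2) Lf _) _.
  by move=> x _; rewrite add0r mul0r add0r; exact: flux_defect_le.
by rewrite !mul0r !add0r mulrCA mulrA.
Qed.

(** With F the flux profile, the integral of d2 U1 is L1 by the boundary values while that of F d2
    U1 is 0 by [flow_flux_profile1_ip]. So pairing d2 U1 with 1 - F, of norm O(m^2), gives L1. *)
Lemma flow_grad_lower (U : vector_field L1) : couette_bc U ->
  H1_fun (U ord0) = flow L1 n ord0 ->
  L1 <= grad_norm U * (2 * layer_const L1 * m ^+ 2).
Proof.
move=> cU EU; have tf := flux_profile_test.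
have w := H1_weak (U ord0) ord_max tf.
have LG := H1_grad_L2 (U ord0) ord_max; have Lp := test_L2 hL1 tf.
have G0 : II (grad (U ord0) ord_max) (fun x => flux_profile x.2) = 0.
  apply/eqP; rewrite -oppr_eq0 -w EU (C1_partial C1_flux_profile) /=.
  by rewrite flow_flux_profile1_ip.
have G1 : II (grad (U ord0) ord_max) (fun x => 1 - flux_profile x.2) = L1.
  rewrite (ipBr mC (LL1 hL1) Lp LG) G0 subr0 -[RHS](couette_mean_gradient hL1 ord0 ord_max cU).
  by rewrite ipE; apply: eq_Rintegral => x _; rewrite mulr1.
rewrite -[leLHS]G1; apply: le_trans (ler_norm _) _.
apply: le_trans (ip_le_nrm mC LG (L2B mC (LL1 hL1) Lp)) _.
apply: ler_pM; rewrite ?nrm_ge0 //; first exact: nrm_le_grad_norm.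
exact: flux_profile_defect_nrm.
Qed.

End shear_transport.

(** * From the integer scale to the viscosity *)

Lemma lower_bound_arith (R : realFieldType) (L m g A B s t1 t2 t3 t4 w gu : R) :
  0 <= gu -> 0 < m -> s <= 2 * A * m ^+ 4 -> t1 <= 2 * B * m ^+ 4 ->
  t2 <= 2 * B * m ^+ 4 -> t3 <= 2 * B * m ^+ 4 -> t4 <= 2 * B * m ^+ 4 ->
  w <= 128 * g * m ^+ 4 ->
  m ^+ 2 / 2 * L <= gu * (4 * w + 2 * s + (t1 + t2 + (t3 + t4))) ->
  L / 2 <= gu * ((512 * g + (4 * A + 8 * B)) * m ^+ 2).
Proof.
move=> gu0 m0 hs h1 h2 h3 h4 hw H.
have m2 : 0 < m ^+ 2 by rewrite exprn_gt0.
rewrite -(ler_pM2l m2); have -> : m ^+ 2 * (L / 2) = m ^+ 2 / 2 * L by ring.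
apply: le_trans H _.
have -> : m ^+ 2 * (gu * ((512 * g + (4 * A + 8 * B)) * m ^+ 2)) =
  gu * ((512 * g + (4 * A + 8 * B)) * m ^+ 4) by ring.
by apply: ler_wpM2l => //; lra.
Qed.
Lemma dissipation_lower (R : realFieldType) (L a w p g : R) :
  0 < L -> 0 < a -> 0 < w -> 0 < p -> a <= g * (w * p ^+ 2) ->
  a ^+ 2 / (w ^+ 2 * L) * p ^+ 2 <= p ^+ 6 * (L^-1 * g ^+ 2).
Proof.
move=> L0 a0 w0 p0 h; have wp : 0 < w * p ^+ 2 by rewrite mulr_gt0 // exprn_gt0.
have hg : a / (w * p ^+ 2) <= g by rewrite ler_pdivrMr.
have hg2 : (a / (w * p ^+ 2)) ^+ 2 <= g ^+ 2.
  have ag : 0 <= a / (w * p ^+ 2) by rewrite divr_ge0 // ltW.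
  by rewrite ler_pXn2r // nnegrE // (le_trans ag).
have -> : a ^+ 2 / (w ^+ 2 * L) * p ^+ 2 = p ^+ 6 * (L^-1 * (a / (w * p ^+ 2)) ^+ 2).
  by field; rewrite !gt_eqF.
by rewrite ler_wpM2l ?exprn_ge0 ?(ltW p0) // ler_wpM2l // invr_ge0 ltW.
Qed.

Lemma dissipation_upper (R : realFieldType) (L b p g : R) :
  0 < L -> 0 < p -> 0 <= g -> g <= b / p ^+ 2 ->
  p ^+ 6 * (L^-1 * g ^+ 2) <= b ^+ 2 / L * p ^+ 2.
Proof.
move=> L0 p0 g0 h; have hg2 : g ^+ 2 <= (b / p ^+ 2) ^+ 2.
  by rewrite ler_pXn2r // nnegrE // (le_trans g0).
have -> : b ^+ 2 / L * p ^+ 2 = p ^+ 6 * (L^-1 * (b / p ^+ 2) ^+ 2).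
  by field; rewrite !gt_eqF.
by rewrite ler_wpM2l ?exprn_ge0 ?(ltW p0) // ler_wpM2l // invr_ge0 ltW.
Qed.

(* The scale: with p = nu ^ (1/6), the integer n is the first one above 1 / p. *)
Lemma scale_exists (R : realType) (nu : R) : 0 < nu < 8^-1 ->
  exists p : R, exists n : nat, [/\ (2 <= n)%N, 0 < p, nu = p ^+ 6,
    nu `^ (3^-1) = p ^+ 2 & n%:R^-1 <= p <= 2 * n%:R^-1].
Proof.
move=> /andP[nu0 nu1]; pose p := nu `^ (6^-1); have p0 : 0 < p by exact: powR_gt0.
have p6 : p ^+ 6 = nu.
  by rewrite -powR_mulrn ?(ltW p0) // /p -powRrM mulVf // powRr1 // ltW.
have p1 : p <= 1.
  rewrite leNgt; apply/negP => h; have : 1 < p ^+ 6 by rewrite exprn_egt1.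
  by rewrite p6; lra.
have pi1 : 1 <= p^-1 by rewrite invf_ge1.
have pi0 : 0 <= p^-1 by rewrite invr_ge0 ltW.
pose k := Num.truncn p^-1; have /andP[k1 k2] := Num.Theory.truncn_itv pi0.
exists p, k.+1; split => //.
- by rewrite -(ltr_nat R); exact: le_lt_trans pi1 k2.
- rewrite -powR_mulrn ?(ltW p0) // /p -powRrM; congr (_ `^ _); by field.
- have n0 : 0 < k.+1%:R :> R by rewrite ltr0n.
  apply/andP; split.
    by rewrite -[leRHS]invrK lef_pV2 ?posrE ?invr_gt0 // ltW.
  (* Rounding up costs at most a factor 2 because 1 / p >= 1. *)
  have : k.+1%:R <= 2 * p^-1 by rewrite -natr1; move: k1 pi1; rewrite -/k; lra.
  move=> h; rewrite -[leLHS]invrK -[leRHS]invrK lef_pV2 ?posrE ?invr_gt0 ?mulr_gt0 ?invr_gt0 //.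
  by rewrite invfM invrK mulrC ler_pdivrMr // mulrC.
Qed.

Section scale.
Context (R : realType) (L1 : R).
Hypothesis hL1 : 0 < L1.

Notation Q := (pump_Q L1).
Notation G := (flow_grad_bound L1).

Definition passive_const : R := 512 * G +
  (4 * (layer_const L1 * (8 * profile_bound R / Q)) + 8 * (layer_const L1 * flux_const L1)).

Lemma flow_grad_bound_gt0 : 0 < G.
Proof.
have Q0 := pump_Q_gt0 hL1; have lc0 := layer_const_gt0 hL1; have g0 := grad_const_gt0 hL1.
rewrite /flow_grad_bound; apply: addr_gt0; apply: mulr_gt0 => //; first by rewrite sqrtr_gt0.
by apply: addr_gt0 => //; exact: mulr_gt0.
Qed.

Lemma passive_const_gt0 : 0 < passive_const.
Proof.
have lc0 := layer_const_gt0 hL1; have f0 := flux_const_gt0 hL1.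
have K0 := profile_bound_gt0 R; have Q0 := pump_Q_gt0 hL1.
have n0 k : (0 : R) < k.+1%:R by rewrite ltr0n.
have b0 : 0 < 8 * profile_bound R / Q := divr_gt0 (mulr_gt0 (n0 7) K0) Q0.
exact: addr_gt0 (mulr_gt0 (n0 511) flow_grad_bound_gt0)
  (addr_gt0 (mulr_gt0 (n0 3) (mulr_gt0 lc0 b0)) (mulr_gt0 (n0 7) (mulr_gt0 lc0 f0))).
Qed.

Lemma divergence_free_everywhere (u : vector_field L1) :
  (forall x, \sum_(i < 2) grad (u i) i x = 0) -> divergence_free u.
Proof. by move=> H; apply: aeW => x _; exact: H. Qed.

(** The flow depends on n alone; nu enters only through nu <= 64 m^6, which is p <= 2 m raised to
    the sixth power. *)
Lemma flow_exists (n : nat) : (2 <= n)%N -> exists U : vector_field L1,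
  [/\ essentially_bounded U, divergence_free U & couette_bc U] /\
  [/\ grad_norm U <= 2 * (G / n%:R^-1 ^+ 2),
      L1 <= grad_norm U * (2 * layer_const L1 * n%:R^-1 ^+ 2) &
      forall nu : R, 0 < nu -> nu <= 64 * n%:R^-1 ^+ 6 ->
        (exists u : vector_field L1, passive_field nu U u) /\
        (forall u : vector_field L1, passive_field nu U u ->
           L1 / 2 <= grad_norm u * (passive_const * n%:R^-1 ^+ 2))].
Proof.
move=> n2; have m0 := pump_m_gt0 R n2.
have [U EU] := H1_of_C1 hL1 (C1_flow L1 n) (flow_periodic hL1 n2).
have [v Ev] := H1_of_C1 hL1 (C1_pump L1 n) (pump_periodic' hL1 n2).
have [M [M0 HM]] := flow_bounded L1 n.
have UM i x : cell L1 x -> `|U i x| <= M by rewrite (EU i).1; exact: HM.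
have dU : divergence_free U.
  apply: divergence_free_everywhere => x.
  by rewrite -[RHS](flow_div hL1 n2 x); apply: eq_bigr => i _; rewrite (EU i).2.
have dv : divergence_free v.
  apply: divergence_free_everywhere => x.
  by rewrite -[RHS](pump_div' hL1 n2 x); apply: eq_bigr => i _; rewrite (Ev i).2.
have mC := @measurable_cell R L1.
have cU : couette_bc U.
  move=> i; apply/(in_H10P hL1).
  - exact: (L2B mC (H1_fun_L2 (U i)) (laminar_L2 hL1 i)).
  - by move=> j; exact: (L2B mC (H1_grad_L2 (U i) j) (laminar_grad_L2 hL1 i j)).
  have := test_H10 hL1 (flow_laminar_test hL1 n2 i).
  rewrite (_ : (fun j => _) = (fun j x => dflow L1 n i j x - laminar_grad i j x)).
    by rewrite (EU i).1 (EU i).2.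
  by apply/funext => j; exact: C1_partial (C1B (C1_flow L1 n i) (laminar_C1 R i)) j.
have nv : no_slip v.
  move=> i; apply/(in_H10P hL1).
  - exact: H1_fun_L2.
  - by move=> j; exact: H1_grad_L2.
  have := test_H10 hL1 (pump_test hL1 n2 i).
  rewrite (_ : (fun j => _) = dpump L1 n i); first by rewrite (Ev i).1 (Ev i).2.
  by apply/funext => j; exact: C1_partial (C1_pump L1 n i) j.
have Gm : 0 <= G / n%:R^-1 ^+ 2.
  by exact: ltW (divr_gt0 flow_grad_bound_gt0 (exprn_gt0 2 m0)).
have gU : grad_norm U <= 2 * (G / n%:R^-1 ^+ 2).
  by apply: (grad_norm_le Gm) => i j; rewrite (EU i).2; have [] := flow_grad_le hL1 n2 i j.
have gv : grad_norm v <= 2 * (G / n%:R^-1 ^+ 2).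
  by apply: (grad_norm_le Gm) => i j; rewrite (Ev i).2; have [] := flow_grad_le hL1 n2 i j.
exists U; split; first by split => //; exists M => i; apply: aeW => x; exact: UM.
split => //; first exact: (flow_grad_lower hL1 n2 cU (EU ord0).1).
move=> nu nu0 nu1; split; first exact: (passive_field_exists hL1 M0 UM dU nu0).
move=> u pu.
have Uv i j x : cell L1 x ->
    U j x * v i x = n%:R^-1 ^+ 2 / 2 + flux_osc L1 n x + flux_rem L1 n i j x.
  by move=> _; rewrite (EU j).1 (Ev i).1 flow_pump // /flux_rem [RHS]addrC subrK.
have := passive_lower_bound hL1 (ltW nu0) M0 UM pu dv nv (flux_osc_test hL1 n2)
  (flux_pot_test hL1 n2) (flux_transport hL1 n2) (flux_rem_L2 hL1 n) Uv.
have hS := flux_pot_nrm hL1 n2; have hT := flux_rem_nrm hL1 n2.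
(* The product of nu <= 64 m^6 and |grad v| <= 2 G / m^2. *)
have hnu : nu * grad_norm v <= 128 * G * n%:R^-1 ^+ 4.
  apply: le_trans (ler_pM (ltW nu0) (grad_nrm_ge0 _ _) nu1 gv) _.
  rewrite le_eqVlt; apply/orP; left; apply/eqP; field.
  by rewrite pnatr_eq0 -lt0n (leq_trans _ n2).
rewrite !sum2 => H; rewrite /passive_const.
exact: lower_bound_arith (grad_nrm_ge0 _ _) m0 hS (hT ord0 ord0) (hT ord0 ord_max)
  (hT ord_max ord0) (hT ord_max ord_max) hnu H.
Qed.

End scale.

Theorem mainTheorem3 (R : realType) (L1 : R) (hL1 : 0 < L1) :
  exists U : R -> vector_field L1,
    [/\ forall nu : R, 0 < nu < 8^-1 ->
          [/\ essentially_bounded (U nu), divergence_free (U nu) &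
              couette_bc (U nu)],
        exists C1 C2 : R, [/\ 0 < C1, 0 < C2 &
          forall nu : R, 0 < nu < 8^-1 ->
            C1 * nu `^ (3^-1) <= dissipation nu (U nu) <= C2 * nu `^ (3^-1)] &
        exists2 c : R, 0 < c &
          forall nu : R, 0 < nu < 8^-1 ->
            (exists u : vector_field L1, passive_field nu (U nu) u) /\
            (forall u : vector_field L1, passive_field nu (U nu) u ->
               c * nu `^ (3^-1) <= dissipation nu u)].
Proof.
have lc0 := layer_const_gt0 hL1; have G0 := flow_grad_bound_gt0 hL1.
have W0 := passive_const_gt0 hL1.
have key (nu : R) : exists U : vector_field L1, 0 < nu < 8^-1 ->
    exists p : R, exists n : nat, [/\ (2 <= n)%N, 0 < p, nu = p ^+ 6,
      nu `^ (3^-1) = p ^+ 2 & n%:R^-1 <= p <= 2 * n%:R^-1] /\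
    ([/\ essentially_bounded U, divergence_free U & couette_bc U] /\
    [/\ grad_norm U <= 2 * (flow_grad_bound L1 / n%:R^-1 ^+ 2),
      L1 <= grad_norm U * (2 * layer_const L1 * n%:R^-1 ^+ 2) &
      forall nu : R, 0 < nu -> nu <= 64 * n%:R^-1 ^+ 6 ->
        (exists u : vector_field L1, passive_field nu U u) /\
        (forall u : vector_field L1, passive_field nu U u ->
           L1 / 2 <= grad_norm u * (passive_const L1 * n%:R^-1 ^+ 2))]).
  have [hnu|hnu] := boolP (0 < nu < 8^-1); last first.
    (* Outside the range of nu the flow is arbitrary; that of n = 2 serves as a default, so that
       choice yields a total family. *)
    by have [U _] := flow_exists hL1 (leqnn 2); exists U.
  have [p [n [n2 p0 p6 p2 pm]]] := scale_exists hnu.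
  by have [U HU] := flow_exists hL1 n2; exists U => _; exists p, n.
have /choice[U HU] := key; exists U.
have sq (w p : R) (n : nat) (g : R) : 0 <= w -> 0 <= g -> 0 < p -> n%:R^-1 <= p ->
    g * (w * n%:R^-1 ^+ 2) <= g * (w * p ^+ 2).
  move=> w0 g0 p0 mp; rewrite ler_wpM2l // ler_wpM2l //.
  by rewrite ler_pXn2r ?nnegrE ?invr_ge0 ?ler0n ?(ltW p0).
split.
- by move=> nu /HU[p [n [_ [? _]]]].
- exists (L1 ^+ 2 / ((2 * layer_const L1) ^+ 2 * L1)), ((8 * flow_grad_bound L1) ^+ 2 / L1).
  have lc2 : 0 < 2 * layer_const L1 by exact: mulr_gt0.
  split; [by rewrite divr_gt0 ?mulr_gt0 ?exprn_gt0| |].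
    by apply: divr_gt0 => //; apply: exprn_gt0; exact: mulr_gt0.
  move=> nu /HU[p [n [[n2 p0 p6 p2 /andP[mp pm]] [_ [up lo _]]]]].
  have g0 : 0 <= grad_norm (U nu) by exact: grad_nrm_ge0.
  rewrite p2 dissipation_grad_norm //; move: (grad_norm (U nu)) g0 up lo => g g0 up lo.
  rewrite p6; apply/andP; split.
    apply: dissipation_lower => //.
    by apply: le_trans lo _; apply: sq => //; exact: ltW.
  apply: dissipation_upper => //; apply: le_trans up _.
  have m0 := pump_m_gt0 R n2.
  (* The 8 is 2 from [flow_exists] times 4 from m >= p / 2. *)
  have -> : 8 * flow_grad_bound L1 / p ^+ 2 = 2 * (flow_grad_bound L1 / (p / 2) ^+ 2).
    by field; rewrite gt_eqF.
  rewrite ler_pM2l // ler_pM2l // lef_pV2 ?posrE ?exprn_gt0 ?divr_gt0 //.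
  by rewrite ler_pXn2r // ?nnegrE ?divr_ge0 ?(ltW p0) ?(ltW m0) // ler_pdivrMr // mulrC.
- have a0 : 0 < L1 / 2 by exact: divr_gt0.
  exists ((L1 / 2) ^+ 2 / (passive_const L1 ^+ 2 * L1)).
    by rewrite divr_gt0 ?mulr_gt0 ?exprn_gt0.
  move=> nu hnu; have /andP[nu0 _] := hnu.
  have [p [n [[n2 p0 p6 p2 /andP[mp pm]] [_ [_ _ pu]]]]] := HU _ hnu.
  have m0 := pump_m_gt0 R n2.
  have nu_le : nu <= 64 * n%:R^-1 ^+ 6.
    have -> : 64 * n%:R^-1 ^+ 6 = (2 * n%:R^-1) ^+ 6 :> R by ring.
    by rewrite p6 ler_pXn2r // nnegrE ?mulr_ge0 // ltW.
  have [ex lo] := pu _ nu0 nu_le; split=> // u /lo h.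
  have g0 : 0 <= grad_norm u by exact: grad_nrm_ge0.
  rewrite p2 dissipation_grad_norm //; move: (grad_norm u) h g0 => g h g0.
  rewrite p6; apply: dissipation_lower => //.
  by apply: le_trans h _; apply: sq => //; exact: ltW.
Qed.
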